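(* Let $k=3$ or $k=4$ and let $Z_n^{(k)}$ be the $k$-th order generalized Zagreb index of a random plane recursive tree of size $n$. Then, as $n\to\infty$, $$\frac{Z_n^{(k)}}{n^{k/2}}\xrightarrow{\ d\ }Z^{(k)},$$ where $Z^{(k)}$ is a random variable whose distribution is uniquely characterized by its moment sequence $\mathbb{E}\bigl((Z^{(k)})^r\bigr)=g_{r,0}$, $r\ge0$, with $g_{r,s}$ the array defined recursively in the context.
   Context: A random plane recursive tree of size $n$ is built as follows: start with a root labeled $1$. A node with $m$ children has $m+1$ free places (before the first child, between consecutive children, after the last child). In step $i$ ($2\le i\le n$) the node labeled $i$ is attached at a free place chosen uniformly at random among all free places of all existing nodes. The children of each node are ordered from left to right. For a graph $G=(V,E)$, the $k$-th order generalized Zagreb index is $\sum_{v\in V}D_v^k$, where $D_v$ is the (graph) degree of $v$; $Z_n^{(k)}$ denotes this index for the random tree of size $n$. For fixed integer $k\ge3$, the array $(g_{r,s})_{r,s\ge0}$ is given by $$g_{0,s}=\frac{s!\sqrt\pi}{\Gamma((s+1)/2)}\quad(s\ge0),$$ for $r\ge1$ and $s>0$ $$g_{r,s}=\frac{1}{2\sqrt{\pi}\,\Gamma\left(\frac{kr+s+1}{2}\right)}\sum_{\ell=1}^{r}\binom{r}{\ell}g_{\ell,0}\,g_{r-\ell,s}\,\Gamma\left(\frac{k\ell-1}{2}\right)\Gamma\left(\frac{k(r-\ell)+s+1}{2}\right)+\frac{\Gamma\left(\frac{kr+s}{2}\right)}{\Gamma\left(\frac{kr+s+1}{2}\right)}\bigl(kr\,g_{r-1,k+s-1}+s\,g_{r,s-1}\bigr),$$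 and for $r\ge1$, $s=0$ $$g_{r,0}=\frac{1}{\sqrt{\pi}\,(kr-2)\,\Gamma\left(\frac{kr-1}{2}\right)}\sum_{\ell=1}^{r-1}\binom{r}{\ell}g_{\ell,0}\,g_{r-\ell,0}\,\Gamma\left(\frac{k\ell-1}{2}\right)\Gamma\left(\frac{k(r-\ell)+1}{2}\right)+\frac{kr\,\Gamma\left(\frac{kr}{2}-1\right)}{\Gamma\left(\frac{kr-1}{2}\right)}\,g_{r-1,k-1}.$$ *)

(* Defs.v *)
From HB Require Import structures.
From mathcomp Require Import all_boot all_order all_algebra.
From mathcomp Require Import all_classical all_reals all_analysis.

Set Implicit Arguments.
Unset Strict Implicit.
Unset Printing Implicit Defensive.

Import Order.TTheory GRing.Theory Num.Theory.
Import numFieldNormedType.Exports.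

Local Open Scope classical_set_scope.
Local Open Scope ring_scope.

Definition zagreb_index (V : finType) (e : rel V) (k : nat) : nat :=
  (\sum_(v : V) #|[pred u | e v u]| ^ k)%N.

(* A plane tree on n nodes is stored as its n lists of ordered children: the  *)
(* node labelled i is represented by the index i - 1, and the entry at an     *)
(* index lists the indices of the children of that node from left to right.   *)
(* The root has index 0.                                                      *)
Definition plane_tree : Type := seq (seq nat).

HB.instance Definition _ := Countable.on plane_tree.
HB.instance Definition _ := isPointed.Build plane_tree [:: [::]].
HB.instance Definition _ := @isMeasurable.Build default_measure_display
  plane_tree discrete_measurable discrete_measurable0
  discrete_measurableC discrete_measurableU.

Definition children (t : plane_tree) (v : nat) : seq nat := nth [::] t v.

Definition tree_edge (t : plane_tree) : rel 'I_(size t) :=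
  [rel u v | (nat_of_ord v \in children t u) ||
             (nat_of_ord u \in children t v)].

Definition tree_zagreb (k : nat) (t : plane_tree) : nat :=
  zagreb_index (@tree_edge t) k.

(* The free place (v, p) is the one of node v with exactly p children of v to *)
(* its left.                                                                  *)
Definition free_places (t : plane_tree) : seq (nat * nat) :=
  [seq (v, p) | v <- iota 0 (size t), p <- iota 0 (size (children t v)).+1].

Definition attach (t : plane_tree) (vp : nat * nat) : plane_tree :=
  let c := children t vp.1 in
  rcons (set_nth [::] t vp.1 (take vp.2 c ++ size t :: drop vp.2 c)) [::].

Definition attach_prob (R : realType) (t t' : plane_tree) : R :=
  (count (fun vp => attach t vp == t') (free_places t))%:R /
  (size (free_places t))%:R.

(* X is the n-th state of a growth process (T i)_{1 <= i <= n}. As a tree     *)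
(* determines all its predecessors in the process, conditioning on T i is the *)
(* same as conditioning on the whole history up to step i.                    *)
Definition random_plane_recursive_tree d (Omega : measurableType d)
    (R : realType) (P : probability Omega R) (n : nat)
    (X : {RV P >-> plane_tree}) : Prop :=
  exists T : nat -> {RV P >-> plane_tree},
    [/\ P [set w | T 1%N w = [:: [::]]] = 1%E,
        forall (i : nat) (t t' : plane_tree), (0 < i < n)%N ->
          P [set w | T i w = t /\ T i.+1 w = t'] =
          (P [set w | T i w = t] * (attach_prob R t t')%:E)%E
      & X = T n].

Definition normalized_zagreb (R : realType) (k n : nat) (t : plane_tree) : R :=
  (tree_zagreb k t)%:R / n%:R `^ (k%:R / 2).

Lemma measurable_normalized_zagreb (R : realType) (k n : nat) :
  measurable_fun [set: plane_tree] (@normalized_zagreb R k n).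
Proof. by []. Qed.

HB.instance Definition _ (R : realType) (k n : nat) :=
  isMeasurableFun.Build _ _ _ _ (@normalized_zagreb R k n)
    (@measurable_normalized_zagreb R k n).

Definition cvg_in_distribution (R : realType)
    (d : nat -> measure_display) (Omega : forall n, measurableType (d n))
    (P : forall n, probability (Omega n) R) (X : forall n, {RV (P n) >-> R})
    d' (Omega' : measurableType d') (Q : probability Omega' R)
    (Y : {RV Q >-> R}) : Prop :=
  forall x : R, {for x, continuous (cdf Y)} ->
    cdf (X n) x @[n --> \oo] --> cdf Y x.

Definition has_moments (R : realType) d (Omega : measurableType d)
    (P : probability Omega R) (X : {RV P >-> R}) (m : nat -> R) : Prop :=
  forall r : nat,
    P.-integrable [set: Omega] (fun w => (X w ^+ r)%:E) /\
    ('E_P[fun w => (X w ^+ r)%R] = (m r)%:E)%E.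

Section zagreb_array.
Variable R : realType.

Definition Gamma (x : R) : R :=
  \int[lebesgue_measure]_(t in `]0%R, +oo[) (t `^ (x - 1) * expR (- t)).

Variable k : nat.

Definition zagreb_rec (g : nat -> nat -> R) (r s : nat) : R :=
  if r == 0%N then s`!%:R * Num.sqrt pi / Gamma (s.+1%:R / 2)
  else if (0 < s)%N then
    (2 * Num.sqrt pi * Gamma ((k * r + s + 1)%:R / 2))^-1 *
      (\sum_(1 <= l < r.+1) 'C(r, l)%:R * g l 0%N * g (r - l)%N s *
         Gamma (((k * l)%:R - 1) / 2) *
         Gamma ((k * (r - l) + s + 1)%:R / 2)) +
    Gamma ((k * r + s)%:R / 2) / Gamma ((k * r + s + 1)%:R / 2) *
      ((k * r)%:R * g r.-1 (k + s - 1)%N + s%:R * g r s.-1)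
  else
    (Num.sqrt pi * ((k * r)%:R - 2) * Gamma (((k * r)%:R - 1) / 2))^-1 *
      (\sum_(1 <= l < r) 'C(r, l)%:R * g l 0%N * g (r - l)%N 0%N *
         Gamma (((k * l)%:R - 1) / 2) * Gamma ((k * (r - l) + 1)%:R / 2)) +
    (k * r)%:R * Gamma ((k * r)%:R / 2 - 1) / Gamma (((k * r)%:R - 1) / 2) *
      g r.-1 k.-1.

Lemma zagreb_rec_ext (g h : nat -> nat -> R) (r s : nat) : (0 < k)%N ->
  (forall r' s', (k * r' + s' < k * r + s)%N -> g r' s' = h r' s') ->
  zagreb_rec g r s = zagreb_rec h r s.
Proof.
move=> k0 gh; rewrite /zagreb_rec; case: eqP => // /eqP; rewrite -lt0n => r0.
have E : (k * r = k * r.-1 + k)%N by rewrite -mulnSr prednK.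
have lek l : (l <= r -> k * l <= k * r)%N by rewrite leq_mul2l => ->; rewrite orbT.
have ltk l : (l < r -> k * l < k * r)%N by rewrite ltn_mul2l k0.
case: ifPn => [s0|].
- congr (_ * _ + _ * (_ * _ + _ * _)).
  + apply: eq_big_nat => l /andP[l0 lr]; rewrite ltnS in lr.
    rewrite !gh//; first by rewrite ltn_add2r ltk// ltn_subrL l0.
    by rewrite addn0 (leq_ltn_trans (lek _ lr))// -[ltnLHS]addn0 ltn_add2l.
  + by apply: gh; rewrite E addnBA ?addn_gt0 ?k0// addnA subn1 prednK// addn_gt0 s0 orbT.
  + by apply: gh; rewrite ltn_add2l prednK.
- rewrite -eqn0Ngt => /eqP s0; rewrite s0 in gh; congr (_ * _ + _ * _).
  + apply: eq_big_nat => l /andP[l0 lr].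
    by rewrite !gh// ltn_add2r ltk// ltn_subrL l0.
  + by apply: gh; rewrite E addn0 ltn_add2l prednK.
Qed.

(* The recursion for g_(r,s) only calls g_(r',s') with k r' + s' < k r + s,   *)
(* hence k r + s + 1 unfoldings suffice.                                      *)
Definition zagreb_array (r s : nat) : R :=
  iter (k * r + s).+1 zagreb_rec (fun _ _ => 0) r s.

Lemma zagreb_arrayE (r s : nat) : (0 < k)%N ->
  zagreb_array r s = zagreb_rec zagreb_array r s.
Proof.
move=> k0; rewrite /zagreb_array.
suff H : forall N r' s', (k * r' + s' < N)%N ->
    iter N zagreb_rec (fun _ _ => 0) r' s' = zagreb_array r' s'.
  by rewrite iterS; apply: zagreb_rec_ext => // r' s'; apply: H.
have aux : forall m N M r' s', (k * r' + s' < m)%N -> (k * r' + s' < N)%N ->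
    (k * r' + s' < M)%N ->
    iter N zagreb_rec (fun _ _ => 0) r' s' =
    iter M zagreb_rec (fun _ _ => 0) r' s'.
  elim=> // m IH [//|N] [//|M] r' s'; rewrite !ltnS => h1 h2 h3 /=.
  by apply: zagreb_rec_ext => // r2 s2 h; apply: IH; apply: leq_trans h _.
by move=> N r' s' h; apply: (aux N).
Qed.

End zagreb_array.

(* Main.v *)
Require Import Defs.
From HB Require Import structures.
From mathcomp Require Import all_boot all_order all_algebra.
From mathcomp Require Import all_classical all_reals all_analysis.
From mathcomp Require Import measurable_realfun.
From mathcomp Require Import zify ring lra.
Set Implicit Arguments.
Unset Strict Implicit.
Unset Printing Implicit Defensive.
Import Order.TTheory GRing.Theory Num.Theory.
Import numFieldNormedType.Exports.
Local Open Scope classical_set_scope.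
Local Open Scope ring_scope.

Inductive bt (A : Type) := Leaf of A | Br of bt A & bt A.

HB.instance Definition _ (A : Type) := gen_eqMixin (bt A).

Fixpoint grow A (m : A) (t : bt A) : seq (bt A) :=
  Br (Leaf m) t ::
  (if t is Br a b then [seq Br a' b | a' <- grow m a] ++
                       [seq Br a b' | b' <- grow m b] else [::]).

Fixpoint hist (n : nat) : seq (bt nat) :=
  if n is n'.+1 then flatten [seq grow n t | t <- hist n'] else [:: Leaf 0%N].

Fixpoint shape A (t : bt A) : bt unit :=
  match t with Leaf _ => Leaf tt | Br a b => Br (shape a) (shape b) end.

Fixpoint nleaves A (t : bt A) : nat :=
  match t with Leaf _ => 1 | Br a b => nleaves a + nleaves b end%N.

Fixpoint rdeg A (t : bt A) : nat :=
  match t with Leaf _ => 0 | Br _ b => (rdeg b).+1 end%N.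

Fixpoint zag (k : nat) A (t : bt A) : nat :=
  match t with
  | Leaf _ => 0
  | Br a b => (zag k a + ((rdeg a).+1 ^ k - rdeg a ^ k)) +
              (zag k b + ((rdeg b).+1 ^ k - rdeg b ^ k))
  end%N.

Definition planted (k : nat) A (t : bt A) : nat :=
  (zag k t + ((rdeg t).+1 ^ k - rdeg t ^ k))%N.

Lemma rdeg_shape A (t : bt A) : rdeg (shape t) = rdeg t.
Proof. by elim: t => //= a _ b ->. Qed.

Lemma zag_shape k A (t : bt A) : zag k (shape t) = zag k t.
Proof. by elim: t => //= a -> b ->; rewrite !rdeg_shape. Qed.

Lemma grow_shape A (m : A) t : [seq shape x | x <- grow m t] = grow tt (shape t).
Proof.
elim: t => //= a IHa b IHb.
by rewrite map_cat -!map_comp -IHa -IHb -!map_comp.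
Qed.

Definition uhist n := [seq shape t | t <- hist n].

Lemma uhistS n : uhist n.+1 = flatten [seq grow tt t | t <- uhist n].
Proof.
rewrite /uhist /= map_flatten -!map_comp; congr flatten.
by apply: eq_map => t /=; rewrite grow_shape.
Qed.

Section decomposition.
Variable R : comNzRingType.
Implicit Types f : bt unit -> R.

Definition wsum n f : R := \sum_(t <- uhist n) f t.

Lemma wsum0 f : wsum 0 f = f (Leaf tt).
Proof. by rewrite /wsum /uhist /= big_seq1. Qed.

Lemma wsumS n f : wsum n.+1 f = wsum n (fun t => \sum_(t' <- grow tt t) f t').
Proof. by rewrite /wsum uhistS big_flatten /= big_map. Qed.

Lemma sum_grow_Br a b f : \sum_(t <- grow tt (Br a b)) f t =
  f (Br (Leaf tt) (Br a b)) + (\sum_(a' <- grow tt a) f (Br a' b) +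
    \sum_(b' <- grow tt b) f (Br a b')).
Proof. by rewrite /= big_cons big_cat !big_map. Qed.

Lemma eq_wsum n f g : f =1 g -> wsum n f = wsum n g.
Proof. by move=> fg; apply: eq_bigr => i _. Qed.

Lemma wsumD n f g : wsum n (fun t => f t + g t) = wsum n f + wsum n g.
Proof. exact: big_split. Qed.

Lemma wsum_sum n (I : Type) (r : seq I) (P : pred I) (F : I -> bt unit -> R) :
  wsum n (fun t => \sum_(i <- r | P i) F i t) = \sum_(i <- r | P i) wsum n (F i).
Proof. exact: exchange_big. Qed.

Lemma wsumZ n c f : wsum n (fun t => c * f t) = c * wsum n f.
Proof. by rewrite /wsum big_distrr. Qed.

Lemma wsumZr n c f : wsum n (fun t => f t * c) = wsum n f * c.
Proof. by rewrite /wsum big_distrl. Qed.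

Lemma wsum_Br n f : wsum n.+1 f =
  \sum_(j < n.+1) 'C(n.+1, j.+1)%:R *
    wsum j (fun a => wsum (n - j)%N (fun b => f (Br a b))).
Proof.
elim: n f => [|n IH] f.
  by rewrite wsumS wsum0 /= big_seq1 big_ord1 /= binn mul1r !wsum0.
rewrite wsumS IH.
have e1 (j : 'I_n.+1) : wsum j (fun a => wsum (n - j)%N (fun b =>
     \sum_(t <- grow tt (Br a b)) f t)) =
   wsum j (fun a => wsum (n - j)%N (fun b => f (Br (Leaf tt) (Br a b)))) +
   (wsum j.+1 (fun a => wsum (n - j)%N (fun b => f (Br a b))) +
    wsum j (fun a => wsum (n - j).+1 (fun b => f (Br a b)))).
  rewrite wsumS -!wsumD; apply: eq_wsum => a; rewrite wsumS.
  have -> : \sum_(t' <- grow tt a) wsum (n - j)%N (fun b => f (Br t' b)) =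
      wsum (n - j)%N (fun b => \sum_(t' <- grow tt a) f (Br t' b)).
    by rewrite wsum_sum.
  by rewrite -!wsumD; apply: eq_wsum => b; rewrite sum_grow_Br.
under eq_bigr do rewrite e1 !mulrDr.
rewrite !big_split /= -(IH (fun t => f (Br (Leaf tt) t))).
pose G j := wsum j (fun a => wsum (n.+1 - j)%N (fun b => f (Br a b))).
transitivity (G 0%N + (\sum_(j < n.+1) 'C(n.+1, j.+1)%:R * G j.+1 +
   \sum_(j < n.+1) 'C(n.+1, j.+1)%:R * G j)).
  congr (_ + (_ + _)); first by rewrite /G wsum0 subn0.
  apply: eq_bigr => j _; rewrite /G subSn // -ltnS.
  exact: ltn_ord.
rewrite -/(G _) [RHS](eq_bigr (fun j : 'I_n.+2 =>
  'C(n.+1, j.+1)%:R * G j + 'C(n.+1, j)%:R * G j)); last first.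
  by move=> j _; rewrite binS natrD mulrDl.
rewrite big_split /= [X in _ = X + _]big_ord_recr /= bin_small // mul0r addr0.
rewrite [X in _ = _ + X]big_ord_recl /= bin0 mul1r.
by rewrite addrA addrC; congr (_ + _); rewrite addrC.
Qed.
End decomposition.

Section decoding.

Fixpoint root (t : bt nat) : nat :=
  match t with Leaf a => a | Br _ b => root b end.

Fixpoint labels (t : bt nat) : seq nat :=
  match t with Leaf a => [:: a] | Br a b => labels a ++ labels b end.

Fixpoint kids (t : bt nat) (v : nat) : seq nat :=
  match t with
  | Leaf _ => [::]
  | Br a b => nseq (v == root b) (root a) ++ (kids a v ++ kids b v)
  end.

Definition decode (n : nat) (t : bt nat) : plane_tree := mkseq (kids t) n.

Definition shift_place (r : nat) (x : nat * nat) :=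
  (x.1, if x.1 == r then x.2.+1 else x.2).

Fixpoint growp (m : nat) (t : bt nat) : seq (bt nat * (nat * nat)) :=
  (Br (Leaf m) t, (root t, 0%N)) ::
  (if t is Br a b then
     [seq (Br y.1 b, y.2) | y <- growp m a] ++
     [seq (Br a y.1, shift_place (root b) y.2) | y <- growp m b]
   else [::]).

Lemma growp1 m t : [seq y.1 | y <- growp m t] = grow m t.
Proof.
elim: t => //= a IHa b IHb.
by rewrite map_cat -!map_comp -IHa -IHb -!map_comp.
Qed.

Lemma root_labels t : root t \in labels t.
Proof. by elim: t => [a|a _ b IH] /=; rewrite ?inE // mem_cat IH orbT. Qed.

Lemma kids0 t v : v \notin labels t -> kids t v = [::].
Proof.
elim: t => //= a IHa b IHb; rewrite mem_cat negb_or => /andP[va vb].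
rewrite IHa // IHb // !cats0; case: eqP => // e; move: vb.
by rewrite e root_labels.
Qed.

Lemma kids_labels t v : {subset kids t v <= labels t}.
Proof.
elim: t => //= a IHa b IHb u; rewrite !mem_cat => /or3P[|/IHa->//|/IHb->]; last first.
  by rewrite orbT.
by case: (v == root b); rewrite ?inE // => /eqP ->; rewrite root_labels.
Qed.

Lemma size_kids_root t : uniq (labels t) -> size (kids t (root t)) = rdeg t.
Proof.
elim: t => //= a _ b IH; rewrite cat_uniq => /and3P[_ /hasPn ab ub].
rewrite eqxx /= kids0 ?cat0s ?IH //.
by apply: ab; exact: root_labels.
Qed.

Lemma root_kids t v : uniq (labels t) -> root t \notin kids t v.
Proof.
elim: t => //= a _ b IH; rewrite cat_uniq => /and3P[_ /hasPn ab ub].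
have nb := ab _ (root_labels b).
rewrite !mem_cat !negb_or IH // andbT; apply/andP; split; last first.
  by apply: contra nb => /kids_labels.
case: (v == root b) => //; rewrite inE; apply: contra nb => /eqP ->.
exact: root_labels.
Qed.

Lemma growpP m t y : uniq (labels t) -> m \notin labels t -> y \in growp m t ->
  [/\ perm_eq (labels y.1) (m :: labels t), root y.1 = root t,
      y.2.1 \in labels t, (y.2.2 <= size (kids t y.2.1))%N &
      forall u, kids y.1 u = if u == y.2.1 then
        take y.2.2 (kids t u) ++ m :: drop y.2.2 (kids t u) else kids t u].
Proof.
elim: t y => [a|a IHa b IHb] y /=.
  move=> _; rewrite !inE => ma /eqP -> /=; rewrite eqxx; split=> //.
  by move=> u; case: (u == a).
rewrite cat_uniq mem_cat negb_or => /and3P[ua /hasPn ab ub] /andP[ma mb].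
have dis v : v \in labels a -> v \notin labels b.
  by move=> va; apply/negP => /ab; rewrite va.
rewrite inE => /orP[/eqP -> /=|].
  split=> //; first by rewrite mem_cat root_labels orbT.
  by move=> u; case: eqP => // ->; rewrite take0 drop0.
rewrite mem_cat => /orP[] /mapP[[y' [v p]]] yin -> /=.
  have [lab ry va pk kid] := IHa _ ua ma yin; rewrite /= in lab ry va pk kid *.
  have vb := dis _ va.
  have vr : (v == root b) = false.
    by apply/negP => /eqP e; move: vb; rewrite e root_labels.
  split=> //=.
  - by rewrite -cat_cons perm_cat2r.
  - by rewrite mem_cat va.
  - by rewrite vr (kids0 vb) cats0.
  - move=> u; rewrite kid ry; case: (eqVneq u v) => [-> | _] //.
    by rewrite vr (kids0 vb) !cats0.
have [lab ry vb pk kid] := IHb _ ub mb yin; rewrite /= in lab ry vb pk kid *.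
have va := ab _ vb.
split=> //=.
- apply: (@perm_trans _ (labels a ++ [:: m] ++ labels b)).
    by rewrite perm_cat2l.
  by rewrite perm_catCA.
- by rewrite mem_cat vb orbT.
- by rewrite (kids0 va); case: (v == root b).
- move=> u; rewrite kid ry; case: (eqVneq u v) => [-> | _] //.
  by rewrite (kids0 va); case: (v == root b).
Qed.

Lemma shift_place_inj r : injective (shift_place r).
Proof.
move=> [u p] [v q] [e]; rewrite e; case: (v == r); first by case=> ->.
by move=> ->.
Qed.

Fixpoint places (t : bt nat) : seq (nat * nat) :=
  (root t, 0%N) ::
  (if t is Br a b then places a ++ [seq shift_place (root b) x | x <- places b]
   else [::]).

Lemma growp2 m t : [seq y.2 | y <- growp m t] = places t.
Proof.
elim: t => //= a IHa b IHb.
by rewrite map_cat -!map_comp -IHa -IHb -!map_comp.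
Qed.

Lemma mem_places t x : uniq (labels t) ->
  (x \in places t) = (x.1 \in labels t) && (x.2 <= size (kids t x.1))%N.
Proof.
elim: t x => [a|a IHa b IHb] [v p] /=.
  by rewrite !inE xpair_eqE leqn0.
rewrite cat_uniq => /and3P[ua /hasPn ab ub].
rewrite inE mem_cat IHa //= mem_cat xpair_eqE !size_cat size_nseq.
have -> : ((v, p) \in [seq shift_place (root b) x | x <- places b]) =
    [&& v \in labels b, (v == root b) <= p & p <= (v == root b) + size (kids b v)]%N.
  apply/mapP/and3P => [[[w q]]|[vb rp pk]].
    rewrite IHb //= => /andP[wb qk] [-> ->]; split=> //; case: (w == root b) => //.
  exists (v, if v == root b then p.-1 else p).
    rewrite IHb //= vb /=; case: (v == root b) rp pk => //.
    by case: p.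
  rewrite /shift_place /=; case: (v == root b) rp pk => // p0 _.
  by rewrite prednK.
have [vb|vb] := boolP (v \in labels b).
  rewrite (kids0 (ab _ vb)) (negbTE (ab _ vb)) /= add0n.
  by case: (v == root b) => //=; case: p.
have /negbTE -> : v != root b.
  by apply: contra vb => /eqP ->; rewrite root_labels.
by rewrite (kids0 vb) /= addn0 add0n !orbF.
Qed.

Lemma uniq_places t : uniq (labels t) -> uniq (places t).
Proof.
elim: t => //= a IHa b IHb; rewrite cat_uniq => /and3P[ua /hasPn ab ub].
rewrite mem_cat negb_or mem_places //= (negbTE (ab _ (root_labels b))) /=.
rewrite cat_uniq IHa // map_inj_uniq ?IHb //; last exact: shift_place_inj.
rewrite andbT /=.
apply/andP; split.
  apply/mapP => -[[w q] _] [-> /esym]; rewrite eqxx //.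
apply/hasPn => x /mapP[[w q]]; rewrite mem_places //= => /andP[wb _] ->.
by rewrite mem_places //= (negbTE (ab _ wb)).
Qed.

Definition well_labelled n t := perm_eq (labels t) (iota 0 n).

Lemma well_labelled_uniq n t : well_labelled n t -> uniq (labels t).
Proof. by move/perm_uniq => ->; exact: iota_uniq. Qed.

Lemma well_labelled_mem n t v : well_labelled n t -> (v \in labels t) = (v < n)%N.
Proof. by move/perm_mem => ->; rewrite mem_iota add0n. Qed.

Lemma children_decode n t v : well_labelled n t -> children (decode n t) v = kids t v.
Proof.
move=> wt; rewrite /children /decode.
have [vn|nv] := ltnP v n; first by rewrite nth_mkseq.
by rewrite nth_default ?size_mkseq // kids0 // (well_labelled_mem _ wt) -leqNgt.
Qed.

Lemma perm_free_places n t : well_labelled n t ->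
  perm_eq (free_places (decode n t)) (places t).
Proof.
move=> wt; have ul := well_labelled_uniq wt; apply: uniq_perm.
- apply: allpairs_uniq_dep; first exact: iota_uniq.
  + by move=> i _; exact: iota_uniq.
  + by move=> [i j] [i' j'] _ _ /= [-> ->].
- exact: uniq_places.
- move=> [v p]; rewrite mem_places //= (well_labelled_mem _ wt).
  apply/allpairsPdep/andP => [[v' [p' [+ + [-> ->]]]]|[vn pk]].
    by rewrite !mem_iota size_mkseq !add0n ltnS /= (children_decode _ wt).
  exists v, p; rewrite !mem_iota size_mkseq !add0n ltnS /= (children_decode _ wt).
  by split.
Qed.

Lemma attach_decode n t y : well_labelled n t -> y \in growp n t ->
  attach (decode n t) y.2 = decode n.+1 y.1.
Proof.
move=> wt yin; have ul := well_labelled_uniq wt.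
have nl : n \notin labels t by rewrite (well_labelled_mem _ wt) ltnn.
have [_ _ vl pk kid] := growpP ul nl yin.
rewrite (well_labelled_mem _ wt) in vl.
have sz : size (set_nth [::] (decode n t) y.2.1 (take y.2.2 (kids t y.2.1) ++
     n :: drop y.2.2 (kids t y.2.1))) = n.
  by rewrite size_set_nth size_mkseq (maxn_idPr _).
rewrite /attach (children_decode _ wt) size_mkseq.
apply: (@eq_from_nth _ [::]); first by rewrite size_rcons sz size_mkseq.
move=> u; rewrite size_rcons sz => un.
rewrite nth_mkseq // nth_rcons sz nth_set_nth /= kid.
have [un'|nu] := ltnP u n; first by rewrite nth_mkseq //; case: eqP => // ->.
have -> : u = n by apply/eqP; rewrite eqn_leq nu -ltnS un.
by rewrite eqxx (gtn_eqF vl) kids0.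
Qed.

Lemma grow_well_labelled n t t' : well_labelled n t -> t' \in grow n t ->
  well_labelled n.+1 t'.
Proof.
move=> wt; rewrite -growp1 => /mapP[y yin ->].
have nl : n \notin labels t by rewrite (well_labelled_mem _ wt) ltnn.
have [pl _ _ _ _] := growpP (well_labelled_uniq wt) nl yin.
apply: (perm_trans pl); rewrite -[n.+1]addn1 iotaD /= add0n.
by rewrite perm_sym perm_catC /= perm_cons perm_sym.
Qed.

Lemma hist_well_labelled n t : t \in hist n -> well_labelled n.+1 t.
Proof.
elim: n t => [|n IH] t; first by rewrite inE => /eqP ->.
by case/flatten_mapP => t0 /IH wt; exact: grow_well_labelled.
Qed.

Lemma perm_attach n t : well_labelled n t ->
  perm_eq [seq attach (decode n t) vp | vp <- free_places (decode n t)]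
          [seq decode n.+1 t' | t' <- grow n t].
Proof.
move=> wt; apply: (perm_trans (perm_map _ (perm_free_places wt))).
rewrite -growp1 -(growp2 n) -!map_comp.
set l1 := map _ _; set l2 := map _ _.
suff -> : l1 = l2 by rewrite perm_refl.
by apply/eq_in_map => y; exact: attach_decode.
Qed.

(** degrees *)
Definition deg (t : bt nat) (v : nat) : nat :=
  count (fun u => (u \in kids t v) || (v \in kids t u)) (labels t).

Lemma deg_Brl a b v : uniq (labels (Br a b)) -> v \in labels a ->
  deg (Br a b) v = (deg a v + (v == root a))%N.
Proof.
rewrite /= cat_uniq => /and3P[ua /hasPn ab ub] va.
have dis u : u \in labels a -> u \notin labels b.
  by move=> ua'; apply/negP => /ab; rewrite ua'.
have nr u : u \in labels a -> (u == root b) = false.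
  by move=> /dis; apply: contraNF => /eqP ->; exact: root_labels.
rewrite /deg /= count_cat nr //= (kids0 (dis _ va)) cats0; congr (_ + _)%N.
  apply: eq_in_count => u ul; rewrite (nr _ ul) (kids0 (dis _ ul)) cats0 //.
under eq_in_count => u ub'.
  rewrite (kids0 (ab _ ub')) /= mem_cat.
  have -> : (u \in kids a v) = false.
    by apply: contraNF (ab _ ub') => /kids_labels.
  have -> : (v \in kids b u) = false.
    by apply: contraNF (dis _ va) => /kids_labels.
  over.
rewrite (eq_count (a2 := fun u => (v == root a) && (u == root b))); last first.
  by move=> u; rewrite /= orbF; case: (u == root b); rewrite ?inE ?andbT ?andbF.
case: (v == root a) => /=; last by rewrite count_pred0.
by rewrite (count_uniq_mem _ ub) root_labels.
Qed.

Lemma deg_Brr a b v : uniq (labels (Br a b)) -> v \in labels b ->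
  deg (Br a b) v = (deg b v + (v == root b))%N.
Proof.
rewrite /= cat_uniq => /and3P[ua /hasPn ab ub] vb.
have dis u : u \in labels a -> u \notin labels b.
  by move=> ua'; apply/negP => /ab; rewrite ua'.
have nr u : u \in labels a -> (u == root b) = false.
  by move=> /dis; apply: contraNF => /eqP ->; exact: root_labels.
rewrite /deg /= count_cat addnC (kids0 (ab _ vb)) /=; congr (_ + _)%N.
  apply: eq_in_count => u ul; rewrite (kids0 (ab _ ul)) /= !mem_cat.
  have -> : (u \in nseq (v == root b) (root a)) = false.
    apply: contraNF (ab _ ul); case: (v == root b) => //.
    by rewrite inE => /eqP ->; exact: root_labels.
  have -> : (v \in nseq (u == root b) (root a)) = false.
    apply: contraNF (ab _ vb); case: (u == root b) => //.
    by rewrite inE => /eqP ->; exact: root_labels.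
  by [].
under eq_in_count => u ul.
  rewrite (nr _ ul) (kids0 (dis _ ul)) cats0 mem_cat.
  have -> : (u \in kids b v) = false.
    by apply: contraNF (dis _ ul) => /kids_labels.
  have -> : (v \in kids a u) = false.
    by apply: contraNF (ab _ vb) => /kids_labels.
  over.
rewrite (eq_count (a2 := fun u => (v == root b) && (u == root a))); last first.
  by move=> u; rewrite /= !orbF; case: (v == root b); rewrite ?inE.
case: (v == root b) => /=; last by rewrite count_pred0.
by rewrite (count_uniq_mem _ ua) root_labels.
Qed.

Lemma deg_rootE t : uniq (labels t) -> deg t (root t) = rdeg t.
Proof.
elim: t => [a _|a _ b IHb] //=; move=> ul.
rewrite (deg_Brr ul) ?root_labels // eqxx addn1 IHb //.
by move: ul; rewrite /= cat_uniq => /and3P[].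
Qed.

Lemma sum_deg_shift k t : uniq (labels t) ->
  (\sum_(v <- labels t) (deg t v + (v == root t)) ^ k =
   \sum_(v <- labels t) deg t v ^ k + ((rdeg t).+1 ^ k - rdeg t ^ k))%N.
Proof.
move=> ul; rewrite !(bigD1_seq (root t)) ?root_labels //= eqxx deg_rootE //.
have -> : (\sum_(v <- labels t | v != root t) (deg t v + (v == root t)) ^ k =
   \sum_(v <- labels t | v != root t) deg t v ^ k)%N.
  by apply: eq_bigr => v /negbTE ->; rewrite addn0.
have : (rdeg t ^ k <= (rdeg t).+1 ^ k)%N.
  by case: k => // k; rewrite leq_exp2r.
by rewrite addn1; move: (_ ^ _)%N (_ ^ _)%N => x y; lia.
Qed.

Lemma sum_deg k t : (0 < k)%N -> uniq (labels t) ->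
  (\sum_(v <- labels t) deg t v ^ k = zag k t)%N.
Proof.
move=> k0; elim: t => [a _|a IHa b IHb ul] /=; first by rewrite big_seq1 /deg /= exp0n.
have := ul; rewrite /= cat_uniq => /and3P[ua _ ub].
rewrite big_cat /= -IHa // -IHb // -!sum_deg_shift //.
congr (_ + _)%N; rewrite !big_seq; apply: eq_bigr => v vl.
  by rewrite deg_Brl.
by rewrite deg_Brr.
Qed.

Lemma tree_zagreb_seq k (T : plane_tree) : tree_zagreb k T =
  (\sum_(v <- iota 0 (size T)) (count (fun u => (u \in children T v) ||
     (v \in children T u)) (iota 0 (size T))) ^ k)%N.
Proof.
have e n : iota 0 n = index_iota 0 n by rewrite /index_iota subn0.
have cnt n (P : pred nat) : #|[pred u : 'I_n | P u]| = count P (iota 0 n).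
  by rewrite -sum1_card -sum1_count e big_mkord.
rewrite /tree_zagreb /zagreb_index.
under eq_bigr => v _ do rewrite (cnt _ (fun u => (u \in children T v) ||
  (nat_of_ord v \in children T u))).
by rewrite [X in _ = bigop _ X _]e big_mkord.
Qed.

Lemma tree_zagreb_decode k n t : (0 < k)%N -> well_labelled n t ->
  tree_zagreb k (decode n t) = zag k t.
Proof.
move=> k0 wt; rewrite tree_zagreb_seq size_mkseq -sum_deg ?(well_labelled_uniq wt) //.
rewrite (perm_big _ wt) /=; apply: eq_bigr => v _; congr (_ ^ _)%N.
rewrite /deg (permP wt); apply: eq_count => u; rewrite !(children_decode _ wt).
by [].
Qed.

End decoding.

Section series.
Variable R : realType.
Implicit Types f g h : nat -> R.

Definition conv f g (n : nat) : R := \sum_(j < n.+1) f j * g (n - j)%N.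

Definition sderiv f (n : nat) : R := n.+1%:R * f n.+1.

Definition sint f (n : nat) : R := if n is m.+1 then f m / m.+1%:R else 0.

Definition binser (a : R) (n : nat) : R := \prod_(i < n) ((a + i%:R) / i.+1%:R).

Let trunc N f : {poly R} := \poly_(i < N) f i.

Let conv_trunc N f g n : (n < N)%N -> conv f g n = (trunc N f * trunc N g)`_n.
Proof.
move=> nN; rewrite coefM; apply: eq_bigr => j _; rewrite !coef_poly.
rewrite (leq_ltn_trans _ nN) ?(leq_ltn_trans _ nN) ?leq_subr // -ltnS.
exact: ltn_ord.
Qed.

Lemma convC f g : conv f g = conv g f.
Proof. by apply/funext => n; rewrite !(@conv_trunc n.+1) // mulrC. Qed.

Lemma convA f g h : conv f (conv g h) = conv (conv f g) h.
Proof.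
apply/funext => n.
transitivity ((trunc n.+1 f * (trunc n.+1 g * trunc n.+1 h))`_n).
  rewrite coefM; apply: eq_bigr => j _.
  by rewrite (@conv_trunc n.+1) ?ltnS ?leq_subr // coef_poly ltn_ord.
rewrite mulrA coefM; apply: eq_bigr => j _.
rewrite (@conv_trunc n.+1 f g j) ?ltn_ord // coef_poly.
by rewrite ltnS leq_subr.
Qed.

Lemma eq_conv f f' g g' n : (forall j, (j <= n)%N -> f j = f' j) ->
  (forall j, (j <= n)%N -> g j = g' j) -> conv f g n = conv f' g' n.
Proof.
move=> ff gg; apply: eq_bigr => j _; rewrite ff -1?ltnS ?ltn_ord //.
by rewrite gg ?leq_subr.
Qed.

Lemma convDr f g h n : conv f (fun i => g i + h i) n = conv f g n + conv f h n.
Proof. by rewrite -big_split; apply: eq_bigr => j _ /=; rewrite mulrDr. Qed.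

Lemma convDl f g h n : conv (fun i => g i + h i) f n = conv g f n + conv h f n.
Proof. by rewrite !(convC _ f) convDr. Qed.

Lemma convZr c f g n : conv f (fun i => c * g i) n = c * conv f g n.
Proof. by rewrite big_distrr; apply: eq_bigr => j _ /=; rewrite mulrCA. Qed.

Lemma convZl c f g n : conv (fun i => c * f i) g n = c * conv f g n.
Proof. by rewrite !(convC _ g) convZr. Qed.

Lemma binser0 n : binser 0 n = (n == 0%N)%:R.
Proof. by case: n => [|n]; rewrite /binser ?big_ord0 // big_ord_recl add0r mul0r mul0r. Qed.

Lemma binserS a n : binser a n.+1 = binser a n * ((a + n%:R) / n.+1%:R).
Proof. by rewrite /binser big_ord_recr. Qed.

Lemma conv1s f n : conv (binser 0) f n = f n.
Proof.
rewrite /conv big_ord_recl binser0 /= mul1r subn0 big1 ?addr0 // => i _.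
by rewrite binser0 mul0r.
Qed.

Lemma sderiv_conv f g n :
  sderiv (conv f g) n = conv (sderiv f) g n + conv f (sderiv g) n.
Proof.
have dtr h j : (j < n.+1)%N -> (trunc n.+2 h)^`()`_j = sderiv h j.
  by move=> jn; rewrite coef_deriv coef_poly ltnS jn -mulr_natl.
rewrite /sderiv (@conv_trunc n.+2) // mulr_natl -coef_deriv derivM coefD !coefM.
congr (_ + _); apply: eq_bigr => j _.
  rewrite dtr ?ltn_ord // coef_poly.
  by rewrite (leq_ltn_trans (leq_subr _ _)) // ltnW.
rewrite dtr ?ltnS ?leq_subr // coef_poly.
by rewrite (leq_trans (ltn_ord j)).
Qed.

Lemma binser_unique a f : f 0%N = 1 ->
  (forall n, sderiv f n = (a + n%:R) * f n) -> f = binser a.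
Proof.
move=> f0 fS; apply/funext; elim=> [|n IH]; first by rewrite f0 /binser big_ord0.
by rewrite binserS -IH mulrA (mulrC (f n)) -fS /sderiv mulrC mulKf.
Qed.

Lemma sderiv_binser a n : sderiv (binser a) n = (a + n%:R) * binser a n.
Proof. by rewrite /sderiv binserS mulrC -mulrA divfK ?pnatr_eq0 // mulrC. Qed.

Lemma conv_binser a b : conv (binser a) (binser b) = binser (a + b).
Proof.
apply: binser_unique => [|n].
  by rewrite /conv big_ord1 /binser !big_ord0 mulr1.
rewrite sderiv_conv /conv big_distrr -big_split; apply: eq_bigr => j _ /=.
rewrite !sderiv_binser natrB -1?ltnS ?ltn_ord //; ring.
Qed.

Lemma sderivK f : sint (sderiv f) = fun n => f n - f 0%N * (n == 0%N)%:R.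
Proof.
apply/funext => -[|n] /=; first by rewrite mulr1 subrr.
by rewrite mulr0 subr0 /sderiv mulrC mulKf ?pnatr_eq0.
Qed.

Lemma sintK f : sderiv (sint f) = f.
Proof. by apply/funext => n; rewrite /sderiv /= mulrC divfK ?pnatr_eq0. Qed.

Lemma sint_binser a n : a != 1 -> sint (binser a) n.+1 = binser (a - 1) n.+1 / (a - 1).
Proof.
move=> a1; have a0 : a - 1 != 0 by rewrite subr_eq0.
rewrite /= /binser big_ord_recl /= addr0 [in RHS]mulrC !mulrA mulVf // mul1r.
have -> : \prod_(i < n) ((a - 1 + (bump 0 i)%:R) / i.+2%:R) =
    \prod_(i < n) ((a + i%:R) / i.+1%:R) / n.+1%:R :> R.
  elim: n => [|n IH]; first by rewrite !big_ord0 divr1.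
  rewrite !big_ord_recr /= IH /bump /= add1n.
  have n1 : n.+1%:R != 0 :> R by rewrite pnatr_eq0.
  have n2 : n.+2%:R != 0 :> R by rewrite pnatr_eq0.
  rewrite -!natr1 in n1 n2 *; field; rewrite n1 n2 //.
by rewrite invr1 mul1r.
Qed.

End series.

Section asymptotics.
Variable R : realType.
Implicit Types (f g : nat -> R) (a b : R).

Lemma binser_gt0 a n : 0 < a -> 0 < binser a n.
Proof.
move=> a0; apply: prodr_gt0 => i _; rewrite divr_gt0 // ltr_pwDl //.
Qed.


Lemma cvg_divnS (b : R) : b / n.+1%:R @[n --> \oo] --> (0 : R).
Proof.
rewrite -(mulr0 b); apply: cvgM; first exact: cvg_cst.
exact: cvg_harmonic.
Qed.

Lemma cvg_divDn a : 0 < a -> a / (a + n%:R) @[n --> \oo] --> (0 : R).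
Proof.
move=> a0; apply: (squeeze_cvgr _ (cvg_cst 0) (cvg_divnS (a + 1))).
near=> n; apply/andP; split; first by rewrite divr_ge0 ?addr_ge0 // ltW.
rewrite ler_pdivrMr ?ltr_pwDl // mulrAC ler_pdivlMr //.
rewrite -natr1; have : 0 <= n%:R :> R by []; nra.
Unshelve. all: by end_near. Qed.

Lemma binser_lower a : 0 < a -> binser a n / binser (a + 2^-1) n @[n --> \oo] --> (0 : R).
Proof.
move=> a0; have a2 : 0 < a + 2^-1 by rewrite addr_gt0.
have sq n : (binser a n / binser (a + 2^-1) n) ^+ 2 <= a / (a + n%:R).
  elim: n => [|n IH]; first by rewrite /binser !big_ord0 divr1 expr1n addr0 divff ?gt_eqF.
  have n0 : 0 <= n%:R :> R by [].
  rewrite !binserS.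
  have -> : binser a n * ((a + n%:R) / n.+1%:R) /
      (binser (a + 2^-1) n * ((a + 2^-1 + n%:R) / n.+1%:R)) =
      (binser a n / binser (a + 2^-1) n) * ((a + n%:R) / (a + 2^-1 + n%:R)).
    move: (gt_eqF (binser_gt0 n a2)); move: (binser _ _) (binser _ _) => A B /negbT B0.
    have : a + 2^-1 + n%:R != 0 by rewrite gt_eqF ?ltr_pwDl.
    have : n.+1%:R != 0 :> R by rewrite pnatr_eq0.
    move: (a + n%:R) (a + _ + _) (n.+1%:R) => p q d d0 q0.
    by field; rewrite B0 d0 q0.
  rewrite exprMn; apply: (le_trans (ler_wpM2r (sqr_ge0 _) IH)).
  have -> : a / (a + n%:R) * ((a + n%:R) / (a + 2^-1 + n%:R)) ^+ 2 =
     a * (a + n%:R) / (a + 2^-1 + n%:R) ^+ 2.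
    have : a + 2^-1 + n%:R != 0 by rewrite gt_eqF ?ltr_pwDl.
    have : a + n%:R != 0 by rewrite gt_eqF ?ltr_pwDl.
    move: (a + n%:R) (a + _ + _) => p q p0 q0.
    by field; rewrite p0 q0.
  rewrite -natr1 ler_pdivrMr ?exprn_gt0 ?ltr_pwDl // mulrAC ler_pdivlMr ?ltr_pwDl //.
  by rewrite -subr_ge0 (_ : _ - _ = a / 4) ?divr_ge0 ?ltW //; field.
have sq0 : (binser a n / binser (a + 2^-1) n) ^+ 2 @[n --> \oo] --> (0 : R).
  apply: (squeeze_cvgr _ (cvg_cst 0) (cvg_divDn a0)).
  by near=> n; rewrite sqr_ge0 sq.
rewrite -[X in _ --> X](sqrtr0 R); suff -> : (fun n => binser a n / binser (a + 2^-1) n) =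
    (fun n => Num.sqrt ((binser a n / binser (a + 2^-1) n) ^+ 2)).
  by apply: continuous_cvg sq0; exact: sqrt_continuous.
apply/funext => n.
by rewrite sqrtr_sqr ger0_norm // divr_ge0 // ltW ?binser_gt0.
Unshelve. all: by end_near. Qed.

Lemma binser_shift a : 0 < a -> binser a n / binser a n.+1 @[n --> \oo] --> (1 : R).
Proof.
move=> a0.
have -> : (fun n => binser a n / binser a n.+1) =
    (fun n => 1 + (1 - a) / a * (a / (a + n%:R))).
  apply/funext => n; rewrite binserS.
  have n0 : 0 <= n%:R :> R by [].
  have n1 : n.+1%:R != 0 :> R by rewrite pnatr_eq0.
  rewrite -natr1 in n1 *.
  have : a + n%:R != 0 by rewrite gt_eqF ?ltr_pwDl.
  move: (gt_eqF a0) (gt_eqF (binser_gt0 n a0)) => /negbT a0' /negbT b0' c0.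
  by field; rewrite n1 a0' b0' c0.
rewrite -[X in _ --> X]addr0 -[X in _ --> _ + X](mulr0 ((1 - a) / a)).
apply: cvgD; first exact: cvg_cst.
by apply: cvgM; [exact: cvg_cst|exact: cvg_divDn].
Qed.

Definition asy a (be : R) f := f n / binser a n @[n --> \oo] --> be.

Lemma asy_lower a be f : 0 < a -> asy a be f -> asy (a + 2^-1) 0 f.
Proof.
move=> a0 F; rewrite /asy -(mulr0 be).
have -> : (fun n => f n / binser (a + 2^-1) n) =
  (fun n => (f n / binser a n) * (binser a n / binser (a + 2^-1) n)).
  by apply/funext => n; rewrite mulrA divfK // gt_eqF ?binser_gt0.
by apply: cvgM => //; exact: binser_lower.
Qed.

Lemma asy_lowern a be f i : 0 < a -> asy a be f -> asy (a + i.+1%:R / 2) 0 f.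
Proof.
move=> a0; elim: i be => [|i IH] be F.
  by rewrite mul1r; exact: asy_lower F.
rewrite -natr1 mulrDl mul1r addrA; apply: asy_lower (IH _ F).
by rewrite addr_gt0 // divr_gt0.
Qed.

Lemma half_gt0 p : 0 < p.+1%:R / 2 :> R. Proof. exact: divr_gt0. Qed.

Lemma toeplitz_weight p b j : 0 < b ->
  binser b n / binser (b + p.+1%:R / 2) (n + j) @[n --> \oo] --> (0 : R).
Proof.
move=> b0; have ab0 := addr_gt0 b0 (half_gt0 p).
elim: j => [|j IH].
  under eq_fun do rewrite addn0.
  apply: (@asy_lowern b 1) => //; rewrite /asy.
  by under eq_fun do rewrite divff ?gt_eqF ?binser_gt0 //; exact: cvg_cst.
rewrite -(mul0r 1).
have -> : (fun n => binser b n / binser (b + p.+1%:R / 2) (n + j.+1)) =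
  (fun n => binser b n / binser (b + p.+1%:R / 2) (n + j) *
   (binser (b + p.+1%:R / 2) (n + j) / binser (b + p.+1%:R / 2) (n + j).+1)).
  apply/funext => n; rewrite addnS mulrA divfK // gt_eqF ?binser_gt0 //.
apply: cvgM IH _.
rewrite (cvg_shiftn j (fun n => binser _ n / binser (b + p.+1%:R / 2) n.+1)).
exact: binser_shift.
Qed.

Lemma toeplitz p b (u : nat -> R) : 0 < b -> u n @[n --> \oo] --> (0 : R) ->
  conv (fun j => binser (p.+1%:R / 2) j * `|u j|) (binser b) n / binser (b + p.+1%:R / 2) n
    @[n --> \oo] --> (0 : R).
Proof.
set a := p.+1%:R / 2 => b0 u0; have a0 : 0 < a := half_gt0 p.
have ab0 := addr_gt0 b0 a0.
have [K K0 uK] : exists2 K, 0 < K & forall j, `|u j| <= K.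
  have /cvg_seq_bounded [K [_ /(_ (K + 1))]] : cvgn u by apply/cvg_ex; exists 0.
  rewrite ltrDl ltr01 => /(_ isT) H; exists (`|K + 1| + 1); first by rewrite ltr_wpDl.
  by move=> j; rewrite (le_trans (H j I)) // (le_trans (ler_norm _)) // lerDl.
pose W j n : R := binser a j * (if (j <= n)%N then binser b (n - j) else 0) / binser (b + a) n.
have W0 j : W j n @[n --> \oo] --> (0 : R).
  have H : binser a j * (binser b n / binser (b + a) (n + j)) @[n --> \oo] --> (0 : R).
    by rewrite -[X in _ --> X](mulr0 (binser a j)); apply: cvgMl_tmp; exact: toeplitz_weight.
  rewrite -(cvg_shiftn j); suff -> : (fun n => W j (n + j)%N) =
    (fun n => binser a j * (binser b n / binser (b + a) (n + j))) by [].
  by apply/funext => n; rewrite /W leq_addl addnK mulrA.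
have Wge j n : 0 <= W j n.
  rewrite /W; case: ifP => _; rewrite ?mulr0 ?mul0r //.
  by rewrite divr_ge0 ?mulr_ge0 ?ltW ?binser_gt0.
have W1 n : \sum_(j < n.+1) W j n = 1.
  have d : binser (b + a) n != 0 by rewrite gt_eqF ?binser_gt0.
  rewrite /W -big_distrl /= -[RHS](divff d); congr (_ / _).
  rewrite addrC -conv_binser; apply: eq_bigr => j _.
  by rewrite -ltnS ltn_ord.
have E n : conv (fun j => binser a j * `|u j|) (binser b) n / binser (b + a) n =
    \sum_(j < n.+1) W j n * `|u j|.
  rewrite /conv big_distrl; apply: eq_bigr => j _ /=.
  have jn : (j <= n)%N by rewrite -ltnS ltn_ord.
  by rewrite /W jn; ring.
apply/cvgrPdist_le => e e0.
have e2 : 0 < e / 2 by rewrite divr_gt0.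
have [N _ HN] : \forall n \near \oo, `|u n| <= e / 2.
  move/cvgrPdist_le : u0 => /(_ _ e2); apply: filterS => n.
  by rewrite sub0r normrN.
have S0 : K * (\sum_(j < N) W j n) @[n --> \oo] --> (0 : R).
  rewrite -[X in _ --> X](mulr0 K); apply: cvgMl_tmp.
  elim: (N) => [|M IH]; first by under eq_fun do rewrite big_ord0; exact: cvg_cst.
  have -> : (fun n => \sum_(j < M.+1) W j n) = (fun n => \sum_(j < M) W j n + W M n).
    by apply/funext => n; rewrite big_ord_recr.
  by rewrite -[X in _ --> X]addr0; apply: cvgD.
have : \forall n \near \oo, K * (\sum_(j < N) W j n) <= e / 2.
  move/cvgrPdist_le : S0 => /(_ _ e2); apply: filterS => n.
  by rewrite sub0r normrN => /(le_trans (ler_norm _)).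
apply: filterS => n Hn; rewrite sub0r normrN E ger0_norm; last first.
  by apply: sumr_ge0 => j _; rewrite mulr_ge0.
have -> : e = e / 2 * 1 + e / 2 by field.
rewrite -[X in e / 2 * X](W1 n); apply: le_trans (lerD (lexx _) Hn).
apply: (@le_trans _ _ (\sum_(j < n.+1) (e / 2 * W j n + (if (j < N)%N then K * W j n else 0)))).
  apply: ler_sum => j _; case: ltnP => jN.
    apply: ler_wpDl; first by rewrite mulr_ge0 // ltW.
    by rewrite mulrC; apply: ler_wpM2r.
  by rewrite addr0 mulrC; apply: ler_wpM2r => //; exact: HN.
rewrite big_split /= -big_distrr /= lerD2l -big_mkcond /= big_distrr /=.
have G j : 0 <= K * W j n by rewrite mulr_ge0 // ltW.
rewrite -(big_mkord (fun j => j < N)%N (fun j => K * W j n)).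
rewrite -(big_mkord xpredT (fun j => K * W j n)).
rewrite (big_nat_widen _ _ (n.+1 + N)) ?leq_addr // [leRHS](big_nat_widen _ _ (n.+1 + N)) ?leq_addl //.
rewrite [leLHS]big_mkcond [leRHS]big_mkcond; apply: ler_sum => j _ /=.
by case: (j < N)%N => //=; case: ifP.
Qed.

Lemma asy_conv p q al be f g : asy (p.+1%:R / 2) al f -> asy (q.+1%:R / 2) be g ->
  asy (p.+1%:R / 2 + q.+1%:R / 2) (al * be) (conv f g).
Proof.
set a := p.+1%:R / 2; set b := q.+1%:R / 2.
have a0 : 0 < a := half_gt0 p; have b0 : 0 < b := half_gt0 q.
move=> fa gb.
have ab0 : 0 < a + b by rewrite addr_gt0.
pose u j := f j / binser a j; pose v j := g j / binser b j.
have fE j : f j = binser a j * u j by rewrite mulrC divfK // gt_eqF ?binser_gt0.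
have gE j : g j = binser b j * v j by rewrite mulrC divfK // gt_eqF ?binser_gt0.
have [K K0 vK] : exists2 K, 0 < K & forall j, `|v j| <= K.
  have /cvg_seq_bounded [K [_ /(_ (K + 1))]] : cvgn v by apply/cvg_ex; exists be.
  rewrite ltrDl ltr01 => /(_ isT) H; exists (`|K + 1| + 1); first by rewrite ltr_wpDl.
  by move=> j; rewrite (le_trans (H j I)) // (le_trans (ler_norm _)) // lerDl.
have u0 : u n - al @[n --> \oo] --> (0 : R) by apply/subr_cvg0.
have v0 : v n - be @[n --> \oo] --> (0 : R) by apply/subr_cvg0.
have T1 := toeplitz p b0 u0; have T2 := toeplitz q a0 v0.
rewrite -/a -/b (addrC b a) in T1 T2.
rewrite /asy; apply/subr_cvg0; apply/norm_cvg0P.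
have T3 : K * (conv (fun j => binser a j * `|u j - al|) (binser b) n / binser (a + b) n) +
   `|al| * (conv (fun j => binser b j * `|v j - be|) (binser a) n / binser (a + b) n)
   @[n --> \oo] --> (0 : R).
  rewrite -[X in _ --> X]addr0 -[X in _ --> X + _](mulr0 K) -[X in _ --> _ + X](mulr0 `|al|).
  by apply: cvgD; apply: cvgM => //; exact: cvg_cst.
apply: (squeeze_cvgr _ (cvg_cst 0) T3); near=> n; rewrite normr_ge0 /=.
have -> : conv f g n / binser (a + b) n - al * be =
    (conv f g n - al * be * conv (binser a) (binser b) n) / binser (a + b) n.
  by rewrite conv_binser mulrBl mulfK // gt_eqF ?binser_gt0.
have c0 : 0 < binser (a + b) n by exact: binser_gt0.
have -> : forall x, `|x / binser (a + b) n| = `|x| / binser (a + b) n.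
  by move=> x; rewrite normrM normfV [`|binser _ _|]gtr0_norm.
rewrite (mulrA K) (mulrA `|al|) -[leRHS]mulrDl.
rewrite ler_pM2r ?invr_gt0 //.
rewrite (convC (fun j => binser b j * _) (binser a)) /conv !big_distrr /= -sumrB -big_split /=.
apply: (le_trans (ler_norm_sum _ _ _)); apply: ler_sum => j _.
rewrite fE gE; set x := binser a j; set y := binser b _.
have x0 : 0 <= x by rewrite ltW ?binser_gt0.
have y0 : 0 <= y by rewrite ltW ?binser_gt0.
have -> : x * u j * (y * v (n - j)%N) - al * be * (x * y) =
  (x * y) * ((u j - al) * v (n - j)%N + al * (v (n - j)%N - be)) by ring.
rewrite normrM ger0_norm ?mulr_ge0 //.
have -> : K * (x * `|u j - al| * y) + `|al| * (x * (y * `|v (n - j)%N - be|)) =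
  (x * y) * (`|u j - al| * K + `|al| * `|v (n - j)%N - be|) by ring.
apply: ler_wpM2l; first exact: mulr_ge0.
by rewrite (le_trans (ler_normD _ _)) // (normrM (u j - al)) (normrM al) lerD2r ler_wpM2l.
Unshelve. all: by end_near. Qed.

Lemma asyD a be ga f g : asy a be f -> asy a ga g -> asy a (be + ga) (fun n => f n + g n).
Proof. by move=> F G; rewrite /asy; under eq_fun do rewrite mulrDl; exact: cvgD. Qed.

Lemma asyZ a be c f : asy a be f -> asy a (c * be) (fun n => c * f n).
Proof. by move=> F; rewrite /asy; under eq_fun do rewrite -mulrA; apply: cvgM => //; exact: cvg_cst. Qed.

Lemma asy_near a be f g : asy a be f -> (forall n, f n.+1 = g n.+1) -> asy a be g.
Proof.
move=> + fg; rewrite /asy -(cvg_shiftS (fun n => f n / binser a n)).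
rewrite -(cvg_shiftS (fun n => g n / binser a n)).
suff -> : (fun n => f n.+1 / binser a n.+1) = (fun n => g n.+1 / binser a n.+1) by [].
by apply/funext => n; rewrite fg.
Qed.

Lemma asy_sum a (I : Type) (r : seq I) (P : pred I) (be : I -> R) (F : I -> nat -> R) :
  (forall i, P i -> asy a (be i) (F i)) ->
  asy a (\sum_(i <- r | P i) be i) (fun n => \sum_(i <- r | P i) F i n).
Proof.
move=> H; elim: r => [|i r IH].
  rewrite big_nil; rewrite /asy; under eq_fun do rewrite big_nil mul0r; exact: cvg_cst.
rewrite big_cons.
have -> : (fun n => \sum_(j <- i :: r | P j) F j n) =
  (fun n => if P i then F i n + \sum_(j <- r | P j) F j n else \sum_(j <- r | P j) F j n).
  by apply/funext => n; rewrite big_cons.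
case: ifP => // Pi; exact: asyD (H _ Pi) IH.
Qed.

Lemma asy_sint a be f : 1 < a -> asy a be f -> asy (a - 1) (be / (a - 1)) (sint f).
Proof.
move=> a1 F.
have a10 : a - 1 != 0 by rewrite subr_eq0 gt_eqF.
have b0 n : 0 < binser (a - 1) n by rewrite binser_gt0 // subr_gt0.
rewrite /asy -(cvg_shiftS (fun n => sint f n / binser (a - 1) n)).
suff -> : (fun n => sint f n.+1 / binser (a - 1) n.+1) = (fun n => (f n / binser a n) / (a - 1)).
  by apply: cvgM => //; exact: cvg_cst.
apply/funext => n /=.
have := @sint_binser _ a n; rewrite subr_eq0 in a10 *.
rewrite a10 => /(_ isT) /= E.
have -> : binser (a - 1) n.+1 = (a - 1) * (binser a n / n.+1%:R).
  by rewrite E mulrC divfK // subr_eq0.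
have c0 : binser a n != 0 by rewrite gt_eqF // binser_gt0 // (lt_trans ltr01).
rewrite -subr_eq0 in a10.
have n1 : n.+1%:R != 0 :> R by rewrite pnatr_eq0.
by move: (n.+1%:R) n1 => N n1; field; rewrite n1 c0 a10.
Qed.

Lemma asy_sderiv a be f : 0 < a -> asy a be f -> asy (a + 1) (a * be) (sderiv f).
Proof.
move=> a0; rewrite /asy -(cvg_shiftS (fun n => f n / binser a n)) => F.
suff -> : (fun n => sderiv f n / binser (a + 1) n) = (fun n => a * (f n.+1 / binser a n.+1)).
  exact: cvgMl_tmp.
apply/funext => n.
have a1 : a + 1 != 1 by rewrite -subr_eq0 addrK gt_eqF.
have := sint_binser n a1; rewrite /= addrK => E.
have -> : binser (a + 1) n = n.+1%:R * (binser a n.+1 / a).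
  by rewrite -E mulrC divfK // pnatr_eq0.
have n1 : n.+1%:R != 0 :> R by rewrite pnatr_eq0.
have c0 : binser a n.+1 != 0 by rewrite gt_eqF // binser_gt0.
have a0' : a != 0 by rewrite gt_eqF.
by rewrite /sderiv; move: (n.+1%:R) n1 => N n1; field; rewrite n1 c0 a0'.
Qed.

End asymptotics.

Section moments.
Variable R : realType.
Implicit Types (f : bt unit -> R) (r s n l : nat).

Definition egf f n : R := wsum n f / (n`!%:R * 2 ^+ n).

Lemma eq_egf f g : f =1 g -> egf f = egf g.
Proof. by move=> fg; apply/funext => n; rewrite /egf (eq_wsum _ fg). Qed.

Lemma egf_sum (I : Type) (r : seq I) (P : pred I) (c : I -> R) (F : I -> bt unit -> R) n :
  egf (fun t => \sum_(i <- r | P i) c i * F i t) n = \sum_(i <- r | P i) c i * egf (F i) n.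
Proof.
rewrite /egf wsum_sum big_distrl; apply: eq_bigr => i _ /=.
by rewrite wsumZ mulrA.
Qed.

Lemma egf_Br (u v : bt unit -> R) f n : (forall a b, f (Br a b) = u a * v b) ->
  egf f n.+1 = conv (sint (egf u)) (egf v) n.+1 / 2.
Proof.
move=> fuv; rewrite /egf wsum_Br.
rewrite [in RHS]/conv [in RHS]big_ord_recl /= mul0r add0r !big_distrl; apply: eq_bigr => j _ /=.
have jn : (j <= n)%N by rewrite -ltnS ltn_ord.
rewrite /bump /= !add1n subSS.
under eq_wsum do under eq_wsum do rewrite fuv.
under eq_wsum do rewrite wsumZ.
rewrite wsumZr.
have E : 'C(n.+1, j.+1)%:R * (j.+1%:R * j`!%:R * (n - j)`!%:R) = n.+1`!%:R :> R.
  by rewrite -!natrM -factS -(@bin_fact n.+1 j.+1) // subSS.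
have -> : (2 : R) ^+ n.+1 = 2 ^+ j * 2 ^+ (n - j) * 2.
  by rewrite -exprD subnKC // exprSr.
have F1 : j`!%:R != 0 :> R by rewrite pnatr_eq0 -lt0n fact_gt0.
have F2 : (n - j)`!%:R != 0 :> R by rewrite pnatr_eq0 -lt0n fact_gt0.
have F3 : j.+1%:R != 0 :> R by rewrite pnatr_eq0.
have F4 : n.+1`!%:R != 0 :> R by rewrite pnatr_eq0 -lt0n fact_gt0.
have F5 i : (2 : R) ^+ i != 0 by rewrite expf_neq0.
have F6 := F5 j; have F7 := F5 (n - j)%N.
move: E F1 F2 F3 F4 F6 F7.
move: (2 ^+ j) (2 ^+ (n - j)) (n.+1`!%:R) (j.+1%:R) (j`!%:R) ((n-j)`!%:R) ('C(_, _)%:R).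
move=> p2 q2 nf js jf nj cc <- F1 F2 F3 F4 F6 F7.
have F8 : cc != 0 by apply: contraNneq F4 => ->; rewrite mul0r.
by field; rewrite F7 F6 F1 F3 F2 F8.
Qed.

Lemma size_grow (t : bt unit) : size (grow tt t) = (2 * nleaves t).-1.
Proof.
elim: t => //= a IHa b IHb; rewrite size_cat !size_map IHa IHb.
have p (t : bt unit) : (0 < nleaves t)%N by elim: t => //= x p y _; rewrite addn_gt0 p.
by move: (nleaves a) (nleaves b) (p a) (p b) => x y; lia.
Qed.

Lemma nleaves_grow (t t' : bt unit) : t' \in grow tt t -> nleaves t' = (nleaves t).+1.
Proof.
elim: t t' => [[]|a IHa b IHb] t' /=; first by rewrite inE => /eqP ->.
rewrite inE mem_cat => /or3P[/eqP -> //|/mapP[x /IHa e ->]|/mapP[x /IHb e ->]] /=;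
  by rewrite e ?addnS ?addSn.
Qed.

Lemma nleaves_uhist n t : t \in uhist n -> nleaves t = n.+1.
Proof.
elim: n t => [|n IH] t; first by rewrite inE => /eqP ->.
by rewrite uhistS => /flatten_mapP[x /IH e] /nleaves_grow ->; rewrite e.
Qed.

Lemma egf1 : egf (fun=> 1) = binser (1 / 2 : R).
Proof.
apply: binser_unique => [|n]; first by rewrite /egf wsum0 expr0 !mulr1 divr1.
rewrite /sderiv /egf wsumS.
have -> : wsum n (fun t => \sum_(t' <- grow tt t) 1 : R) = (2 * n).+1%:R * wsum n (fun=> 1).
  rewrite -wsumZ /wsum !big_seq; apply: eq_bigr => t /nleaves_uhist tn.
  rewrite big_const_seq count_predT iter_addr_0 size_grow tn mulr1.
  by congr (_%:R); lia.
have F1 : n`!%:R != 0 :> R by rewrite pnatr_eq0 -lt0n fact_gt0.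
have F3 : n.+1%:R != 0 :> R by rewrite pnatr_eq0.
have F5 : (2 : R) ^+ n != 0 by rewrite expf_neq0.
rewrite factS natrM exprS -[(2 * n).+1]addn1 natrD natrM.
move: (wsum _ _) => W; rewrite -natr1 in F3 *.
by field; rewrite F1 F3 F5.
Qed.

Variable k : nat.

Definition mom r s := egf (fun t => (zag k t)%:R ^+ r * (rdeg t)%:R ^+ s).

Definition pmom r s := egf (fun t => (planted k t)%:R ^+ r * (rdeg t).+1%:R ^+ s).

Definition smom l n := sint (pmom l 0) n / 2.

Lemma pmom00 : pmom 0 0 = binser (1 / 2 : R).
Proof. by rewrite -egf1; apply: eq_egf => t; rewrite !expr0 mulr1. Qed.

Lemma mom00 : mom 0 0 = binser (1 / 2 : R).
Proof. by rewrite -egf1; apply: eq_egf => t; rewrite !expr0 mulr1. Qed.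

Lemma smom0 n : smom 0 n = binser (0 : R) n - binser (- (1 / 2) : R) n.
Proof.
case: n => [|n]; first by rewrite /smom /= mul0r /binser !big_ord0 subrr.
rewrite /smom pmom00 sint_binser; last by apply/eqP => H; lra.
rewrite binser0 /= sub0r (_ : 1 / 2 - 1 = - (1 / 2)); last by field.
by field.
Qed.

Lemma mom_decomposition r s n : mom r s n = 0 ^+ (r + s) * (n == 0%N)%:R +
  \sum_(l < r.+1) 'C(r, l)%:R * conv (smom l) (pmom (r - l) s) n.
Proof.
case: n => [|n].
  rewrite /mom /egf wsum0 /= expr0 !mulr1 divr1 -exprD big1 ?addr0 // => l _.
  by rewrite /conv big_ord1 /smom /= mul0r mul0r mulr0.
rewrite mulr0 add0r /mom.
pose F (l : 'I_r.+1) (t : bt unit) : R := if t is Br a b then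
  (planted k a)%:R ^+ l * ((planted k b)%:R ^+ (r - l) * (rdeg b).+1%:R ^+ s) else 0.
have -> : forall m, egf (fun t => (zag k t)%:R ^+ r * (rdeg t)%:R ^+ s) m.+1 =
  egf (fun t => \sum_(l < r.+1) 'C(r, l)%:R * F l t) m.+1.
  move=> m; rewrite /egf !wsum_Br; congr (_ / _); apply: eq_bigr => j _; congr (_ * _).
  apply: eq_wsum => a; apply: eq_wsum => b /=.
  rewrite -/(planted k a) -/(planted k b) natrD addrC exprDn big_distrl.
  by apply: eq_bigr => l _ /=; rewrite -mulr_natl; ring.
rewrite egf_sum; apply: eq_bigr => l _; congr (_ * _).
rewrite (@egf_Br (fun t => (planted k t)%:R ^+ l) (fun t => (planted k t)%:R ^+ (r - l) * (rdeg t).+1%:R ^+ s)) //.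
rewrite mulrC -convZl; apply: eq_conv => // j _.
rewrite /smom mulrC; congr (_ / _); congr (sint _ _).
by apply: eq_egf => t; rewrite expr0 mulr1.
Qed.

Hypothesis k3 : (2 < k)%N.
Variable beta : nat -> nat -> R.
Hypothesis beta00 : beta 0 0 = 1.
Hypothesis betaS : forall r s, (0 < s)%N -> beta r s =
  s%:R * beta r s.-1 + (k * r)%:R * beta r.-1 (k + s - 1) +
  \sum_(1 <= l < r.+1) 'C(r, l)%:R * (beta l 0 / ((k * l)%:R - 1)) * beta (r - l) s.
Hypothesis beta0 : forall r, (0 < r)%N -> beta r 0 * ((k * r)%:R - 2) / ((k * r)%:R - 1) =
  (k * r)%:R * beta r.-1 k.-1 +
  \sum_(1 <= l < r) 'C(r, l)%:R * (beta l 0 / ((k * l)%:R - 1)) * beta (r - l) 0.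

Definition mom_asy r s := asy ((k * r + s).+1%:R / 2) (beta r s) (mom r s).

Definition pmom_asy r s := asy ((k * r + s).+1%:R / 2) (beta r s) (pmom r s).

Lemma asy_lower_half (p q : nat) be (f : nat -> R) : (p < q)%N -> asy (p.+1%:R / 2 : R) be f ->
  asy (q.+1%:R / 2 : R) 0 f.
Proof.
move=> pq F; have -> : q.+1%:R / 2 = p.+1%:R / 2 + (q - p).-1.+1%:R / 2 :> R.
  by rewrite -mulrDl -natrD prednK ?subn_gt0 //; congr (_%:R / _); lia.
by apply: asy_lowern F; exact: half_gt0.
Qed.

Lemma asy_poly r d (p : {poly R}) : (size p <= d.+1)%N ->
  (forall j, (j <= d)%N -> mom_asy r j) ->
  asy ((k * r + d).+1%:R / 2) (p`_d * beta r d)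
    (egf (fun t => (zag k t)%:R ^+ r * p.[(rdeg t)%:R])).
Proof.
move=> sp H.
have -> : egf (fun t => (zag k t)%:R ^+ r * p.[(rdeg t)%:R]) =
    (fun n => p`_d * mom r d n + \sum_(j < d) p`_j * mom r j n).
  apply/funext => n.
  rewrite (_ : _ + _ = \sum_(j < d.+1) p`_j * mom r j n); last by rewrite big_ord_recr addrC.
  rewrite -egf_sum; congr (_ n); apply: eq_egf => t; rewrite (horner_coef_wide _ sp) big_distrr.
  by apply: eq_bigr => j _ /=; rewrite mulrCA.
rewrite -[X in asy _ X _]addr0; apply: asyD; first exact/asyZ/H.
suff : asy ((k * r + d).+1%:R / 2) (\sum_(j < d) (0 : R))
    (fun n => \sum_(j < d) p`_j * mom r j n) by rewrite big1.
apply: asy_sum => j _; rewrite -[X in asy _ X _](mulr0 p`_j).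
apply: asyZ; apply: asy_lower_half (H j _); last exact/ltnW/ltn_ord.
by rewrite ltn_add2l.
Qed.

Let U : {poly R} := ('X + 1) ^+ k - 'X ^+ k.

Lemma size_coef_XD1n s : (size (('X + 1) ^+ s : {poly R})%R <= s.+1)%N.
Proof.
apply/leq_sizeP => j js; rewrite addrC exprDn coef_sum big1 // => i _.
rewrite expr1n mul1r coefMn coefXn; case: eqP => [e|_]; last by rewrite mul0rn.
by move: (ltn_ord i); rewrite -e ltnS leqNgt js.
Qed.

Lemma coef_XD1n s j : (('X + 1) ^+ s : {poly R})`_j = 'C(s, j)%:R.
Proof.
rewrite addrC exprDn coef_sum; have [js|sj] := leqP j s.
  rewrite (bigD1 (Ordinal (js : (j < s.+1)%N))) //= big1 ?addr0.
    by rewrite expr1n mul1r coefMn coefXn eqxx.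
  move=> i ij; rewrite expr1n mul1r coefMn coefXn.
  case: eqP => [e|_]; last by rewrite mul0rn.
  by move: ij; rewrite -val_eqE /= -e eqxx.
rewrite bin_small // big1 // => i _; rewrite expr1n mul1r coefMn coefXn.
case: eqP => [e|_]; last by rewrite mul0rn.
by move: (ltn_ord i); rewrite -e ltnS leqNgt sj.
Qed.

Lemma coefM_top (p q : {poly R}) m n : (size p <= m.+1)%N -> (size q <= n.+1)%N ->
  (p * q)`_(m + n) = p`_m * q`_n.
Proof.
move=> sp sq; have mn : (m < (m + n).+1)%N by rewrite ltnS leq_addr.
rewrite coefM (bigD1 (Ordinal mn)) //= addKn big1 ?addr0 // => i im.
have [mi|im'] := ltnP m i; first by rewrite (leq_sizeP _ _ sp _ mi) mul0r.
have {im'} im' : (i < m)%N by rewrite ltn_neqAle im' andbT; move: im; rewrite -val_eqE.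
by rewrite (leq_sizeP _ _ sq) ?mulr0 //; lia.
Qed.

Lemma size_diff_pow s : (size (('X + 1) ^+ s - 'X ^+ s : {poly R})%R <= s)%N.
Proof.
apply/leq_sizeP => j js; rewrite coefB coef_XD1n coefXn.
case: eqP js => [-> _|/eqP ne js]; first by rewrite binn subrr.
by rewrite bin_small ?subr0 // ltn_neqAle eq_sym ne.
Qed.

Lemma coef_diff_pow s : (('X + 1) ^+ s.+1 - 'X ^+ s.+1 : {poly R})`_s = s.+1%:R.
Proof.
by rewrite coefB coef_XD1n coefXn ltn_eqF // subr0 binSn.
Qed.

Lemma plantedE (t : bt unit) : (planted k t)%:R = (zag k t)%:R + U.[(rdeg t)%:R] :> R.
Proof.
rewrite /planted natrD natrB ?leq_exp2r ?(ltn_trans _ k3) //.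
by rewrite /U !hornerE natr1 !natrX.
Qed.

Definition incr r s n := pmom r s n - mom r s n.

Lemma incrE r s n : incr r s n =
  egf (fun t => (zag k t)%:R ^+ r * (('X + 1) ^+ s - 'X ^+ s : {poly R}).[(rdeg t)%:R]) n +
  \sum_(i < r) 'C(r, i.+1)%:R *
    egf (fun t => (zag k t)%:R ^+ (r - i.+1) * (U ^+ i.+1 * ('X + 1) ^+ s).[(rdeg t)%:R]) n.
Proof.
rewrite -egf_sum /incr /pmom /mom /egf -mulrBl -mulrDl; congr (_ / _).
apply/eqP; rewrite subr_eq -!wsumD; apply/eqP; apply: eq_wsum => t.
rewrite plantedE exprDn big_ord_recl /= subn0 expr0 mulr1 bin0 mulr1n mulrDl.
rewrite -natr1 [RHS]addrAC; congr (_ + _).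
  by rewrite !hornerE; ring.
rewrite big_distrl; apply: eq_bigr => i _ /=.
by rewrite /bump /= add1n -mulr_natl !hornerE.
Qed.

Lemma asy_incr r s : (0 < k * r + s)%N ->
  (forall r' s', (k * r' + s' < k * r + s)%N -> mom_asy r' s') ->
  asy ((k * r + s)%:R / 2) (s%:R * beta r s.-1 + (k * r)%:R * beta r.-1 (k + s - 1))
    (incr r s).
Proof.
move=> rs0 IH; rewrite (funext (incrE r s)); apply: asyD.
  case: s rs0 IH => [|s] rs0 IH.
    rewrite mul0r !expr0 subrr.
    have -> : egf (fun t => (zag k t)%:R ^+ r * (0 : {poly R}).[(rdeg t)%:R]) = (fun=> 0).
      apply/funext => n; rewrite /egf.
      by under eq_wsum do rewrite horner0 mulr0; rewrite /wsum big1 // mul0r.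
    rewrite /asy; have -> : (fun n => 0 / binser ((k * r + 0)%:R / 2) n) = (fun=> 0 : R).
      by apply/funext => n; rewrite mul0r.
    exact: cvg_cst.
  rewrite addnS -[X in asy _ (X * _) _]coef_diff_pow; apply: asy_poly.
    exact: size_diff_pow.
  by move=> j js; apply: IH; rewrite addnS ltnS leq_add2l.
have kk i : (i.+1 <= r -> k * (r - i.+1) + ((k.-1 * i.+1) + s) = k * r + s - i.+1)%N.
  by move=> ir; rewrite mulnBr; nia.
have T (i : 'I_r) : asy ((k * (r - i.+1) + (k.-1 * i.+1 + s)).+1%:R / 2)
     ((U ^+ i.+1 * ('X + 1) ^+ s)`_(k.-1 * i.+1 + s) * beta (r - i.+1) (k.-1 * i.+1 + s))
   (egf (fun t => (zag k t)%:R ^+ (r - i.+1) * (U ^+ i.+1 * ('X + 1) ^+ s).[(rdeg t)%:R])).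
  have ir := ltn_ord i.
  apply: asy_poly => [|j jd].
    apply: (leq_trans (size_polyMleq _ _)).
    have h1 := size_poly_exp_leq U i.+1.
    have h2 := size_coef_XD1n s; have h3 := size_diff_pow k.
    rewrite -/U in h3.
    apply: (@leq_trans ((k.-1 * i.+1).+1 + s.+1).-1); last by rewrite addnS addSn.
    rewrite -!subn1 leq_sub2r // leq_add // (leq_trans h1) // ltnS leq_mul2r.
    by apply/orP; right; rewrite -!subn1 leq_sub2r.
  apply: IH; rewrite (leq_ltn_trans (_ : _ <= k * (r - i.+1) + ((k.-1 * i.+1) + s))%N) //.
    by rewrite leq_add2l.
  rewrite kk // ltn_subrL //.
case: r rs0 IH kk T => [|r] rs0 IH kk T.
  rewrite muln0 mul0r /asy.
  have -> : (fun n => (\sum_(i < 0) 'C(0, i.+1)%:R *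
    egf (fun t => (zag k t)%:R ^+ (0 - i.+1) * (U ^+ i.+1 * ('X + 1) ^+ s).[(rdeg t)%:R]) n) /
    binser ((0 + s)%:R / 2) n) = (fun=> 0 : R).
    by apply/funext => n; rewrite big_ord0 mul0r.
  exact: cvg_cst.
have -> : (k * r.+1)%:R * beta r.+1.-1 (k + s - 1) =
   \sum_(i < r.+1) (if i == ord0 then (k * r.+1)%:R * beta r (k + s - 1) else 0).
  by rewrite big_ord_recl big1 ?addr0.
apply: asy_sum => i _; case: eqP => [->|/eqP i0].
  have := T ord0; rewrite kk // expr1 muln1 coefM_top ?size_coef_XD1n //; last first.
    by rewrite prednK ?(ltn_trans _ k3) // size_diff_pow.
  have [k' kE] : exists k', k = k'.+1 by exists k.-1; rewrite prednK // (ltn_trans _ k3).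
  rewrite coef_XD1n binn mulr1 /U kE coef_diff_pow -/U -kE /= subSS subn0.
  have -> : ((k * r.+1 + s - 1).+1 = k * r.+1 + s)%N by rewrite -subSn ?subSS ?subn0.
  have -> : (k.-1 + s = k + s - 1)%N by rewrite kE /= addSn subSS subn0.
  rewrite bin1 natrM [_ * r.+1%:R]mulrC -mulrA => H; exact: asyZ.
rewrite -[X in asy _ X _](mulr0 'C(r.+1, i.+1)%:R); apply: asyZ.
have := T i; rewrite kk // => H.
have -> : (k * r.+1 + s = (k * r.+1 + s).-1.+1)%N by rewrite prednK.
apply: asy_lower_half H.
have {}i0 : (0 < i)%N by rewrite lt0n; move: i0; rewrite -val_eqE.
have h : (3 * r.+1 <= k * r.+1)%N by rewrite leq_mul2r k3 orbT.
by move: (k * r.+1)%N h (ltn_ord i) => x h1 h2; lia.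
Qed.

Lemma pmom_asy_of r s : (0 < k * r + s)%N ->
  (forall r' s', (k * r' + s' < k * r + s)%N -> mom_asy r' s') ->
  mom_asy r s -> pmom_asy r s.
Proof.
move=> rs0 IH M; have L := asy_incr rs0 IH.
rewrite /pmom_asy -[X in asy _ X _]addr0.
have -> : pmom r s = (fun n => mom r s n + incr r s n).
  by apply/funext => n; rewrite /incr addrC subrK.
apply: asyD => //; rewrite -(prednK rs0) in L *; exact: asy_lower_half L.
Qed.

Lemma asy_smom l : (0 < l)%N -> pmom_asy l 0 ->
  asy ((k * l - 1)%:R / 2) (beta l 0 / ((k * l)%:R - 1)) (smom l).
Proof.
move=> l0; rewrite /pmom_asy addn0 => P.
have kl : (3 <= k * l)%N by rewrite (leq_trans k3) // leq_pmulr.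
have kl1 : (k * l)%:R - 1 != 0 :> R.
  by rewrite subr_eq0 pnatr_eq1; lia.
have a1 : 1 < (k * l).+1%:R / 2 :> R.
  by rewrite ltr_pdivlMr // mul1r ltr_nat; lia.
have := asy_sint a1 P.
have -> : (k * l).+1%:R / 2 - 1 = (k * l - 1)%:R / 2 :> R.
  by rewrite natrB ?(leq_trans _ kl) // -natr1; field.
move=> /(asyZ (c := 2^-1)).
have -> : 2^-1 * (beta l 0 / ((k * l - 1)%:R / 2)) = beta l 0 / ((k * l)%:R - 1).
  by rewrite natrB ?(leq_trans _ kl) //; move: (_%:R) kl1 => x x1; field; exact: x1.
have -> : (fun n => 2^-1 * sint (pmom l 0) n) = smom l by apply/funext => n; rewrite mulrC.
by [].
Qed.

Lemma pmom_eq r s n : (0 < r + s)%N -> conv (binser (- (1 / 2) : R)) (pmom r s) n =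
  incr r s n + \sum_(1 <= l < r.+1) 'C(r, l)%:R * conv (smom l) (pmom (r - l) s) n.
Proof.
move=> rs; have E := mom_decomposition r s n.
rewrite expr0n gtn_eqF // mul0r add0r big_ord_recl bin0 mul1r subn0 in E.
have -> : conv (binser (- (1 / 2) : R)) (pmom r s) n = pmom r s n - conv (smom 0) (pmom r s) n.
  apply/eqP; rewrite eq_sym subr_eq -convDl -[X in X == _]conv1s; apply/eqP.
  by apply: eq_conv => // j _; rewrite smom0 addrC subrK.
by rewrite /incr E big_add1 big_mkord opprD addrA subrK.
Qed.

Lemma conv_half_inv (f : nat -> R) :
  conv (binser (1 / 2)) (conv (binser (- (1 / 2))) f) = f.
Proof.
rewrite convA conv_binser subrr; apply/funext => n; exact: conv1s.
Qed.

Lemma asy_binser a : 0 < a -> asy a (1 : R) (binser a).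
Proof.
move=> a0; rewrite /asy; have -> : (fun n => binser a n / binser a n) = (fun=> 1).
  by apply/funext => n; rewrite divff // gt_eqF // binser_gt0.
exact: cvg_cst.
Qed.

Lemma asy_convolutions r s m : (m <= r.+1)%N -> (0 < s)%N || (m <= r)%N ->
  (forall r' s', (k * r' + s' < k * r + s)%N -> pmom_asy r' s') ->
  asy ((k * r + s)%:R / 2)
   (\sum_(1 <= l < m) 'C(r, l)%:R * (beta l 0 / ((k * l)%:R - 1)) * beta (r - l) s)
   (fun n => \sum_(1 <= l < m) 'C(r, l)%:R * conv (smom l) (pmom (r - l) s) n).
Proof.
move=> mr ms IH; rewrite big_seq_cond.
have -> : (fun n => \sum_(1 <= l < m) 'C(r, l)%:R * conv (smom l) (pmom (r - l) s) n) =
  (fun n => \sum_(l <- index_iota 1 m | (l \in index_iota 1 m) && true)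
     'C(r, l)%:R * conv (smom l) (pmom (r - l) s) n).
  by apply/funext => n; rewrite big_seq_cond.
apply: asy_sum => l; rewrite andbT mem_index_iota => /andP[l0 lm].
have lr : (l <= r)%N by rewrite -ltnS (leq_trans lm).
have kl : (3 <= k * l)%N by rewrite (leq_trans k3) // leq_pmulr.
have klr : (k * l <= k * r)%N by rewrite leq_mul2l lr orbT.
rewrite -mulrA; apply: asyZ.
have P1 : pmom_asy l 0.
  apply: IH; rewrite addn0; case/orP: ms => [s0|mr'].
    by rewrite (leq_ltn_trans klr) // -[ltnLHS]addn0 ltn_add2l.
  rewrite (@leq_trans (k * r)) ?leq_addr // ltn_mul2l (ltn_trans _ k3) //=.
  exact: leq_trans lm mr'.
have P2 : pmom_asy (r - l) s.
  by apply: IH; rewrite ltn_add2r ltn_mul2l (ltn_trans _ k3) //=; lia.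
have S1 := asy_smom l0 P1.
have e : (k * l - 1 = (k * l - 2).+1)%N by lia.
rewrite e in S1; have := asy_conv S1 P2.
rewrite -e -mulrDl -natrD.
have -> // : (k * l - 1 + (k * (r - l) + s).+1 = k * r + s)%N.
by rewrite mulnBr; lia.
Qed.

Lemma moments_asy_step r s : (0 < r + s)%N ->
  (forall r' s', (k * r' + s' < k * r + s)%N -> mom_asy r' s' /\ pmom_asy r' s') ->
  pmom_asy r s.
Proof.
move=> rs IH.
have k0 : (0 < k)%N by rewrite (ltn_trans _ k3).
have rs0 : (0 < k * r + s)%N by move: rs; rewrite !addn_gt0 muln_gt0 k0.
have L := asy_incr rs0 (fun r' s' h => (IH r' s' h).1).
have eh : 1 / 2 + (k * r + s)%:R / 2 = (k * r + s).+1%:R / 2 :> R.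
  by rewrite -mulrDl nat1r.
have [s0|] := ltnP 0 s.
  have S := asy_convolutions (leqnn _) (introT orP (or_introl s0)) (fun r' s' h => (IH r' s' h).2).
  have T := asyD L S; rewrite -betaS // in T.
  rewrite -(prednK rs0) in T.
  have := asy_conv (p := 0) (asy_binser (half_gt0 _ 0)) T.
  rewrite [X in asy _ X _]mul1r prednK // eh.
  have -> // : conv (binser (1 / 2)) (fun n => incr r s n +
     \sum_(1 <= l < r.+1) 'C(r, l)%:R * conv (smom l) (pmom (r - l) s) n) = pmom r s.
  rewrite -[RHS]conv_half_inv; congr conv; apply/funext => n; by rewrite pmom_eq.
rewrite leqn0 => /eqP s0; rewrite {}s0 !addn0 in rs rs0 L eh IH *.
have kr : (3 <= k * r)%N by rewrite (leq_trans k3) // leq_pmulr.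
have kr1 : (k * r)%:R - 1 != 0 :> R by rewrite subr_eq0 pnatr_eq1; lia.
have kr2 : (k * r)%:R - 2 != 0 :> R by rewrite subr_eq0 eqr_nat; lia.
have S := asy_convolutions (s := 0) (leqnSn r) (introT orP (or_intror (leqnn r))) 
  (fun r' s' h => (IH r' s' (eq_rect _ (fun x => k * r' + s' < x)%N h _ (addn0 _))).2).
rewrite addn0 in S.
have T := asyD L S; rewrite mul0r add0r subn1 -beta0 // in T.
set rho := fun n => _ + _ in T.
have rhoE n : conv (binser (- (1 / 2) : R)) (pmom r 0) n = rho n + conv (smom r) (binser (1 / 2)) n.
  rewrite pmom_eq ?addn0 // big_nat_recr //= binn [1%:R * conv _ _ _]mul1r subnn pmom00.
  by rewrite addrA.
have dy n : sderiv (binser (- (1 / 2))) n = - (1 / 2) * binser (1 / 2 : R) n.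
  have h1 : 1 / 2 != 1 :> R by apply/eqP => H; lra.
  have := sint_binser n h1; rewrite /= (_ : 1 / 2 - 1 = - (1 / 2)); last by field.
  move=> E; rewrite /sderiv.
  have -> : binser (- (1 / 2)) n.+1 = - (1 / 2) * (binser (1 / 2 : R) n / n.+1%:R).
    by rewrite E [RHS]mulrC divfK // oppr_eq0; apply/eqP => H; lra.
  by rewrite mulrCA [n.+1%:R * _]mulrC divfK ?pnatr_eq0.
have sdA n : sderiv (smom r) n = pmom r 0 n / 2.
  by rewrite /sderiv /smom /= mulrA [_ * (_ / _)]mulrC divfK // pnatr_eq0.
have A : smom r = conv (binser (1 / 2)) (fun n => 2^-1 * sint rho n).
  rewrite -[LHS]conv_half_inv; congr conv.
  have d n : sderiv (conv (binser (- (1 / 2))) (smom r)) n = rho n / 2.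
    have e1 : sderiv (binser (- (1 / 2))) = (fun n => - (1 / 2) * binser (1 / 2 : R) n).
      by apply/funext.
    have e2 : sderiv (smom r) = (fun n => 2^-1 * pmom r 0 n).
      by apply/funext => j; rewrite sdA mulrC.
    rewrite sderiv_conv e1 e2 convZl convZr rhoE [conv (smom r) _]convC.
    by field.
  have := sderivK (conv (binser (- (1 / 2))) (smom r)).
  have -> : sderiv (conv (binser (- (1 / 2))) (smom r)) = (fun n => rho n / 2) by apply/funext.
  move=> E; apply/funext => n; move: (congr1 (@^~ n) E).
  have c0 : conv (binser (- (1 / 2))) (smom r) 0 = 0.
    by rewrite /conv big_ord1 /smom /= mul0r mulr0.
  rewrite c0 mul0r subr0 => <-.
  by case: n => [|n] /=; rewrite ?mulr0 // [RHS]mulrC mulrAC.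
have a1 : 1 < (k * r)%:R / 2 :> R by rewrite ltr_pdivlMr // mul1r ltr_nat.
have := asyZ (c := 2^-1) (asy_sint a1 T).
have e : (k * r)%:R / 2 - 1 = (k * r - 3).+1%:R / 2 :> R.
  rewrite (_ : (k * r - 3).+1 = k * r - 2)%N; last by lia.
  by rewrite natrB ?(leq_trans _ kr) //; field.
rewrite {1}e => T2; have := asy_conv (p := 0) (asy_binser (half_gt0 _ 0)) T2.
rewrite -e -A [X in asy _ X _]mul1r.
have -> : 1 / 2 + ((k * r)%:R / 2 - 1) = (k * r)%:R / 2 - 1 / 2 :> R by field.
have a0 : 0 < (k * r)%:R / 2 - 1 / 2 :> R by lra.
move=> /(asy_sderiv a0) /(asyZ (c := 2)).
have -> : (fun n => 2 * sderiv (smom r) n) = pmom r 0.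
  by apply/funext => n; rewrite sdA mulrC divfK // pnatr_eq0.
rewrite /pmom_asy addn0.
have -> : (k * r)%:R / 2 - 1 / 2 + 1 = (k * r).+1%:R / 2 :> R.
  by rewrite -[(k * r).+1]addn1 natrD; field.
move=> H; have E : beta r 0 =
   2 * (((k * r)%:R / 2 - 1 / 2) * (2^-1 * (beta r 0 * ((k * r)%:R - 2) / ((k * r)%:R - 1) /
          ((k * r)%:R / 2 - 1)))).
  by move: (_%:R) kr1 kr2 => x x1 x2; field; rewrite x1 x2.
rewrite E; exact: H.
Qed.

Theorem moments_asy r s : mom_asy r s.
Proof.
suff H N : forall r s, (k * r + s < N)%N -> mom_asy r s /\ pmom_asy r s.
  by case: (H (k * r + s).+1 r s).
elim: N => // N IHN {}r {}s; rewrite ltnS => lN.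
have IH r' s' : (k * r' + s' < k * r + s)%N -> mom_asy r' s' /\ pmom_asy r' s'.
  by move=> h; apply: IHN; apply: leq_trans h lN.
have [|rs] := posnP (r + s).
  move/eqP; rewrite addn_eq0 => /andP[/eqP -> /eqP ->].
  rewrite /mom_asy /pmom_asy mom00 pmom00 muln0 beta00.
  by split; apply: asy_binser; exact: half_gt0.
have P := moments_asy_step rs IH; split=> //.
have rs0 : (0 < k * r + s)%N by move: rs; rewrite !addn_gt0 muln_gt0 (ltn_trans _ k3).
have := asy_incr rs0 (fun r' s' h => (IH r' s' h).1).
rewrite -(prednK rs0) => /asy_lower_half => /(_ (k * r + s)%N).
rewrite prednK // => /(_ (leqnn _)) /(asyZ (c := (-1))) /(asyD P).
rewrite mulr0 addr0.
have -> // : (fun n => pmom r s n + -1 * incr r s n) = mom r s.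
by apply/funext => n; rewrite mulN1r /incr opprB addrC subrK.
Qed.

End moments.

Section gamma.
Variable R : realType.
Notation mu := (@lebesgue_measure R).
Implicit Types (x a b t : R) (f : R -> R).

Definition gamma_fun x t : R := t `^ (x - 1) * expR (- t).

Lemma gamma_fun_ge0 x t : 0 <= gamma_fun x t.
Proof. by rewrite mulr_ge0 ?powR_ge0 ?expR_ge0. Qed.

Lemma measurable_expRN : measurable_fun [set: R] (fun t : R => expR (- t)).
Proof.
apply: continuous_measurable_fun => t.
by apply: continuous_comp; [exact: opp_continuous|exact: continuous_expR].
Qed.

Lemma measurable_gamma_fun x (D : set R) : measurable_fun D (gamma_fun x).
Proof.
apply: measurable_funTS; apply: measurable_funM; first exact: measurable_powR.
exact: measurable_expRN.
Qed.

Lemma derivable_expRN t : derivable (fun t : R => expR (- t)) t 1.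
Proof. by apply/derivable1_diffP; apply: differentiable_comp; apply/derivable1_diffP; [exact: derivableN|exact: derivable_expR]. Qed.

Lemma derivable_powRpos x t : 0 < t -> derivable (fun t : R => t `^ x) t 1.
Proof. by move=> t0; apply: derivable_powR; rewrite in_itv /= t0. Qed.

Lemma derivable_continuous_at f t : derivable f t 1 -> {for t, continuous f}.
Proof. by move=> /derivable1_diffP; exact: differentiable_continuous. Qed.

Lemma derivable_LRcontinuous f a b : a < b ->
  (forall t, a <= t <= b -> derivable f t 1) -> derivable_oo_LRcontinuous f a b.
Proof.
move=> ab df; split.
- by move=> t; rewrite in_itv /= => /andP[/ltW at_ /ltW tb]; apply: df; rewrite at_.
- by apply: cvg_at_right_filter; apply: derivable_continuous_at; apply: df; rewrite lexx ltW.
- by apply: cvg_at_left_filter; apply: derivable_continuous_at; apply: df; rewrite lexx ltW.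
Qed.

Lemma within_continuousT f a b : (forall t, a <= t <= b -> {for t, continuous f}) ->
  {within `[a, b], continuous f}.
Proof.
move=> cf; apply: continuous_in_subspaceT => t.
by rewrite inE /= in_itv /= => /cf.
Qed.

Definition exhausting (a_ b_ : nat -> R) :=
  [/\ forall n, 0 < a_ n, forall n m, (n <= m)%N -> a_ m <= a_ n,
      forall n m, (n <= m)%N -> b_ n <= b_ m,
      forall e, 0 < e -> exists n, a_ n <= e & forall M, exists n, M <= b_ n].

Lemma exhausting_cvg (a_ b_ : nat -> R) f : exhausting a_ b_ ->
  (forall t, 0 <= f t) -> measurable_fun [set: R] f ->
  (\int[mu]_(t in `[a_ n, b_ n]) (f t)%:E)%E @[n --> \oo] -->
  (\int[mu]_(t in `]0%R, +oo[) (f t)%:E)%E.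
Proof.
move=> [a0 ad bi ae bM] f0 mf.
have -> : `]0%R, +oo[%classic = \bigcup_n `[a_ n, b_ n]%classic.
  apply/seteqP; split => t /=; rewrite in_itv /= ?andbT.
    move=> t0; have [n an] := ae _ t0; have [m bm] := bM t.
    exists (maxn n m) => //=; rewrite in_itv /= (le_trans (ad _ _ (leq_maxl n m))) //=.
    by rewrite (le_trans bm) // bi // leq_maxr.
  by case=> n _ /=; rewrite in_itv /= => /andP[h _]; exact: lt_le_trans (a0 n) h.
apply: ge0_nondecreasing_set_cvg_integral.
- move=> n m nm; apply/subsetPset => t /=; rewrite !in_itv /= => /andP[h1 h2].
  by rewrite (le_trans (ad _ _ nm)) //= (le_trans h2) // bi.
- by move=> n; exact: measurable_itv.
- by move=> n; apply/measurable_EFinP; exact: measurable_funTS.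
- by move=> n t _; rewrite lee_fin.
Qed.

Definition GammaE x : \bar R := (\int[mu]_(t in `]0%R, +oo[) (gamma_fun x t)%:E)%E.

Lemma GammaE_ge0 x : (0 <= GammaE x)%E.
Proof. by apply: integral_ge0 => t _; rewrite lee_fin gamma_fun_ge0. Qed.

Lemma GammaEE x : Gamma x = fine (GammaE x).
Proof. by []. Qed.

Lemma cvg_EFinn (u : nat -> R) (l : R) :
  u n @[n --> \oo] --> l -> (u n)%:E @[n --> \oo] --> l%:E.
Proof. by move=> ul; apply: cvg_EFin => //; apply: nearW. Qed.

Lemma exhausting_nat : exhausting (fun n => n.+1%:R^-1) (fun n => n.+1%:R).
Proof.
split => [n|n m nm|n m nm|e e0|M].
- by rewrite invr_gt0.
- by rewrite lef_pV2 ?posrE // ler_nat.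
- by rewrite ler_nat.
- exists (Num.truncn e^-1); rewrite invf_ple ?posrE //; exact/ltW/truncnS_gt.
- exists (Num.truncn M); exact/ltW/truncnS_gt.
Qed.

Lemma exhausting_natX : exhausting (fun n => (n.+1%:R^-1) ^+ 2) (fun n => n.+1%:R ^+ 2).
Proof.
have [h1 h2 h3 h4 h5] := exhausting_nat.
split => [n|n m nm|n m nm|e e0|M].
- by rewrite exprn_gt0 // h1.
- by rewrite lerXn2r ?nnegrE ?invr_ge0 ?h2.
- by rewrite lerXn2r ?nnegrE // h3.
- have [n hn] := h4 _ e0; exists n; apply: le_trans hn.
  by rewrite expr2 ler_piMl ?invr_ge0 // invf_le1 // ler1n.
- have [n hn] := h5 M; exists n; apply: (le_trans hn).
  by rewrite expr2 ler_peMl // ler1n.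
Qed.

Lemma integral_eqcc a b f g : (forall t, a <= t <= b -> f t = g t) ->
  (\int[mu]_(t in `[a, b]) (f t)%:E = \int[mu]_(t in `[a, b]) (g t)%:E)%E.
Proof.
by move=> fg; apply: eq_integral => t; rewrite inE /= in_itv /= => /fg ->.
Qed.

Lemma GammaE_half : GammaE (1 / 2) = (Num.sqrt pi)%:E.
Proof.
have L1 := exhausting_cvg exhausting_natX (gamma_fun_ge0 (1 / 2)) (@measurable_gamma_fun _ setT).
have mg : measurable_fun [set: R] (fun t : R => 2 * expR (- t ^+ 2)).
  by apply: measurable_funM; [exact: measurable_cst|exact: measurable_gauss_fun].
have g0 t : 0 <= 2 * expR (- t ^+ 2) :> R by rewrite mulr_ge0 ?expR_ge0.
have L2 := exhausting_cvg exhausting_nat g0 mg.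
have E (n : nat) : (\int[mu]_(t in `[(n.+1%:R^-1 ^+ 2)%R, (n.+1%:R ^+ 2)%R]) (gamma_fun (1 / 2) t)%:E =
   \int[mu]_(t in `[(n.+1%:R^-1)%R, n.+1%:R%R]) (2 * expR (- t ^+ 2))%:E)%E.
  have n0 : 0 < n.+1%:R^-1 :> R by rewrite invr_gt0.
  have nn : n.+1%:R^-1 <= n.+1%:R :> R by rewrite (@le_trans _ _ 1) // ?invf_le1 // ler1n.
  have dsq (t : R) : is_derive t 1 (fun t : R => t ^+ 2) (2 * t).
    by apply: is_derive_eq; rewrite !scaler1 mulrDl mul1r.
  have dsqE : derive1 (fun t : R => t ^+ 2) = (fun t => 2 * t).
    by apply/funext => t; rewrite derive1E derive_val.
  have c2 (t : R) : {for t, continuous (fun t : R => 2 * t)}.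
    by apply: continuousM => //; exact: cvg_cst.
  rewrite (@integration_by_substitution_increasing _ (fun t => t ^+ 2)) //.
  - rewrite dsqE; apply: integral_eqcc => t /andP[tn _] /=.
    have t0 : 0 < t by exact: lt_le_trans n0 tn.
    rewrite /gamma_fun !fctE (_ : 1 / 2 - 1 = - 2^-1); last by field.
    rewrite powRN powR12_sqrt ?sqr_ge0 // sqrtr_sqr gtr0_norm //.
    by rewrite mulrCA mulrA mulrAC mulrA mulfK ?gt_eqF // mulrC.
  - move=> x y; rewrite !in_itv /= => /andP[nx _] /andP[ny _] xy.
    by rewrite ltrXn2r // ?nnegrE // ltW // (lt_le_trans n0).
  - by rewrite dsqE => t _; exact: c2.
  - rewrite dsqE; apply/cvg_ex; exists (2 * n.+1%:R^-1).
    by apply: cvg_at_right_filter; exact: c2.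
  - rewrite dsqE; apply/cvg_ex; exists (2 * n.+1%:R).
    by apply: cvg_at_left_filter; exact: c2.
  - split => [t _||]; first by [].
    + by apply: cvg_at_right_filter; exact: exprn_continuous.
    + by apply: cvg_at_left_filter; exact: exprn_continuous.
  - apply: within_continuousT => t /andP[tn _].
    have t0 : 0 < t by rewrite (lt_le_trans _ tn) // exprn_gt0.
    apply: continuousM; apply: derivable_continuous_at.
      exact: derivable_powRpos.
    exact: derivable_expRN.
rewrite (_ : (fun n : nat => _) = (fun n : nat => (\int[mu]_(t in `[(n.+1%:R^-1)%R, n.+1%:R%R]) (2 * expR (- t ^+ 2))%:E)%E)) in L1; last by apply/funext.
rewrite /GammaE (cvg_unique _ L1 L2) //.
under eq_integral do rewrite EFinM.
rewrite ge0_integralZl_EFin //=; last first.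
  by apply/measurable_EFinP; apply: measurable_funTS; exact: measurable_gauss_fun.
rewrite integral_itv_obnd_cbnd; last first.
  by apply/measurable_EFinP; apply: measurable_funTS; exact: measurable_gauss_fun.
rewrite integral0y_gauss -EFinM; congr EFin; by rewrite mulrC divfK.
Qed.

Lemma GammaE_one : GammaE 1 = 1%E.
Proof.
have L := exhausting_cvg exhausting_nat (gamma_fun_ge0 1) (@measurable_gamma_fun _ setT).
have E (n : nat) : (\int[mu]_(t in `[(n.+2%:R^-1)%R, n.+2%:R%R]) (gamma_fun 1 t)%:E =
   (expR (- n.+2%:R^-1) - expR (- n.+2%:R))%:E)%E.
  have n0 : 0 < n.+2%:R^-1 :> R by rewrite invr_gt0.
  have nn : n.+2%:R^-1 < n.+2%:R :> R.
    by rewrite (@lt_le_trans _ _ 1) // ?invf_lt1 // ?ltr1n // ler1n.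
  have de (t : R) : is_derive t 1 (fun t : R => - expR (- t)) (expR (- t)).
    by apply: is_derive_eq; rewrite mulrN1 opprK.
  rewrite (@integral_eqcc _ _ _ (fun t => expR (- t))); last first.
    by move=> t _; rewrite /gamma_fun subrr powRr0 mul1r.
  rewrite (@continuous_FTC2 _ _ (fun t => - expR (- t))) //.
  - by rewrite -EFinB opprK addrC.
  - by apply: within_continuousT => t _; apply: derivable_continuous_at; exact: derivable_expRN.
  - by apply: derivable_LRcontinuous => // t _.
  - by move=> t _; rewrite derive1E derive_val.
move: L; rewrite -(cvg_shiftS (fun n : nat => (\int[mu]_(t in `[(n.+1%:R^-1)%R, n.+1%:R%R]) (gamma_fun 1 t)%:E)%E)).
rewrite (_ : (fun n : nat => _) = (fun n : nat => (expR (- n.+2%:R^-1) - expR (- n.+2%:R))%:E)); last by apply/funext.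
move=> L.
have L2 : expR (- n.+2%:R^-1) - expR (- n.+2%:R) @[n --> \oo] --> (1 : R).
  rewrite -[X in _ --> X]subr0; apply: cvgB.
    have H2 : n.+2%:R^-1 @[n --> \oo] --> (0 : R).
      by have := @cvg_harmonic R; rewrite -(cvg_shiftS (fun n => harmonic n : R)).
    have H3 : - n.+2%:R^-1 @[n --> \oo] --> (0 : R).
      by rewrite -[X in _ --> X]oppr0; apply: cvgN.
    by rewrite -[X in _ --> X]expR0; apply: continuous_cvg H3; exact: continuous_expR.
  have := @cvgn_expR R; rewrite -(cvg_shiftS (fun n => expR (- n%:R))).
  by rewrite -(cvg_shiftS (fun n => expR (- n.+1%:R))).
by rewrite /GammaE (cvg_unique _ L (cvg_EFinn L2)).
Qed.

Lemma cvg_powR_expRN x : 0 < x -> (n.+1%:R `^ x) * expR (- n.+1%:R) @[n --> \oo] --> (0 : R).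
Proof.
move=> x0; pose p := (Num.truncn x).+1.
have h n : 0 <= (n.+1%:R `^ x) * expR (- n.+1%:R) <= p.+1`!%:R * (n.+1%:R^-1 : R).
  rewrite mulr_ge0 ?powR_ge0 ?expR_ge0 //=.
  have n1 : 1 <= n.+1%:R :> R by rewrite ler1n.
  have n0 : 0 < n.+1%:R :> R by [].
  have h1 : n.+1%:R `^ x <= n.+1%:R ^+ p :> R.
    by rewrite -powR_mulrn //; apply: ler_powR => //; exact/ltW/truncnS_gt.
  have h2 : n.+1%:R ^+ p.+1 / p.+1`!%:R <= expR n.+1%:R :> R.
    by apply: le_trans (expR_ge1Dxn p (ltW n0)); rewrite lerDr.
  have F : 0 < p.+1`!%:R :> R by rewrite ltr0n fact_gt0.
  rewrite expRN ler_pdivrMr ?expR_gt0 //; apply: (le_trans h1).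
  rewrite ler_pdivrMr // in h2.
  rewrite [_ * expR _]mulrAC ler_pdivlMr // -exprSr mulrC; exact: h2.
apply: (squeeze_cvgr _ (cvg_cst 0)); first by near=> n; exact: h.
rewrite -[X in _ --> X](mulr0 p.+1`!%:R); apply: cvgMl_tmp; exact: cvg_harmonic.
Unshelve. all: by end_near. Qed.

Lemma cvg_powR_harmonic x : 0 < x -> (n.+1%:R^-1 `^ x) @[n --> \oo] --> (0 : R).
Proof.
move=> x0; have := powR_cvg0 x0.
move=> /cvg_at_rightP; apply; split => [n|]; first by rewrite invr_gt0.
exact: cvg_harmonic.
Qed.

Lemma GammaE_shift x : 0 < x -> GammaE x \is a fin_num ->
  GammaE (x + 1) = (x * Gamma x)%:E.
Proof.
move=> x0 fx.
have n0 (n : nat) : 0 < n.+1%:R^-1 :> R by rewrite invr_gt0.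
have L1 := exhausting_cvg exhausting_nat (gamma_fun_ge0 x) (@measurable_gamma_fun _ setT).
have L2 := exhausting_cvg exhausting_nat (gamma_fun_ge0 (x + 1)) (@measurable_gamma_fun _ setT).
pose J y n : R := (\int[mu]_(t in `[(n.+1%:R^-1)%R, n.+1%:R%R]) gamma_fun y t)%R.
have cgam y t : 0 < t -> {for t, continuous (gamma_fun y)}.
  move=> t0; apply: continuousM; apply: derivable_continuous_at.
    exact: derivable_powRpos.
  exact: derivable_expRN.
have JE y n : (\int[mu]_(t in `[(n.+1%:R^-1)%R, n.+1%:R%R]) (gamma_fun y t)%:E)%E = (J y n)%:E.
  rewrite /J /Rintegral fineK //; apply: integrable_fin_num => //.
  apply: continuous_compact_integrable => //; first exact: segment_compact.
  apply: within_continuousT => t /andP[tn _]; apply: cgam; exact: lt_le_trans tn.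
rewrite (_ : (fun n => _) = EFin \o J x) in L1; last by apply/funext => n; exact: JE.
rewrite (_ : (fun n => _) = EFin \o J (x + 1)) in L2; last by apply/funext => n; exact: JE.
have {}L1 : J x n @[n --> \oo] --> Gamma x.
  have : (EFin \o J x) n @[n --> \oo] --> (Gamma x)%:E by rewrite GammaEE fineK.
  exact: fine_cvg.
pose bd n : R := n.+1%:R^-1 `^ x * expR (- n.+1%:R^-1) - n.+1%:R `^ x * expR (- n.+1%:R).
have JS n : (0 < n)%N -> J (x + 1) n = bd n + x * J x n.
  move=> npos.
  have nn : n.+1%:R^-1 < n.+1%:R :> R.
    by rewrite (@lt_le_trans _ _ 1) // ?invf_lt1 // ?ltr1n // ler1n.
  have dp t : 0 < t -> is_derive t 1 (fun t : R => t `^ x) (x * t `^ (x - 1)).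
    by move=> t0; apply: is_derive1_powR.
  have de (t : R) : is_derive t 1 (fun t : R => - expR (- t)) (expR (- t)).
    by apply: is_derive_eq; rewrite mulrN1 opprK.
  have pos t : t \in `]n.+1%:R^-1, n.+1%:R[ -> 0 < t.
    by rewrite in_itv /= => /andP[h _]; exact: lt_trans h.
  have -> : J (x + 1) n = (\int[mu]_(t in `[(n.+1%:R^-1)%R, n.+1%:R%R]) (t `^ x * expR (- t)))%R.
    by rewrite /J; under eq_Rintegral do rewrite /gamma_fun addrK.
  rewrite (@Rintegration_by_parts _ (fun t => t `^ x) (fun t => - expR (- t)) (fun t => x * t `^ (x - 1))) //.
  - have -> : (\int[mu]_(t in `[(n.+1%:R^-1)%R, n.+1%:R%R]) (x * t `^ (x - 1) * - expR (- t)))%R = (- x) * J x n.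
      rewrite -RintegralZl //.
        by apply: eq_Rintegral => t _; rewrite /gamma_fun; ring.
      apply: continuous_compact_integrable => //; first exact: segment_compact.
      apply: within_continuousT => t /andP[tn _]; apply: cgam; exact: lt_le_trans tn.
    by rewrite /bd; ring.
  - apply: within_continuousT => t /andP[tn _]; apply: continuousM; first exact: cvg_cst.
    by apply: derivable_continuous_at; apply: derivable_powRpos; exact: lt_le_trans tn.
  - apply: derivable_LRcontinuous => // t /andP[tn _].
    by apply: derivable_powRpos; exact: lt_le_trans tn.
  - by move=> t /pos t0; rewrite derive1E; have := dp _ t0 => -[_ ->].
  - by apply: within_continuousT => t _; apply: derivable_continuous_at; exact: derivable_expRN.
  - by apply: derivable_LRcontinuous => // t _.
  - by move=> t _; rewrite derive1E derive_val.
have bd0 : bd n @[n --> \oo] --> (0 : R).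
  rewrite -[X in _ --> X]subr0; apply: cvgB; last exact: cvg_powR_expRN.
  have H := cvg_powR_harmonic x0.
  apply: (squeeze_cvgr _ (cvg_cst 0) H); near=> n.
  rewrite mulr_ge0 ?powR_ge0 ?expR_ge0 //=.
  by rewrite ler_piMr ?powR_ge0 // expR_le1 oppr_le0 invr_ge0.
have L3 : J (x + 1) n @[n --> \oo] --> x * Gamma x.
  have : bd n + x * J x n @[n --> \oo] --> 0 + x * Gamma x.
    by apply: cvgD => //; apply: cvgMl_tmp.
  rewrite add0r -(cvg_shiftS (fun n => bd n + x * J x n)) -(cvg_shiftS (J (x + 1))).
  rewrite (_ : (fun n => J (x + 1) n.+1) = (fun n => bd n.+1 + x * J x n.+1)) //.
  by apply/funext => n; rewrite JS.
by rewrite /GammaE (cvg_unique _ L2 (cvg_EFinn L3)).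
Unshelve. all: by end_near. Qed.

Definition Gammah (p : nat) : R := Gamma (p.+1%:R / 2).

Lemma half_shift p : p.+3%:R / 2 = p.+1%:R / 2 + 1 :> R.
Proof. by rewrite -[p.+3]addn2 natrD; field. Qed.

Lemma GammaE_half_fin p : GammaE (p.+1%:R / 2) \is a fin_num.
Proof.
suff : GammaE (p.+1%:R / 2) \is a fin_num /\ GammaE (p.+2%:R / 2) \is a fin_num by case.
elim: p => [|p [IH1 IH2]].
  by rewrite GammaE_half divff // GammaE_one.
by split=> //; rewrite half_shift GammaE_shift // divr_gt0.
Qed.

Lemma GammahE p : (Gammah p)%:E = GammaE (p.+1%:R / 2).
Proof. by rewrite /Gammah GammaEE fineK // GammaE_half_fin. Qed.

Lemma Gammah0 : Gammah 0 = Num.sqrt pi.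
Proof. by rewrite /Gammah GammaEE GammaE_half. Qed.

Lemma Gammah1 : Gammah 1 = 1.
Proof. by rewrite /Gammah GammaEE divff // GammaE_one. Qed.

Lemma GammahSS p : Gammah p.+2 = p.+1%:R / 2 * Gammah p.
Proof.
by rewrite /Gammah half_shift GammaEE GammaE_shift ?GammaE_half_fin // divr_gt0.
Qed.

Lemma Gammah_gt0 p : 0 < Gammah p.
Proof.
suff : 0 < Gammah p /\ 0 < Gammah p.+1 by case.
elim: p => [|p [IH1 IH2]].
  by rewrite Gammah0 Gammah1 sqrtr_gt0 pi_gt0.
by split=> //; rewrite GammahSS mulr_gt0 // divr_gt0.
Qed.

Lemma Gammah_convex p a : 0 < a ->
  Gammah p.+1 <= 2^-1 * a * Gammah p + 2^-1 / a * Gammah p.+2.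
Proof.
move=> a0; rewrite -lee_fin EFinD !(EFinM _ (Gammah _)) !GammahE.
have c1 : 0 <= 2^-1 * a by rewrite mulr_ge0 ?invr_ge0 // ltW.
have c2 : 0 <= 2^-1 / a by rewrite mulr_ge0 ?invr_ge0 // ltW.
have pos (c x : R) : 0 <= c -> forall t : R, `]0%R, +oo[%classic t -> (0 <= (c * gamma_fun x t)%:E)%E.
  by move=> c0 t _; rewrite lee_fin mulr_ge0 // gamma_fun_ge0.
have mea (c x : R) : measurable_fun (`]0%R, +oo[%classic : set R) (fun t => (c * gamma_fun x t)%:E).
  by apply/measurable_EFinP; apply: measurable_funM => //; exact: measurable_gamma_fun.
have E (c x : R) : 0 <= c -> (c%:E * GammaE x = \int[mu]_(t in `]0%R, +oo[) (c * gamma_fun x t)%:E)%E.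
  move=> c0; under eq_integral do rewrite EFinM.
  rewrite ge0_integralZl_EFin //; first by move=> t _; rewrite lee_fin gamma_fun_ge0.
  by apply/measurable_EFinP; exact: measurable_gamma_fun.
rewrite !E // -ge0_integralD //; [|exact: pos|exact: mea|exact: pos|exact: mea].
apply: ge0_le_integral => //.
- by move=> t _; rewrite lee_fin gamma_fun_ge0.
- by apply/measurable_EFinP; exact: measurable_gamma_fun.
- by apply: emeasurable_funD; exact: mea.
move=> t; rewrite /= in_itv /= andbT => t0.
rewrite -EFinD lee_fin /gamma_fun !mulrA -mulrDl ler_wpM2r ?expR_ge0 //.
have e1 : t `^ (p.+3%:R / 2 - 1) = t `^ (p.+1%:R / 2 - 1) * t.
  rewrite half_shift addrK -[X in _ = _ * X](@powRr1 _ t) ?ltW // -powRD ?subrK //.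
  by rewrite (gt_eqF t0) implybT.
have e2 : t `^ (p.+2%:R / 2 - 1) = t `^ (p.+1%:R / 2 - 1) * Num.sqrt t.
  rewrite -powR12_sqrt ?ltW // -powRD; last by rewrite (gt_eqF t0) implybT.
  by congr (_ `^ _); rewrite -[p.+2]addn1 natrD; field.
rewrite e1 e2 mulrA -!mulrA.
have P : 0 <= t `^ (p.+1%:R / 2 - 1) by exact: powR_ge0.
have -> : 2^-1 * (a * t `^ (p.+1%:R / 2 - 1)) + 2^-1 * (a^-1 * (t `^ (p.+1%:R / 2 - 1) * t)) =
  t `^ (p.+1%:R / 2 - 1) * (2^-1 * (a + t / a)) by field; rewrite gt_eqF.
apply: ler_wpM2l => //.
have sE : Num.sqrt t ^+ 2 = t by rewrite sqr_sqrtr // ltW.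
rewrite -{2}sE -subr_ge0.
have -> : 2^-1 * (a + Num.sqrt t ^+ 2 / a) - Num.sqrt t = 2^-1 / a * (a - Num.sqrt t) ^+ 2.
  by field; rewrite gt_eqF.
by rewrite mulr_ge0 // sqr_ge0.
Qed.

Lemma Gammah_step p : Gammah p.+1 ^+ 2 <= p.+1%:R / 2 * Gammah p ^+ 2.
Proof.
have G0 := Gammah_gt0 p; have G1 := Gammah_gt0 p.+1.
have p0 : 0 < p.+1%:R / 2 :> R by rewrite divr_gt0.
pose a : R := Num.sqrt (p.+1%:R / 2).
have a0 : 0 < a by rewrite sqrtr_gt0.
have aE : a ^+ 2 = p.+1%:R / 2 by rewrite sqr_sqrtr // ltW.
have := Gammah_convex p a0; rewrite GammahSS -aE => H.
have {}H : Gammah p.+1 <= a * Gammah p.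
  by apply: (le_trans H); rewrite le_eqVlt; apply/orP; left; apply/eqP; field; rewrite gt_eqF.
by rewrite -exprMn lerXn2r // nnegrE ltW // mulr_gt0.
Qed.

Lemma binser_Gammah p n : binser (p.+1%:R / 2) n = Gammah (p + n.*2) / (Gammah p * n`!%:R) :> R.
Proof.
elim: n => [|n IH].
  by rewrite /binser big_ord0 addn0 mulr1 divff // gt_eqF // Gammah_gt0.
rewrite binserS IH doubleS !addnS GammahSS factS natrM.
have -> : (p + n.*2).+1%:R = p.+1%:R + n%:R * 2 :> R.
  by rewrite -natrM -natrD muln2 addSn.
have G0 : Gammah p != 0 by rewrite gt_eqF // Gammah_gt0.
have F : n`!%:R != 0 :> R by rewrite pnatr_eq0 -lt0n fact_gt0.
have n1 : n.+1%:R != 0 :> R by rewrite pnatr_eq0.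
move: (Gammah _) (Gammah p) (n`!%:R) (n.+1%:R) (p.+1%:R) G0 F n1 => A B C D E B0 C0 D0.
by field; rewrite B0 C0 D0.
Qed.

Lemma Gammah_ratio_cvg q :
  Gammah (n.*2 + q).+1 / Gammah (n.*2 + q) / Num.sqrt n.+1%:R @[n --> \oo] --> (1 : R).
Proof.
pose rho n := Gammah (n.*2 + q).+1 / Gammah (n.*2 + q).
have rho0 n : 0 < rho n by rewrite divr_gt0 ?Gammah_gt0.
have up n : rho n ^+ 2 <= (n.*2 + q).+1%:R / 2.
  by rewrite exprMn exprVn ler_pdivrMr ?exprn_gt0 ?Gammah_gt0 // Gammah_step.
have lo n : (n.*2 + q)%:R / 2 <= rho n ^+ 2.
  set p := (n.*2 + q)%N.
  have H : ((p%:R + 1) / 2 * Gammah p) ^+ 2 <= (p%:R + 2) / 2 * Gammah p.+1 ^+ 2.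
    have := Gammah_step p.+1; rewrite GammahSS.
    by rewrite -[in X in X -> _](addn1 p) -[(p + 1).+1]addnS !natrD addn1.
  have G0 := Gammah_gt0 p; have G1 := Gammah_gt0 p.+1.
  rewrite exprMn exprVn ler_pdivlMr ?exprn_gt0 //.
  have p0 : 0 <= p%:R :> R by [].
  have p2 : 0 < (p%:R + 2) / 2 :> R by rewrite divr_gt0 // ltr_wpDl.
  rewrite -(ler_pM2l p2); apply: le_trans H; rewrite mulrA exprMn ler_wpM2r ?sqr_ge0 //.
  rewrite expr2; nra.
have sq : (rho n / Num.sqrt n.+1%:R) ^+ 2 @[n --> \oo] --> (1 : R).
  have c1 c : 1 + c / n.+1%:R @[n --> \oo] --> (1 : R).
    by rewrite -[X in _ --> X]addr0; apply: cvgD; [exact: cvg_cst|exact: cvg_divnS].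
  apply: (squeeze_cvgr _ (c1 ((q%:R - 2) / 2)) (c1 ((q%:R - 1) / 2))); near=> n.
  have n1 : 0 < n.+1%:R :> R by [].
  rewrite exprMn exprVn sqr_sqrtr //.
  have e (c : R) : 1 + c / n.+1%:R = (n.+1%:R + c) / n.+1%:R.
    by move: (n.+1%:R) (lt0r_neq0 n1) => N N0; field; rewrite N0.
  rewrite !e !ler_pM2r ?invr_gt0 //.
  have -> : n.+1%:R + (q%:R - 2) / 2 = (n.*2 + q)%:R / 2 :> R.
    by rewrite -muln2 natrD natrM -natr1; field.
  have -> : n.+1%:R + (q%:R - 1) / 2 = (n.*2 + q).+1%:R / 2 :> R.
    by rewrite -muln2 -[(_ + _).+1]addn1 !natrD natrM -natr1; field.
  by rewrite lo up.
rewrite -[X in _ --> X](sqrtr1 R).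
suff -> : (fun n => rho n / Num.sqrt n.+1%:R) =
    (fun n => Num.sqrt ((rho n / Num.sqrt n.+1%:R) ^+ 2)).
  by apply: continuous_cvg sq; exact: sqrt_continuous.
by apply/funext => n; rewrite sqrtr_sqr ger0_norm // divr_ge0 ?sqrtr_ge0 // ltW.
Unshelve. all: by end_near. Qed.

Lemma binser_ratio_cvg q :
  binser (q.+1%:R / 2) n / binser (1 / 2) n / Num.sqrt n.+1%:R ^+ q @[n --> \oo]
    --> Num.sqrt pi / Gammah q.
Proof.
have G0 p : Gammah p != 0 by rewrite gt_eqF // Gammah_gt0.
have s0 n : Num.sqrt n.+1%:R != 0 :> R by rewrite gt_eqF // sqrtr_gt0.
have H : Gammah (n.*2 + q) / Gammah n.*2 / Num.sqrt n.+1%:R ^+ q @[n --> \oo] --> (1 : R).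
  elim: q => [|q IH].
    rewrite (_ : (fun n => _) = fun=> 1); first exact: cvg_cst.
    by apply/funext => n; rewrite addn0 divr1 divff.
  have H1 := cvgM IH (Gammah_ratio_cvg q); rewrite mulr1 in H1.
  suff E : (fun n => Gammah (n.*2 + q.+1) / Gammah n.*2 / Num.sqrt n.+1%:R ^+ q.+1) =
    (fun n => Gammah (n.*2 + q) / Gammah n.*2 / Num.sqrt n.+1%:R ^+ q) \*
    (fun n => Gammah (n.*2 + q).+1 / Gammah (n.*2 + q) / Num.sqrt n.+1%:R) by rewrite E; exact: H1.
  apply/funext => n; rewrite addnS exprS /=.
  move: (G0 (n.*2 + q)%N) (G0 n.*2) (s0 n).
  move: (Gammah (n.*2 + q).+1) (Gammah (n.*2 + q)) (Gammah n.*2) (Num.sqrt n.+1%:R) => A B C D B0 C0 D0.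
  have Dq : D ^+ q != 0 by rewrite expf_neq0.
  by move: (D ^+ q) Dq => E E0; field; rewrite B0 C0 D0 E0.
have H2 : Num.sqrt pi / Gammah q * (Gammah (n.*2 + q) / Gammah n.*2 / Num.sqrt n.+1%:R ^+ q)
    @[n --> \oo] --> Num.sqrt pi / Gammah q.
  by rewrite -[X in _ --> X]mulr1; apply: cvgMl_tmp.
suff -> : (fun n => binser (q.+1%:R / 2) n / binser (1 / 2) n / Num.sqrt n.+1%:R ^+ q) =
  (fun n => Num.sqrt pi / Gammah q * (Gammah (n.*2 + q) / Gammah n.*2 / Num.sqrt n.+1%:R ^+ q)) by [].
apply/funext => n; have b0 := binser_Gammah 0 n; rewrite add0n in b0.
rewrite b0 binser_Gammah -Gammah0 addnC.
have F : n`!%:R != 0 :> R by rewrite pnatr_eq0 -lt0n fact_gt0.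
have Dq : Num.sqrt n.+1%:R ^+ q != 0 :> R by rewrite expf_neq0.
move: (G0 q) (G0 0%N) (G0 (n.*2 + q)%N) (G0 n.*2) F Dq.
move: (Gammah (n.*2 + q)) (Gammah q) (Gammah 0) (Gammah n.*2) (n`!%:R) (Num.sqrt n.+1%:R ^+ q) => A B C D E F.
move=> B0 C0 A0 D0 E0 F0; by field; rewrite B0 C0 D0 E0 F0.
Qed.

End gamma.

Lemma GammaB1 (R : realType) m : (1 < m)%N -> Gamma ((m%:R - 1) / 2 : R) = Gammah R (m - 2).
Proof.
move=> m1; have -> : m%:R - 1 = (m - 1)%:R :> R by rewrite natrB // ltnW.
by rewrite -(subnSK m1).
Qed.

Lemma Gamma_half (R : realType) m : (0 < m)%N -> Gamma (m%:R / 2 : R) = Gammah R m.-1.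
Proof. by move=> m0; rewrite /Gammah prednK. Qed.

Local Opaque Gamma zagreb_array Gammah.

Section zagreb_array_facts.
Variable R : realType.
Variable k : nat.
Hypothesis k3 : (2 < k)%N.
Notation g := (@zagreb_array R k).
Notation G := (Gammah R).

Let k0 : (0 < k)%N. Proof. exact: ltn_trans k3. Qed.

Let kr3 r : (0 < r)%N -> (3 <= k * r)%N.
Proof. by move=> r0; rewrite (leq_trans k3) // leq_pmulr. Qed.

Definition beta r s : R := g r s * G (k * r + s) / Num.sqrt pi.

Let G0 p : G p != 0. Proof. by rewrite gt_eqF // Gammah_gt0. Qed.

Let pi0 : Num.sqrt pi != 0 :> R. Proof. by rewrite gt_eqF // sqrtr_gt0 pi_gt0. Qed.

Lemma beta0s s : beta 0 s = s`!%:R.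
Proof.
rewrite /beta zagreb_arrayE // /zagreb_rec eqxx muln0 add0n Gamma_half //=.
by field; rewrite pi0 G0.
Qed.

Lemma beta_smom l : (0 < l)%N ->
  beta l 0 / ((k * l)%:R - 1) = g l 0 * G (k * l - 2) / (2 * Num.sqrt pi).
Proof.
move=> l0; have kl := kr3 l0; rewrite /beta addn0.
have [m ->] : exists m, (k * l = m.+2)%N by exists (k * l - 2)%N; lia.
rewrite GammahSS -[m.+2]addn2 addnK natrD -addrA (_ : 2 - 1 = 1 :> R); last by ring.
rewrite natr1; have m0 : m.+1%:R != 0 :> R by rewrite pnatr_eq0.
by move: (m.+1%:R) m0 (G m) => x x0 Gm; field; rewrite pi0 x0.
Qed.

Lemma betaS r s : (0 < s)%N -> beta r s =
  s%:R * beta r s.-1 + (k * r)%:R * beta r.-1 (k + s - 1) +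
  \sum_(1 <= l < r.+1) 'C(r, l)%:R * (beta l 0 / ((k * l)%:R - 1)) * beta (r - l) s.
Proof.
move=> s0; have [->|r0] := posnP r.
  rewrite big_geq // muln0 mul0r !addr0 !beta0s.
  by rewrite -natrM -(prednK s0) factS /= prednK.
rewrite {1}/beta zagreb_arrayE // /zagreb_rec gtn_eqF // s0.
have krs : (0 < k * r + s)%N by rewrite addn_gt0 s0 orbT.
rewrite addn1 Gamma_half // Gamma_half //= .
have eS : (\sum_(1 <= l < r.+1) 'C(r, l)%:R * (beta l 0 / ((k * l)%:R - 1)) * beta (r - l) s) =
  (2 * Num.sqrt pi ^+ 2)^-1 * \sum_(1 <= l < r.+1) 'C(r, l)%:R * g l 0 * g (r - l)%N s *
     Gamma (((k * l)%:R - 1) / 2) * Gamma ((k * (r - l) + s + 1)%:R / 2).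
  rewrite big_distrr /=; apply: eq_big_nat => l /andP[l0 lr].
  rewrite beta_smom // GammaB1; last by have := kr3 l0; lia.
  rewrite addn1 Gamma_half //= /beta.
  move: (Num.sqrt pi) pi0 (g l 0) (g (r - l) s) (G (k * l - 2)) => p p0 a b c.
  move: (G (k * (r - l) + s)) ('C(r, l)%:R) => d e.
  by field; rewrite p0.
rewrite eS /beta.
have -> : (k * r.-1 + (k + s - 1) = (k * r + s).-1)%N.
  by rewrite -{2}(prednK r0) mulnS; lia.
have -> : (k * r + s.-1 = (k * r + s).-1)%N by rewrite -[in RHS](prednK s0) addnS.
move: (\sum_(_ <= _ < _) _) => S.
move: (G0 (k * r + s)%N); move: (Num.sqrt pi) pi0 (g r.-1 _) (g r s.-1) (G (k * r + s)) => p p0 a b c c0.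
move: (G _) ((k * r)%:R) (s%:R) => d e f.
by field; rewrite p0 c0.
Qed.

Lemma beta0 r : (0 < r)%N -> beta r 0 * ((k * r)%:R - 2) / ((k * r)%:R - 1) =
  (k * r)%:R * beta r.-1 k.-1 +
  \sum_(1 <= l < r) 'C(r, l)%:R * (beta l 0 / ((k * l)%:R - 1)) * beta (r - l) 0.
Proof.
move=> r0; have kr := kr3 r0.
rewrite [LHS]mulrAC.
rewrite [X in X * _ = _](beta_smom r0).
rewrite zagreb_arrayE // /zagreb_rec gtn_eqF //=.
rewrite GammaB1; last by lia.
have n2 : (k * r)%:R - 2 != 0 :> R by rewrite subr_eq0 eqr_nat; lia.
have eG : Gamma ((k * r)%:R / 2 - 1 : R) = G (k * r - 3).
  rewrite (_ : _ / 2 - 1 = (k * r - 2)%:R / 2); last by rewrite natrB; [field|lia].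
  by rewrite Gamma_half ?subn_gt0 // -subn1 -subnDA.
have eS : (\sum_(1 <= l < r) 'C(r, l)%:R * (beta l 0 / ((k * l)%:R - 1)) * beta (r - l) 0) =
  (2 * Num.sqrt pi ^+ 2)^-1 * \sum_(1 <= l < r) 'C(r, l)%:R * g l 0 * g (r - l)%N 0%N *
     Gamma (((k * l)%:R - 1) / 2) * Gamma ((k * (r - l) + 1)%:R / 2).
  rewrite big_distrr /=; apply: eq_big_nat => l /andP[l0 lr].
  rewrite beta_smom // GammaB1; last by have := kr3 l0; lia.
  rewrite addn1 Gamma_half //= /beta addn0.
  move: (Num.sqrt pi) pi0 (g l 0) (g (r - l) 0) (G (k * l - 2)) => p p0 a b c.
  move: (G (k * (r - l))) ('C(r, l)%:R) => d e.
  by field; rewrite p0.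
rewrite eS eG /beta.
have -> : (k * r.-1 + k.-1 = (k * r - 3).+2)%N.
  by rewrite -{2}(prednK r0) mulnS; move: (k * r.-1)%N => x; lia.
rewrite GammahSS.
have -> : (k * r - 3).+1%:R = (k * r)%:R - 2 :> R.
  rewrite (_ : (k * r - 3).+1 = k * r - 2)%N; last by lia.
  by rewrite natrB //; lia.
move: (\sum_(_ <= _ < _) _) => S.
move: (G0 (k * r - 2)%N); move: ((k * r)%:R) n2 (G (k * r - 2)) (G _) => x n2 A B A0.
move: (Num.sqrt pi) pi0 (g r.-1 _) => p p0 c.
by field; rewrite p0 n2 A0.
Qed.

End zagreb_array_facts.

Lemma binS_ge N m : (0 < m < N)%N -> (N <= 'C(N, m))%N.
Proof.
elim: N m => // N IH [//|[|m]] /andP[_ mN]; first by rewrite bin1.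
rewrite binS -addn1 addnC; apply: leq_add; first by rewrite bin_gt0.
by apply: IH; rewrite -ltnS.
Qed.

Section weight_bound.
Variable R : realType.
Variable k : nat.
Hypothesis k3 : (2 < k)%N.

Let k0 : (0 < k)%N. Proof. exact: ltn_trans k3. Qed.

Let kr3 r : (0 < r)%N -> (3 <= k * r)%N.
Proof. by move=> r0; rewrite (leq_trans k3) // leq_pmulr. Qed.

Lemma fact_split r s l : (0 < l <= r)%N -> (0 < s)%N || (l < r)%N ->
  ('C(r, l) * ((k * l)`! * (s + k * (r - l))`!) * (s + k.-1 * r) <= (s + k * r)`!)%N.
Proof.
move=> /andP[l0 lr] sl.
have kE : k = k.-1.+1 by rewrite prednK.
have e1 : (s + k * (r - l) = s + k * r - k * l)%N.
  by rewrite mulnBr addnBA // leq_mul2l lr orbT.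
have kl : (k * l <= s + k * r)%N by rewrite (leq_trans _ (leq_addl _ _)) // leq_mul2l lr orbT.
rewrite -(bin_fact kl) -e1 mulnAC leq_mul2r; apply/orP; right.
have -> : (s + k * r = r + (s + k.-1 * r))%N by rewrite {1}kE mulSn addnCA.
rewrite -binomial.Vandermonde.
have lk : (l < (k * l).+1)%N by rewrite ltnS leq_pmull.
rewrite (bigD1 (Ordinal lk)) //=; apply: leq_trans (leq_addr _ _).
rewrite leq_mul2l; apply/orP; right.
rewrite (_ : k * l - l = k.-1 * l)%N; last by rewrite {1}kE mulSn addKn.
have k1 : (1 < k.-1)%N by rewrite -ltnS prednK.
apply: binS_ge; rewrite muln_gt0 l0 (ltn_trans _ k1) //=.
case/orP: sl => [s0|lr'].
  by rewrite (@leq_ltn_trans (k.-1 * r)) ?leq_mul2l ?lr ?orbT // -[ltnLHS]add0n ltn_add2r.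
by rewrite (@leq_trans (k.-1 * r)) ?leq_addl // ltn_mul2l lr' andbT; lia.
Qed.

Variable beta : nat -> nat -> R.
Hypothesis beta0s : forall s, beta 0 s = s`!%:R.
Hypothesis betaS : forall r s, (0 < s)%N -> beta r s =
  s%:R * beta r s.-1 + (k * r)%:R * beta r.-1 (k + s - 1) +
  \sum_(1 <= l < r.+1) 'C(r, l)%:R * (beta l 0 / ((k * l)%:R - 1)) * beta (r - l) s.
Hypothesis beta0 : forall r, (0 < r)%N -> beta r 0 * ((k * r)%:R - 2) / ((k * r)%:R - 1) =
  (k * r)%:R * beta r.-1 k.-1 +
  \sum_(1 <= l < r) 'C(r, l)%:R * (beta l 0 / ((k * l)%:R - 1)) * beta (r - l) 0.

Lemma beta_bound r s : 0 <= beta r s <= 4 ^+ r * (s + k * r)`!%:R.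
Proof.
suff H N : forall r s, (k * r + s < N)%N -> 0 <= beta r s <= 4 ^+ r * (s + k * r)`!%:R.
  exact: H.
elim: N => // N IHN {}r {}s; rewrite ltnS => lN.
have IH r' s' : (k * r' + s' < k * r + s)%N -> 0 <= beta r' s' <= 4 ^+ r' * (s' + k * r')`!%:R.
  by move=> h; apply: IHN; apply: leq_trans h lN.
have [->|r0] := posnP r; first by rewrite beta0s muln0 addn0 expr0 mul1r ler0n lexx.
have kr := kr3 r0.
set T : R := 4 ^+ r * (s + k * r)`!%:R.
have T0 : 0 <= T by rewrite mulr_ge0 ?exprn_ge0.
pose D : R := (s + k.-1 * r)%:R.
have D0 : 0 < D by rewrite ltr0n addn_gt0 muln_gt0 r0 andbT orbC -ltnS prednK // (ltn_trans _ k3).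
(* convolution terms *)
have S1 m : (m <= r.+1)%N -> (0 < s)%N || (m <= r)%N ->
   0 <= \sum_(1 <= l < m) 'C(r, l)%:R * (beta l 0 / ((k * l)%:R - 1)) * beta (r - l) s
     <= m.-1%:R * (T / (2 * D)).
  move=> mr ms.
  have B l : (1 <= l < m)%N -> 0 <= 'C(r, l)%:R * (beta l 0 / ((k * l)%:R - 1)) * beta (r - l) s <= T / (2 * D).
    move=> /andP[l0 lm].
    have lr : (l <= r)%N by rewrite -ltnS (leq_trans lm).
    have kl := kr3 l0.
    have klr : (k * l <= k * r)%N by rewrite leq_mul2l lr orbT.
    have sl : (0 < s)%N || (l < r)%N.
      by case/orP: ms => [->//|mr']; rewrite (leq_trans lm mr') orbT.
    have /IH/andP[b1 b2] : (k * l + 0 < k * r + s)%N.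
      case/orP: sl => [s0|lr']; first by rewrite addn0 (leq_ltn_trans klr) // -[ltnLHS]addn0 ltn_add2l.
      by rewrite addn0 (@leq_trans (k * r)) ?leq_addr // ltn_mul2l k0.
    have /IH/andP[c1 c2] : (k * (r - l) + s < k * r + s)%N by rewrite ltn_add2r ltn_mul2l k0 /=; lia.
    have d2 : 2 <= (k * l)%:R - 1 :> R.
      by rewrite lerBrDr (_ : 2 + 1 = 3%:R :> R); [rewrite ler_nat|ring].
    have d0 : 0 < (k * l)%:R - 1 :> R by apply: lt_le_trans d2.
    rewrite !mulr_ge0 ?invr_ge0 ?(ltW d0) //=.
    rewrite ler_pdivlMr ?mulr_gt0 //.
    have F : 'C(r, l)%:R * ((k * l)`!%:R * (s + k * (r - l))`!%:R) * D <= (s + k * r)`!%:R :> R.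
      by rewrite -!natrM ler_nat; apply: fact_split; rewrite ?l0.
    apply: (@le_trans _ _ ('C(r, l)%:R * (4 ^+ l * (k * l)`!%:R / 2) * (4 ^+ (r - l) * (s + k * (r - l))`!%:R) * (2 * D))).
      rewrite add0n in b2.
      have h1 : beta l 0 / ((k * l)%:R - 1) <= 4 ^+ l * (k * l)`!%:R / 2.
        by apply: ler_pM => //; rewrite ?invr_ge0 ?(ltW d0) // lef_pV2 ?posrE.
      apply: ler_wpM2r; first by rewrite mulr_ge0 // ltW.
      apply: ler_pM => //; first by rewrite !mulr_ge0 ?invr_ge0 ?(ltW d0).
      exact: ler_wpM2l.
    rewrite /T (_ : 4 ^+ r = 4 ^+ l * 4 ^+ (r - l) :> R); last by rewrite -exprD subnKC.
    have H := ler_wpM2l (mulr_ge0 (exprn_ge0 l (ler0n R 4)) (exprn_ge0 (r - l) (ler0n R 4))) F.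
    by apply: le_trans H; rewrite le_eqVlt; apply/orP; left; apply/eqP; field.
  apply/andP; split; first by rewrite big_nat sumr_ge0 // => l /B/andP[].
  apply: (@le_trans _ _ (\sum_(1 <= l < m) (T / (2 * D)))).
    by apply: ler_sum_nat => l /B/andP[].
  by rewrite sumr_const_nat subn1 -(mulr_natl (T / _)).
have [s0|] := ltnP 0 s.
  rewrite betaS //.
  have /IH/andP[b1 b2] : (k * r + s.-1 < k * r + s)%N by rewrite ltn_add2l prednK.
  have e1 : (k * r.-1 + (k + s - 1) = (k * r + s).-1)%N.
    by rewrite -{2}(prednK r0) mulnS; lia.
  have /IH/andP[c1 c2] : (k * r.-1 + (k + s - 1) < k * r + s)%N by rewrite e1 prednK // addn_gt0 s0 orbT.
  have /andP[d1 d2] := S1 r.+1 (leqnn _) (introT orP (or_introl s0)).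
  have c0 : (s + k * r = (k * r + s).-1.+1)%N by rewrite prednK ?addn_gt0 ?s0 ?orbT // addnC.
  set F : R := (k * r + s).-1`!%:R.
  have TE : T = 4 ^+ r * ((s + k * r)%:R * F) by rewrite /T {1}c0 factS natrM -c0.
  have b3 : beta r s.-1 <= 4 ^+ r * F.
    apply: (le_trans b2); rewrite ler_wpM2l ?exprn_ge0 // ler_nat /F.
    by rewrite (_ : s.-1 + k * r = (k * r + s).-1)%N //; lia.
  have c3 : beta r.-1 (k + s - 1) <= 4 ^+ r / 4 * F.
    have -> : 4 ^+ r / 4 = 4 ^+ r.-1 :> R by rewrite -{1}(prednK r0) exprSr mulfK.
    apply: (le_trans c2); rewrite ler_wpM2l ?exprn_ge0 // ler_nat /F.
    rewrite (_ : k + s - 1 + k * r.-1 = (k * r + s).-1)%N // -e1 addnC //.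
  have d3 : r.+1.-1%:R * (T / (2 * D)) <= (k * r)%:R / 4 * (4 ^+ r * F).
    rewrite TE /=.
    have aux (a E N' f d : R) : 0 < d -> a * (E * (N' * f) / (2 * d)) = (2 * a * N' / (4 * d)) * (E * f).
      by move=> d0; field; rewrite gt_eqF.
    rewrite aux //.
    apply: ler_wpM2r; first by rewrite mulr_ge0 ?exprn_ge0.
    rewrite ler_pdivrMr ?mulr_gt0 // mulrA divfK // /D -!natrM ler_nat.
    have k2 : (2 * k <= k * k.-1)%N by rewrite mulnC leq_mul2l; lia.
    have : (2 * s <= k * s)%N by rewrite leq_mul2r; lia.
    rewrite -mulnA [(k * r)%N]mulnC -(mulnA r) mulnCA leq_mul2l => h; apply/orP; right.
    rewrite !mulnDr; apply: leq_add => //.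
    by rewrite [(r * k)%N]mulnC !mulnA leq_mul2r k2 orbT.
  rewrite !addr_ge0 ?mulr_ge0 //=.
  apply: le_trans (lerD (lerD (ler_wpM2l (ler0n R s) b3) (ler_wpM2l (ler0n R (k * r)) c3)) (le_trans d2 d3)) _.
  rewrite TE natrD.
  have : 0 <= (k * r)%:R * (4 ^+ r * F) by rewrite !mulr_ge0 ?exprn_ge0.
  move: ((k * r)%:R) (4 ^+ r) (s%:R) => x y z; nra.
rewrite leqn0 => /eqP s0; rewrite {}s0 in lN IH T T0 D D0 S1 *.
rewrite addn0 in IH; rewrite add0n in T T0 S1 *; rewrite add0n in D D0 S1.
have e1 : (k * r.-1 + k.-1 = (k * r).-1)%N.
  by rewrite -{2}(prednK r0) mulnS; lia.
have /IH/andP[c1 c2] : (k * r.-1 + k.-1 < k * r)%N by rewrite e1 prednK // muln_gt0 k0.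
have /andP[d1 d2] := S1 r (leqnSn _) (introT orP (or_intror (leqnn r))).
set F : R := (k * r).-1`!%:R.
have TE : T = 4 ^+ r * ((k * r)%:R * F).
  by rewrite /T -natrM -[in X in _ = _ * (X * _)%:R](prednK (leq_trans (ltn0Sn _) kr)) -factS prednK // (leq_trans _ kr).
have c3 : beta r.-1 k.-1 <= 4 ^+ r / 4 * F.
  have -> : 4 ^+ r / 4 = 4 ^+ r.-1 :> R by rewrite -{1}(prednK r0) exprSr mulfK.
  by apply: (le_trans c2); rewrite ler_wpM2l ?exprn_ge0 // ler_nat /F -e1 addnC.
have d3 : r.-1%:R * (T / (2 * D)) <= T / 4.
  have aux (a t d : R) : 0 < d -> a * (t / (2 * d)) = (2 * a / d) * (t / 4).
    by move=> d0; field; rewrite gt_eqF.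
  rewrite aux //.
  rewrite ler_piMl ?divr_ge0 // ler_pdivrMr // mul1r /D -natrM ler_nat.
  by rewrite leq_mul // ?leq_pred //; lia.
have := beta0 r0; set S := \sum_(_ <= _ < _) _ => E.
have m3 : 3 <= (k * r)%:R :> R by rewrite ler_nat.
have rhs0 : 0 <= (k * r)%:R * beta r.-1 k.-1 + S by rewrite addr_ge0 ?mulr_ge0.
have rhs1 : (k * r)%:R * beta r.-1 k.-1 + S <= T / 2.
  apply: le_trans (lerD (ler_wpM2l (ler0n R (k * r)) c3) (le_trans d2 d3)) _.
  by rewrite TE le_eqVlt; apply/orP; left; apply/eqP; field.
rewrite -E in rhs0 rhs1.
have q0 : 0 < ((k * r)%:R - 2) / ((k * r)%:R - 1) :> R by rewrite divr_gt0; lra.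
have q1 : 1 / 2 <= ((k * r)%:R - 2) / ((k * r)%:R - 1) :> R.
  by rewrite ler_pdivlMr; lra.
rewrite -mulrA in rhs0 rhs1.
have b0 : 0 <= beta r 0 by rewrite -(pmulr_lge0 _ q0).
rewrite b0 /=; have := ler_wpM2l b0 q1; lra.
Qed.

End weight_bound.

Section moment_limits.
Variable R : realType.
Variable k : nat.
Hypothesis k3 : (2 < k)%N.
Notation g := (@zagreb_array R k).

Let pi0 : Num.sqrt pi != 0 :> R. Proof. by rewrite gt_eqF // sqrtr_gt0 pi_gt0. Qed.

Definition emean (n : nat) (f : bt unit -> R) : R := wsum n f / wsum n (fun=> 1).

Lemma wsum1_gt0 n : 0 < wsum n (fun=> 1 : R).
Proof.
have := congr1 (@^~ n) (egf1 R); rewrite /egf => E.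
have : 0 < wsum n (fun=> 1 : R) / (n`!%:R * 2 ^+ n).
  by rewrite E; apply: binser_gt0; rewrite divr_gt0.
by rewrite pmulr_lgt0 // invr_gt0 mulr_gt0 ?exprn_gt0 // ltr0n fact_gt0.
Qed.

Lemma emean_cvg r :
  emean n (fun t => (zag k t)%:R ^+ r) / Num.sqrt n.+1%:R ^+ (k * r) @[n --> \oo] --> g r 0.
Proof.
have b00 : beta R k 0 0 = 1 by rewrite beta0s.
have A : mom_asy (R := R) k (beta R k) r 0 by exact: (@moments_asy R k k3 (beta R k) b00 (betaS R k3) (beta0 R k3) r 0).
rewrite /mom_asy /asy addn0 in A.
have H := cvgM A (@binser_ratio_cvg R (k * r)).
have G0 : Gammah R (k * r) != 0 by rewrite gt_eqF // Gammah_gt0.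
have e : beta R k r 0 * (Num.sqrt pi / Gammah R (k * r)) = g r 0.
  rewrite /beta addn0; move: (g r 0) (Gammah _ _) (Num.sqrt _) G0 pi0 => a b c b0 c0.
  by field; rewrite b0 c0.
rewrite e in H.
suff -> : (fun n => emean n (fun t => (zag k t)%:R ^+ r) / Num.sqrt n.+1%:R ^+ (k * r)) =
 (fun n => mom R k r 0 n / binser ((k * r).+1%:R / 2) n) \*
 (fun n => binser ((k * r).+1%:R / 2) n / binser (1 / 2) n / Num.sqrt n.+1%:R ^+ (k * r)) by exact: H.
apply/funext => n /=.
rewrite -egf1 /mom /egf /emean.
have -> : wsum n (fun t => (zag k t)%:R ^+ r * (rdeg t)%:R ^+ 0) = wsum n (fun t => (zag k t)%:R ^+ r : R).
  by apply: eq_wsum => t; rewrite expr0 mulr1.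
have b0 : binser ((k * r).+1%:R / 2 : R) n != 0.
  by rewrite gt_eqF // binser_gt0 // divr_gt0.
have F : n`!%:R * 2 ^+ n != 0 :> R.
  by rewrite mulf_neq0 ?expf_neq0 // pnatr_eq0 -lt0n fact_gt0.
have s0 : Num.sqrt n.+1%:R ^+ (k * r) != 0 :> R by rewrite expf_neq0 // gt_eqF // sqrtr_gt0.
have w0 : wsum n (fun=> 1 : R) != 0 by rewrite gt_eqF // wsum1_gt0.
move: (wsum n (fun=> 1)) w0 (wsum n _) (binser _ n) b0 (n`!%:R * _) F (_ ^+ (k * r)) s0.
move=> a a0 b c c0 d d0 x x0.
by field; rewrite a0 c0 d0 x0.
Qed.

Lemma Gammah_double m : Gammah R m.*2 * (4 ^+ m * m`!%:R) = m.*2`!%:R * Num.sqrt pi.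
Proof.
elim: m => [|m IH]; first by rewrite Gammah0 !fact0 expr0 !mul1r mulr1.
rewrite doubleS GammahSS exprS !factS !natrM.
have -> : (m.*2).+1%:R / 2 * Gammah R m.*2 * (4 * 4 ^+ m * (m.+1%:R * m`!%:R)) =
  (Gammah R m.*2 * (4 ^+ m * m`!%:R)) * ((m.*2).+1%:R * (2 * m.+1%:R)) by field.
rewrite IH -natrM mul2n doubleS; ring.
Qed.

Lemma zagreb_array_ge0 r : 0 <= g r 0.
Proof.
have /andP[b0 _] := beta_bound k3 (beta0s R k3) (betaS R k3) (beta0 R k3) r 0.
have G0 := Gammah_gt0 R (k * r).
have : 0 <= beta R k r 0 / Gammah R (k * r) * Num.sqrt pi.
  by rewrite mulr_ge0 ?sqrtr_ge0 // divr_ge0 // ltW.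
rewrite /beta addn0; move: (g r 0) (Gammah _ _) (Num.sqrt _) G0 pi0 => a b c b0' c0.
by rewrite (_ : a * b / c / b * c = a) //; field; rewrite c0 gt_eqF.
Qed.

Lemma zagreb_array_bound q : (k <= 4)%N -> g q.*2 0 <= (16 * 256) ^+ q * (4 * q)`!%:R.
Proof.
move=> k4; have /andP[_] := beta_bound k3 (beta0s R k3) (betaS R k3) (beta0 R k3) q.*2 0.
have e : (k * q.*2 = (k * q).*2)%N by rewrite -!muln2 mulnA.
rewrite /beta addn0 add0n e.
have := Gammah_double (k * q).
have G0 := Gammah_gt0 R (k * q).*2.
have p0 : 0 < Num.sqrt pi :> R by rewrite sqrtr_gt0 pi_gt0.
have F0 : 0 < (k * q)`!%:R :> R by rewrite ltr0n fact_gt0.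
have F1 : 0 < (k * q).*2`!%:R :> R by rewrite ltr0n fact_gt0.
have F2 : 0 < 4 ^+ (k * q) :> R by rewrite exprn_gt0.
have le1 : 4 ^+ (k * q) * (k * q)`!%:R <= 256 ^+ q * (4 * q)`!%:R :> R.
  have kq : (k * q <= 4 * q)%N by rewrite leq_mul2r k4 orbT.
  have e2 : 256 ^+ q = 4 ^+ (4 * q) :> R by rewrite exprM; congr (_ ^+ _); ring.
  rewrite e2; apply: ler_pM; rewrite ?exprn_ge0 ?ler_nat ?leq_fact //.
  by apply: ler_weXn2l => //; rewrite ler1n.
rewrite -[q.*2]muln2 [(q * 2)%N]mulnC (exprM 4 2 q) (_ : 4 ^+ 2 = 16 :> R); last by ring.
move=> E B.
have {}B : g (2 * q) 0 * Gammah R (k * q).*2 <= 16 ^+ q * (k * q).*2`!%:R * Num.sqrt pi.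
  by rewrite -ler_pdivrMr.
rewrite exprMn -mulrA; apply: (@le_trans _ _ (16 ^+ q * (4 ^+ (k * q) * (k * q)`!%:R))); last first.
  by rewrite ler_wpM2l ?exprn_ge0.
rewrite -(ler_pM2r G0); apply: (le_trans B).
by rewrite -mulrA -E le_eqVlt; apply/orP; left; apply/eqP; ring.
Qed.

End moment_limits.

Section cosine_taylor.
Variable R : realType.

Definition cosd (j : nat) (x : R) : R := cos (x + j%:R * (pi / 2)).

Lemma cosd_max j x : `|cosd j x| <= 1. Proof. exact: cos_max. Qed.

Lemma is_derive_cosd j (x : R) : is_derive x 1 (cosd j) (cosd j.+1 x).
Proof.
have -> : cosd j.+1 x = - sin (x + j%:R * (pi / 2)).
  by rewrite /cosd -natr1 mulrDl mul1r addrA cosDpihalf.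
rewrite /cosd; apply: is_derive_eq.
by rewrite addr0 mulr1.
Qed.

Lemma cosd0 x : cosd 0 x = cos x.
Proof. by rewrite /cosd mul0r addr0. Qed.

Lemma cosdSS j x : cosd j.+2 x = - cosd j x.
Proof.
rewrite /cosd; have -> : x + j.+2%:R * (pi / 2) = x + j%:R * (pi / 2) + pi / 2 + pi / 2.
  by rewrite -[j.+2]addn2 natrD; field.
by rewrite cosDpihalf sinDpihalf.
Qed.

Lemma cosd_even_at0 i : cosd i.*2 0 = (-1) ^+ i.
Proof.
elim: i => [|i IH]; first by rewrite cosd0 cos0.
by rewrite doubleS cosdSS IH exprS mulN1r.
Qed.

Lemma cosd_odd_at0 i : cosd i.*2.+1 0 = 0.
Proof.
elim: i => [|i IH]; first by rewrite /cosd mul1r add0r cos_pihalf.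
by rewrite doubleS cosdSS IH oppr0.
Qed.

Lemma cosd_taylor N j (x h : R) : 0 <= h ->
  `|cosd j (x + h) - \sum_(l < N) h ^+ l / l`!%:R * cosd (j + l) x| <= h ^+ N / N`!%:R.
Proof.
elim: N j h => [|N IH] j h h0.
  by rewrite big_ord0 subr0 fact0 divr1 expr0 cosd_max.
pose r i M t : R := cosd i (x + t) - \sum_(l < M) t ^+ l / l`!%:R * cosd (i + l) x.
pose p M t : R := t ^+ M / M`!%:R.
have dp M (t : R) : is_derive t 1 (p M.+1) (p M t).
  have dX : is_derive t 1 (fun t : R => t ^+ M.+1) (M.+1%:R * t ^+ M).
    apply: DeriveDef; first exact: exprn_derivable.
    by rewrite exp_derive /= [LHS]mulr1.
  have -> : p M.+1 = (M.+1`!%:R^-1) \*: (fun t : R => t ^+ M.+1).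
    by apply/funext => u; rewrite /p /= mulrC.
  apply: is_derive_eq; rewrite /p factS natrM.
  have F0 : M`!%:R != 0 :> R by rewrite pnatr_eq0 -lt0n fact_gt0.
  have F1 : M.+1%:R != 0 :> R by rewrite pnatr_eq0.
  move: (M.+1%:R) (M`!%:R) F0 F1 => u v v0 u0.
  by rewrite -[LHS]/((u * v)^-1 * (u * t ^+ M)); field; rewrite u0 v0.
have rS i M t : r i M.+1 t = r i M t - p M t * cosd (i + M) x.
  by rewrite /r big_ord_recr /= opprD addrA.
have dc i (t : R) : is_derive t 1 (fun t => cosd i (x + t)) (cosd i.+1 (x + t)).
  have dx := is_derive_cosd i (x + t); apply: is_derive_eq.
  by rewrite add0r mulr1.
have dr M (t : R) : is_derive t 1 (r j M.+1) (r j.+1 M t).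
  elim: M => [|m IHM].
    have -> : r j 1 = fun t => cosd j (x + t) - cosd j x.
      by apply/funext => u; rewrite rS /r big_ord0 subr0 /p expr0 fact0 divr1 mul1r addn0.
    have dct := dc j t; apply: is_derive_eq.
    by rewrite subr0 /r big_ord0 subr0.
  have -> : r j m.+2 = fun t => r j m.+1 t - p m.+1 t * cosd (j + m.+1) x.
    by apply/funext => u; rewrite rS.
  have dpM := dp m t; apply: is_derive_eq.
  by rewrite scaler0 add0r rS addSnnS [in RHS]mulrC.
have key (s : R) : `|s| <= 1 -> s * r j N.+1 h <= p N.+1 h.
  move=> s1; rewrite -subr_ge0.
  pose F t : R := p N.+1 t - s * r j N.+1 t.
  have dF (t : R) : is_derive t 1 F (p N t - s * r j.+1 N t).
    have dpN := dp N t; have drN := dr N t; apply: is_derive_eq.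
    by [].
  have F0 : F 0 = 0.
    rewrite /F /p expr0n /= mul0r sub0r /r addr0 big_ord_recl /= expr0 fact0 divr1 mul1r addn0.
    by rewrite big1 ?addr0 ?subrr ?mulr0 ?oppr0 // => l _; rewrite expr0n /= !mul0r.
  rewrite -/(F h) -F0.
  have cF : {within `[0, h], continuous F}.
    apply: continuous_in_subspaceT => t _; apply: differentiable_continuous.
    by apply/derivable1_diffP; have [] := dF t.
  have H1 t : t \in `]0, h[%R -> derivable F t 1 by move=> _; have [] := dF t.
  have H2 t : t \in `]0, h[%R -> 0 <= derive1 F t.
    rewrite in_itv /= => /andP[/ltW t0 _]; rewrite derive1E derive_val subr_ge0.
    have := IH j.+1 t t0; rewrite -/(r j.+1 N t) -/(p N t) => H.
    apply: le_trans H; apply: le_trans (ler_norm _) _; rewrite normrM.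
    by apply: le_trans (ler_wpM2r (normr_ge0 _) s1) _; rewrite mul1r.
  by apply: (ger0_derive1_le_cc H1 H2 cF); rewrite ?in_itv /= ?lexx ?h0.
have k1 : r j N.+1 h <= p N.+1 h by rewrite -[leLHS]mul1r; apply: key; rewrite normr1.
have k2 : - r j N.+1 h <= p N.+1 h by rewrite -mulN1r; apply: key; rewrite normrN normr1.
by rewrite -/(r j N.+1 h) -/(p N.+1 h) ler_norml lerNl k1 k2.
Qed.

End cosine_taylor.

Section linear_combinations.
Context d (T : measurableType d) (R : realType) (P : probability T R).

Lemma integrable_lin (c : R) (f g : T -> R) : P.-integrable [set: T] (EFin \o f) ->
  P.-integrable [set: T] (EFin \o g) ->
  P.-integrable [set: T] (EFin \o (fun w => f w + c * g w)).
Proof.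
move=> f1 g1; have := integrableD measurableT f1 (integrableZl measurableT c g1).
exact.
Qed.

Lemma Rintegral_lin (c : R) (f g : T -> R) : P.-integrable [set: T] (EFin \o f) ->
  P.-integrable [set: T] (EFin \o g) ->
  \int[P]_w (f w + c * g w) = \int[P]_w f w + c * \int[P]_w g w.
Proof.
move=> f1 g1; rewrite RintegralD // ?RintegralZl //.
by have := integrableZl measurableT c g1.
Qed.

Lemma Rintegral_lincomb N (c : nat -> R) (F : nat -> T -> R) :
  (forall l, P.-integrable [set: T] (EFin \o F l)) ->
  P.-integrable [set: T] (EFin \o (fun w => \sum_(l < N) c l * F l w)) /\
  \int[P]_w (\sum_(l < N) c l * F l w) = \sum_(l < N) c l * \int[P]_w F l w.
Proof.
move=> iF; elim: N => [|N [IH1 IH2]].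
  have e : (fun w => \sum_(l < 0) c l * F l w) = (fun w => 0 * F 0%N w).
    by apply/funext => w; rewrite big_ord0 mul0r.
  rewrite e; split; first by have := integrableZl measurableT 0 (iF 0%N).
  by rewrite RintegralZl // mul0r big_ord0.
have e : (fun w => \sum_(l < N.+1) c l * F l w) =
    (fun w => \sum_(l < N) c l * F l w + c N * F N w).
  by apply/funext => w; rewrite big_ord_recr.
rewrite e; split; first exact: integrable_lin.
by rewrite Rintegral_lin // IH2 big_ord_recr.
Qed.

End linear_combinations.

Section trigonometric_moments.
Context d (T : measurableType d) (R : realType) (P : probability T R).
Variable Y : T -> R.
Hypothesis mY : measurable_fun [set: T] Y.
Hypothesis Y0 : forall w, 0 <= Y w.
Hypothesis iY : forall j : nat, P.-integrable [set: T] (EFin \o (fun w => Y w ^+ j)).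

Definition cosmom (j : nat) (t : R) : R := \int[P]_w (Y w ^+ j * cosd j (t * Y w)).

Lemma measurable_cosd j : measurable_fun [set: R] (@cosd R j).
Proof.
apply: continuous_measurable_fun => x; apply: differentiable_continuous.
by apply/derivable1_diffP; have [] := is_derive_cosd j x.
Qed.

Lemma integrable_cosmom i j t :
  P.-integrable [set: T] (EFin \o (fun w => Y w ^+ i * cosd j (t * Y w))).
Proof.
apply: le_integrable (iY i) => //.
  apply/measurable_EFinP; apply: measurable_funM; first exact: measurable_funX.
  apply: (@measurableT_comp _ _ _ _ _ _ (@cosd R j)); first exact: measurable_cosd.
  exact: measurable_funM.
move=> w _ /=; rewrite lee_fin normrM ler_piMr // ; exact: cosd_max.
Qed.

Lemma cosmom_norm j t : `|cosmom j t| <= \int[P]_w (Y w ^+ j).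
Proof.
apply: le_trans (le_normr_Rintegral _ (integrable_cosmom _ _ _)) _ => //.
apply: le_Rintegral => //.
  by have := integrable_norm (integrable_cosmom j j t).
move=> w _ /=; rewrite normrM ger0_norm ?exprn_ge0 // ler_piMr ?exprn_ge0 //.
exact: cosd_max.
Qed.

Lemma cosmom_taylor N i (t h : R) : 0 <= h ->
  `|cosmom i (t + h) - \sum_(l < N) h ^+ l / l`!%:R * cosmom (i + l) t| <=
  h ^+ N / N`!%:R * \int[P]_w (Y w ^+ (i + N)).
Proof.
move=> h0.
have [iS eS] := Rintegral_lincomb N (fun l => h ^+ l / l`!%:R)
  (fun l => integrable_cosmom (i + l) (i + l) t).
rewrite /cosmom -eS.
rewrite -RintegralB //; last exact: integrable_cosmom.
have iB := integrableB measurableT (integrable_cosmom i i (t + h)) iS.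
rewrite -RintegralZl //.
apply: le_trans (le_normr_Rintegral _ _) _ => //.
apply: le_Rintegral => //.
- exact: integrable_norm iB.
- by have := integrableZl measurableT (h ^+ N / N`!%:R) (iY (i + N)).
move=> w _.
have hY : 0 <= h * Y w by rewrite mulr_ge0.
have := cosd_taylor N i (t * Y w) hY; rewrite -mulrDl => H.
have := ler_wpM2l (exprn_ge0 i (Y0 w)) H.
rewrite -[X in X * `|_| <= _](ger0_norm (exprn_ge0 i (Y0 w))) -normrM mulrBr big_distrr /=.
move=> H2; apply: le_trans (le_trans _ H2) _; last first.
  by rewrite exprMn exprD; rewrite le_eqVlt; apply/orP; left; apply/eqP; ring.
rewrite le_eqVlt; apply/orP; left; apply/eqP; congr (`|_ - _|).
by apply: eq_bigr => l _; rewrite exprMn exprD; ring.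
Qed.

End trigonometric_moments.

Section stepping.
Context d (T : measurableType d) d' (T' : measurableType d') (R : realType).
Context (P : probability T R) (P' : probability T' R).
Variables (Y : T -> R) (Y' : T' -> R) (K : R).
Hypothesis (mY : measurable_fun [set: T] Y) (Y0 : forall w, 0 <= Y w).
Hypothesis (mY' : measurable_fun [set: T'] Y') (Y'0 : forall w, 0 <= Y' w).
Hypothesis iY : forall j : nat, P.-integrable [set: T] (EFin \o (fun w => Y w ^+ j)).
Hypothesis iY' : forall j : nat, P'.-integrable [set: T'] (EFin \o (fun w => Y' w ^+ j)).
Hypothesis K0 : 0 < K.
Hypothesis bY : forall q, \int[P]_w (Y w ^+ (4 * q)) <= K ^+ q * (4 * q)`!%:R.
Hypothesis bY' : forall q, \int[P']_w (Y' w ^+ (4 * q)) <= K ^+ q * (4 * q)`!%:R.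

Definition cosdiff j t : R := cosmom P Y j t - cosmom P' Y' j t.

Variable h : R.
Hypothesis h0 : 0 < h.
Hypothesis hK : 16 * K * h ^+ 4 <= 1 / 2.

Lemma cosdiff_remainder i q : (i <= 4 * q)%N ->
  h ^+ (4 * q - i) / (4 * q - i)`!%:R * (K ^+ q * (4 * q)`!%:R) <=
  i`!%:R / h ^+ i * (1 / 2) ^+ q.
Proof.
move=> iq.
have B : (4 * q)`!%:R <= i`!%:R * 16 ^+ q * (4 * q - i)`!%:R :> R.
  have e : (4 * q)`!%:R = 'C(4 * q, i)%:R * (i`!%:R * (4 * q - i)`!%:R) :> R.
    by rewrite -!natrM bin_fact.
  have b : 'C(4 * q, i)%:R <= 16 ^+ q :> R.
    rewrite (_ : 16 = 2 ^+ 4 :> R); last by ring.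
    rewrite -exprM -natrX ler_nat -[(2 ^ _)%N]/((1 + 1) ^ (4 * q))%N expnDn.
    have iq1 : (i < (4 * q).+1)%N by rewrite ltnS.
    by rewrite (bigD1 (Ordinal iq1)) //= !exp1n !muln1 leq_addr.
  rewrite e (mulrA _ i`!%:R) ler_wpM2r // mulrC; exact: ler_wpM2l.
have F0 : 0 < (4 * q - i)`!%:R :> R by rewrite ltr0n fact_gt0.
have hi0 : 0 < h ^+ i by rewrite exprn_gt0.
have hX : h ^+ (4 * q - i) = h ^+ (4 * q) / h ^+ i.
  by rewrite -{2}(subnK iq) exprD mulfK // gt_eqF.
have c0 : 0 <= h ^+ (4 * q - i) / (4 * q - i)`!%:R * K ^+ q.
  by rewrite mulr_ge0 ?divr_ge0 ?exprn_ge0 ?ltW.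
rewrite mulrA; apply: le_trans (ler_wpM2l c0 B) _; rewrite hX.
have -> : h ^+ (4 * q) / h ^+ i / (4 * q - i)`!%:R * K ^+ q *
   (i`!%:R * 16 ^+ q * (4 * q - i)`!%:R) = i`!%:R / h ^+ i * (16 * K * h ^+ 4) ^+ q.
  rewrite (exprMn _ (16 * K)) (exprMn _ 16) exprM.
  move: (h ^+ i) hi0 ((h ^+ 4) ^+ q) (K ^+ q) (16 ^+ q) ((4 * q - i)`!%:R) F0 => a a0 b c e f f0.
  by field; rewrite !gt_eqF.
apply: ler_wpM2l; first by rewrite divr_ge0 // ltW.
by apply: lerXn2r; rewrite ?nnegrE // mulr_ge0 ?exprn_ge0 ?mulr_ge0 // ltW.
Qed.

Lemma cosdiff_step t i : (forall j, 0 <= cosdiff j t) ->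
  cosdiff i t + h * cosdiff i.+1 t <= cosdiff i (t + h).
Proof.
move=> D0.
have key q : (i + 2 <= 4 * q)%N ->
  cosdiff i t + h * cosdiff i.+1 t - 2 * (i`!%:R / h ^+ i * (1 / 2) ^+ q) <= cosdiff i (t + h).
  move=> iq; have iq' : (i <= 4 * q)%N by rewrite (leq_trans _ iq) // leq_addr.
  have T1 := cosmom_taylor mY Y0 iY (4 * q - i) i t (ltW h0).
  have T2 := cosmom_taylor mY' Y'0 iY' (4 * q - i) i t (ltW h0).
  rewrite subnKC // in T1 T2.
  have c0 : 0 <= h ^+ (4 * q - i) / (4 * q - i)`!%:R by rewrite divr_ge0 // exprn_ge0 // ltW.
  have R1 := le_trans (le_trans T1 (ler_wpM2l c0 (bY q))) (cosdiff_remainder iq').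
  have R2 := le_trans (le_trans T2 (ler_wpM2l c0 (bY' q))) (cosdiff_remainder iq').
  have S0 : cosdiff i t + h * cosdiff i.+1 t <=
    \sum_(l < 4 * q - i) h ^+ l / l`!%:R * cosmom P Y (i + l) t -
    \sum_(l < 4 * q - i) h ^+ l / l`!%:R * cosmom P' Y' (i + l) t.
    rewrite -sumrB.
    have [m ->] : exists m, (4 * q - i = m.+2)%N by exists (4 * q - i - 2)%N; lia.
    pose f l := h ^+ l / l`!%:R * cosdiff (i + l) t.
    rewrite (eq_bigr (fun l : 'I_m.+2 => f l)); last by move=> l _; rewrite /f mulrBr.
    have f0 : f 0%N = cosdiff i t by rewrite /f addn0 expr0 fact0 divr1 mul1r.
    have f1 : f 1%N = h * cosdiff i.+1 t by rewrite /f addn1 expr1 divr1.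
    rewrite !big_ord_recl /= -f0 -f1 addrA lerDl; apply: sumr_ge0 => l _.
    by rewrite /f mulr_ge0 // divr_ge0 // exprn_ge0 // ltW.
  move: R1 R2 S0; rewrite !ler_norml /cosdiff => /andP[a1 a2] /andP[b1 b2].
  lra.
have L : cosdiff i t + h * cosdiff i.+1 t - 2 * (i`!%:R / h ^+ i * (1 / 2) ^+ q)
    @[q --> \oo] --> cosdiff i t + h * cosdiff i.+1 t.
  rewrite -[X in _ --> X]subr0; apply: cvgB; first exact: cvg_cst.
  rewrite -[X in _ --> X](mulr0 2); apply: cvgMl_tmp.
  rewrite -[X in _ --> X](mulr0 (i`!%:R / h ^+ i)); apply: cvgMl_tmp.
  by apply: cvg_expr; rewrite ger0_norm; lra.
apply: (cvgr_to_le L); near=> q; apply: key; near: q.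
by exists (i + 2)%N => // q /= iq; rewrite (leq_trans iq) // leq_pmull.
Unshelve. all: by end_near. Qed.

Lemma cosdiff_ge0 n j : (forall j, 0 <= cosdiff j 0) -> 0 <= cosdiff j (n%:R * h).
Proof.
move=> D0; elim: n j => [|n IH] j; first by rewrite mul0r.
rewrite -natr1 mulrDl mul1r; apply: le_trans (cosdiff_step j IH).
by rewrite addr_ge0 // mulr_ge0 // ltW.
Qed.

(** a bounded absolutely monotone function is constant *)
Lemma cosdiff2_le0 : (forall j, 0 <= cosdiff j 0) -> cosdiff 2 0 <= 0.
Proof.
move=> D0; have Dn n j := cosdiff_ge0 n j D0.
have D2 n : cosdiff 2 0 <= cosdiff 2 (n%:R * h).
  elim: n => [|n IH]; first by rewrite mul0r.
  rewrite -natr1 mulrDl mul1r; apply: le_trans (cosdiff_step 2 (Dn n)).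
  by rewrite (le_trans IH) // lerDl mulr_ge0 ?Dn // ltW.
have D1 n : n%:R * h * cosdiff 2 0 <= cosdiff 1 (n%:R * h).
  elim: n => [|n IH]; first by rewrite !mul0r.
  rewrite -natr1 !mulrDl !mul1r; apply: le_trans (cosdiff_step 1 (Dn n)).
  by rewrite lerD // ler_wpM2l // ltW.
rewrite leNgt; apply/negP => p.
pose B : R := \int[P]_w (Y w ^+ 1) + \int[P']_w (Y' w ^+ 1).
have Bn n : n%:R * (h * cosdiff 2 0) <= B.
  rewrite mulrA; apply: le_trans (D1 n) _; apply: le_trans (ler_norm _) _.
  apply: le_trans (ler_normB _ _) _; apply: lerD; exact: cosmom_norm.
have hp : 0 < h * cosdiff 2 0 by rewrite mulr_gt0.
have := Bn (Num.truncn (B / (h * cosdiff 2 0))).+1.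
by rewrite -ler_pdivlMr // leNgt truncnS_gt.
Qed.

End stepping.

Section agreement.
Context d (T : measurableType d) d' (T' : measurableType d') (R : realType).
Context (P : probability T R) (P' : probability T' R).
Variables (Y : T -> R) (Y' : T' -> R).
Hypothesis (mY : measurable_fun [set: T] Y) (Y0 : forall w, 0 <= Y w).
Hypothesis (mY' : measurable_fun [set: T'] Y') (Y'0 : forall w, 0 <= Y' w).

Definition agree (f : R -> R) :=
  [/\ measurable_fun [set: R] f, exists M, forall x, `|f x| <= M &
      \int[P]_w f (Y w) = \int[P']_w f (Y' w)].

Lemma bounded_integrable d0 (T0 : measurableType d0) (Q : probability T0 R) (f : T0 -> R) M :
  measurable_fun [set: T0] f -> (forall w, `|f w| <= M) ->
  Q.-integrable [set: T0] (EFin \o f).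
Proof.
move=> mf fM; have M0 : 0 <= M by exact: le_trans (normr_ge0 _) (fM point).
have iM := finite_measure_integrable_cst Q M measurableT.
apply: le_integrable iM => //; first exact/measurable_EFinP.
by move=> w _ /=; rewrite lee_fin (le_trans (fM w)) // ler_norm.
Qed.

Lemma agree_integrable f : agree f ->
  P.-integrable [set: T] (EFin \o (f \o Y)) /\ P'.-integrable [set: T'] (EFin \o (f \o Y')).
Proof.
move=> [mf [M fM] _]; split.
  by apply: (@bounded_integrable _ _ P (f \o Y) M); [exact: measurableT_comp|move=> w; exact: fM].
by apply: (@bounded_integrable _ _ P' (f \o Y') M); [exact: measurableT_comp|move=> w; exact: fM].
Qed.

Lemma agree_lin c f g : agree f -> agree g -> agree (fun x => f x + c * g x).
Proof.
move=> af ag; have [if1 if2] := agree_integrable af; have [ig1 ig2] := agree_integrable ag.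
case: af ag => [mf [M fM] ef] [mg [N gN] eg]; split.
- apply: measurable_funD => //; exact: measurable_funM.
- exists (M + `|c| * N) => x; rewrite (le_trans (ler_normD _ _)) // lerD //.
  by rewrite normrM ler_wpM2l.
- by rewrite (Rintegral_lin c if1 ig1) (Rintegral_lin c if2 ig2) /= ef eg.
Qed.

Lemma eq_agree f g : f =1 g -> agree f -> agree g.
Proof. by move=> /funext ->. Qed.

Lemma agree_lim (f : nat -> R -> R) (g : R -> R) : (forall n, agree (f n)) ->
  (forall n x, `|f n x| <= 1) -> (forall x, `|g x| <= 1) -> measurable_fun [set: R] g ->
  (forall x, f n x @[n --> \oo] --> g x) -> agree g.
Proof.
move=> af f1 g1 mg fg.
have L d0 (T0 : measurableType d0) (Q : probability T0 R) (U : T0 -> R) : measurable_fun [set: T0] U ->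
    \int[Q]_w f n (U w) @[n --> \oo] --> \int[Q]_w g (U w).
  move=> mU.
  have [] := @dominated_convergence _ _ _ Q [set: T0] measurableT
    (fun n => EFin \o (f n \o U)) (EFin \o (g \o U)) (fun=> 1%E).
  - move=> n; apply/measurable_EFinP; apply: measurableT_comp => //.
    by case: (af n).
  - by apply/measurable_EFinP; apply: measurableT_comp.
  - apply: aeW => w _ /=; apply: cvg_EFin; first exact: nearW.
    exact: fg.
  - exact: finite_measure_integrable_cst.
  - by apply: aeW => w n _ /=; rewrite lee_fin f1.
  move=> ig _ H; rewrite /Rintegral; apply: fine_cvg; rewrite fineK //.
  exact: integrable_fin_num.
split=> //; first by exists 1.
have H1 := L _ _ P Y mY; have H2 := L _ _ P' Y' mY'.
have e : (fun n => \int[P]_w f n (Y w)) = (fun n => \int[P']_w f n (Y' w)).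
  by apply/funext => n; case: (af n).
by rewrite e in H1; rewrite (cvg_unique _ H1 H2).
Qed.

Hypothesis cosE : forall t, 0 <= t -> \int[P]_w cos (t * Y w) = \int[P']_w cos (t * Y' w).

Lemma measurable_cos : measurable_fun [set: R] (@cos R).
Proof. by apply: continuous_measurable_fun; exact: continuous_cos. Qed.

Lemma agree_cos t : agree (fun y => cos (t * y)).
Proof.
wlog t0 : t / 0 <= t.
  move=> H; have [/H//|t0] := leP 0 t.
  apply: (@eq_agree (fun y => cos (- t * y))); first by move=> y; rewrite mulNr cosN.
  by apply: H; rewrite oppr_ge0 ltW.
split; last exact: cosE.
- by apply: measurableT_comp; [exact: measurable_cos|exact: measurable_funM].
- by exists 1 => x; exact: cos_max.
Qed.

Lemma agree_cosX s N t : agree (fun y => cos (s * y) ^+ N * cos (t * y)).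
Proof.
elim: N t => [|N IH] t.
  by apply: eq_agree (agree_cos t) => y; rewrite expr0 mul1r.
have H := agree_lin 1 (IH (s + t)) (IH (s - t)).
have Z := agree_lin (-1) H H.
apply: eq_agree (agree_lin (1 / 2) Z H) => y.
have -> : cos ((s + t) * y) = cos (s * y) * cos (t * y) - sin (s * y) * sin (t * y).
  by rewrite mulrDl cosD.
have -> : cos ((s - t) * y) = cos (s * y) * cos (t * y) + sin (s * y) * sin (t * y).
  by rewrite mulrBl cosB.
by rewrite exprS; field.
Qed.

Lemma cos_expR_dist (x : R) : `|cos x - expR (- (x ^+ 2 / 2))| <= x ^+ 4.
Proof.
wlog x0 : x / 0 <= x.
  move=> H; have [/H//|x0] := leP 0 x.
  have := H (- x); rewrite oppr_ge0 cosN !sqrrN (_ : (- x) ^+ 4 = x ^+ 4); last by ring.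
  by apply; exact: ltW.
have x4 : 0 <= x ^+ 4 by rewrite exprn_ge0.
have := cosd_taylor 4 0 0 x0.
rewrite !big_ord_recr big_ord0 /= !add0n !add0r cosd0.
rewrite (cosd_even_at0 R 0) (cosd_odd_at0 R 0) (cosd_even_at0 R 1) (cosd_odd_at0 R 1).
rewrite !mulr0 !addr0 expr0 fact0 divr1 !mulr1 expr1 mulrN1 => H.
have f4 : x ^+ 4 / 4`!%:R <= x ^+ 4 / 2.
  by rewrite ler_wpM2l // lef_pV2 ?posrE // ler_nat.
have u0 : 0 <= x ^+ 2 / 2 by rewrite divr_ge0 // sqr_ge0.
set u := x ^+ 2 / 2 in u0 *.
have uE : u ^+ 2 = x ^+ 4 / 4 by rewrite /u; field.
have e1 : 1 - u <= expR (- u) by exact: expR_ge1Dx.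
have e2 : expR (- u) <= 1 - u + u ^+ 2.
  have p : 0 < 1 + u by rewrite ltr_pwDl.
  rewrite expRN; apply: (@le_trans _ _ (1 + u)^-1).
    by rewrite lef_pV2 ?posrE ?expR_gt0 // expR_ge1Dx.
  rewrite -[leLHS]mul1r ler_pdivrMr //.
  have u3 : 0 <= u ^+ 3 by rewrite exprn_ge0.
  have -> : (1 - u + u ^+ 2) * (1 + u) = 1 + u ^+ 3 by ring.
  by rewrite lerDl.
have H2 : `|cos x - (1 - u)| <= x ^+ 4 / 2 by apply: (le_trans _ f4).
move: H2; rewrite !ler_norml uE in e2 * => /andP[a1 a2]; apply/andP; split; lra.
Qed.

Lemma normB_exp (a b : R) n : `|a| <= 1 -> `|b| <= 1 -> `|a ^+ n - b ^+ n| <= n%:R * `|a - b|.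
Proof.
move=> a1 b1; elim: n => [|n IH]; first by rewrite subrr normr0 mul0r.
have -> : a ^+ n.+1 - b ^+ n.+1 = a * (a ^+ n - b ^+ n) + (a - b) * b ^+ n.
  by rewrite !exprS; ring.
rewrite (le_trans (ler_normD _ _)) // -natr1 [leRHS]mulrDl mul1r !normrM lerD //.
  by rewrite (le_trans (ler_wpM2r _ a1)) // mul1r.
by rewrite ler_piMr // normrX exprn_ile1.
Qed.

Lemma agree_gauss a : 0 <= a -> agree (fun y => expR (- (a * y ^+ 2))).
Proof.
move=> a0; pose s n : R := Num.sqrt (2 * a / n.+1%:R).
have sE n : s n ^+ 2 = 2 * a / n.+1%:R.
  by rewrite sqr_sqrtr // divr_ge0 // mulr_ge0.
apply: (@agree_lim (fun n y => cos (s n * y) ^+ n.+1)).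
- by move=> n; apply: eq_agree (agree_cosX (s n) n.+1 0) => y; rewrite mul0r cos0 mulr1.
- by move=> n x; rewrite normrX exprn_ile1 // cos_max.
- by move=> x; rewrite ger0_norm ?expR_ge0 // expR_le1 oppr_le0 mulr_ge0 // sqr_ge0.
- apply: (measurableT_comp (f := @expR R)); first exact: measurable_expR.
  by apply: measurable_funN; apply: measurable_funM => //; exact: measurable_funX.
move=> y; apply/subr_cvg0; apply/norm_cvg0P.
pose C : R := (2 * a * y ^+ 2) ^+ 2.
have H : C / n.+1%:R @[n --> \oo] --> (0 : R).
  by rewrite -[X in _ --> X](mulr0 C); apply: cvgMl_tmp; exact: cvg_harmonic.
apply: (squeeze_cvgr _ (cvg_cst 0) H); near=> n; rewrite normr_ge0 /=.
have -> : expR (- (a * y ^+ 2)) = expR (- ((s n * y) ^+ 2 / 2)) ^+ n.+1.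
  rewrite -expRM_natl; congr expR; rewrite exprMn sE.
  have n1 : n.+1%:R != 0 :> R by rewrite pnatr_eq0.
  by move: (n.+1%:R) n1 => N N0; field.
apply: (le_trans (normB_exp _ _ _)).
- exact: cos_max.
- by rewrite ger0_norm ?expR_ge0 // expR_le1 oppr_le0 divr_ge0 // sqr_ge0.
apply: (le_trans (ler_wpM2l _ (cos_expR_dist _))) => //.
rewrite (_ : (s n * y) ^+ 4 = (s n ^+ 2 * y ^+ 2) ^+ 2); last by ring.
have n1 : n.+1%:R != 0 :> R by rewrite pnatr_eq0.
rewrite sE /C le_eqVlt; apply/orP; left; apply/eqP.
by move: (n.+1%:R) n1 => N N0; field.
Unshelve. all: by end_near. Qed.

Lemma agree_gaussX b N a : 0 <= b -> 0 <= a ->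
  agree (fun y => (1 - expR (- (b * y ^+ 2))) ^+ N * expR (- (a * y ^+ 2))).
Proof.
move=> b0; elim: N a => [|N IH] a a0.
  by apply: eq_agree (agree_gauss a0) => y; rewrite expr0 mul1r.
apply: eq_agree (agree_lin (-1) (IH _ a0) (IH _ (addr_ge0 a0 b0))) => y.
by rewrite (mulrDl a b) opprD expRD (exprS _ N); ring.
Qed.

Lemma agree_tail (a : R) : 0 <= a -> agree (fun y => ((a < y ^+ 2)%R)%:R).
Proof.
move=> a0; pose N n := (Num.truncn (n%:R * expR (n%:R * a) : R)).+1.
apply: (@agree_lim (fun n y => (1 - expR (- (n%:R * y ^+ 2))) ^+ N n)).
- move=> n; have := agree_gaussX (N n) (ler0n R n) (lexx 0).
  by apply: eq_agree => y; rewrite mul0r oppr0 expR0 mulr1.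
- move=> n x; have h : expR (- (n%:R * x ^+ 2)) <= 1 :> R.
    by rewrite expR_le1 oppr_le0 mulr_ge0 // sqr_ge0.
  have h2 := expR_ge0 (- (n%:R * x ^+ 2) : R).
  by rewrite normrX exprn_ile1 // ger0_norm; lra.
- by move=> x; case: (_ < _); rewrite ?normr1 // normr0.
- rewrite (_ : (fun y => _) = fun y => if a < y ^+ 2 then 1 else 0); last first.
    by apply/funext => y; case: (_ < _).
  apply: measurable_fun_ifT => //.
  apply: measurable_fun_ltr => //; exact: measurable_funX.
move=> y; case: ltP => ya; last first.
  have H : expR (- n%:R) @[n --> \oo] --> (0 : R) by exact: cvgn_expR.
  apply: (squeeze_cvgr _ (cvg_cst 0) H); near=> n.
  set q := expR (- (n%:R * y ^+ 2)).
  have q1 : q <= 1 by rewrite expR_le1 oppr_le0 mulr_ge0 // sqr_ge0.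
  rewrite exprn_ge0 ?subr_ge0 //=.
  have h1 : 1 - q <= expR (- q) by have := expR_ge1Dx (- q).
  apply: (@le_trans _ _ (expR (- q) ^+ N n)).
    by apply: lerXn2r; rewrite ?nnegrE ?subr_ge0 // expR_ge0.
  rewrite -expRM_natl ler_expR mulrN lerN2.
  have h2 : n%:R * expR (n%:R * a) <= (N n)%:R :> R by exact/ltW/truncnS_gt.
  apply: le_trans (ler_wpM2r (expR_ge0 _) h2).
  rewrite -mulrA -expRD ler_peMr // -expR0 ler_expR -mulrBr mulr_ge0 // subr_ge0.
  exact: ya.
have dl : 0 < y ^+ 2 - a by rewrite subr_gt0.
set dd := y ^+ 2 - a in dl.
have y20 : 0 < y ^+ 2 by exact: le_lt_trans a0 ya.
pose C : R := 2 / dd ^+ 2 + (y ^+ 2)^-1.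
have H : 1 - C / n%:R @[n --> \oo] --> (1 : R).
  rewrite -[X in _ --> X]subr0; apply: cvgB; first exact: cvg_cst.
  rewrite -[X in _ --> X](mulr0 C); apply: cvgMl_tmp.
  rewrite -(cvg_shiftS (fun n : nat => n%:R^-1 : R)); exact: cvg_harmonic.
rewrite [X in _ --> X]mulr1n.
apply: (squeeze_cvgr _ H (cvg_cst (1 : R^o))); near=> n.
have n0 : 0 < n%:R :> R by rewrite ltr0n; near: n; exists 1%N.
set q := expR (- (n%:R * y ^+ 2)).
have q0 : 0 <= q by exact: expR_ge0.
have q1 : q <= 1 by rewrite expR_le1 oppr_le0 mulr_ge0 // sqr_ge0.
apply/andP; split; last by rewrite exprn_ile1 ?subr_ge0 // lerBlDr lerDl.
have bern M : 1 - M%:R * q <= (1 - q) ^+ M.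
  elim: M => [|M IH]; first by rewrite mul0r subr0.
  rewrite exprS; have q1' : 0 <= 1 - q by rewrite subr_ge0.
  apply: le_trans (ler_wpM2l q1' IH).
  rewrite -natr1; have : 0 <= M%:R * q * q by rewrite !mulr_ge0.
  by move: (M%:R) => m; nra.
apply: le_trans (bern (N n)); rewrite lerD2l lerN2.
have h2 : (N n)%:R <= n%:R * expR (n%:R * a) + 1 :> R.
  by rewrite -natr1 lerD2r truncn_le // mulr_ge0 // expR_ge0.
apply: (le_trans (ler_wpM2r q0 h2)); rewrite mulrDl mul1r /C mulrDl; apply: lerD.
  rewrite -mulrA -expRD.
  have -> : n%:R * a + - (n%:R * y ^+ 2) = - (n%:R * dd) by rewrite /dd; ring.
  have u0 : 0 < n%:R * dd by rewrite mulr_gt0.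
  have h : (n%:R * dd) ^+ 2 / 2 <= expR (n%:R * dd).
    by apply: le_trans (expR_ge1Dxn 1 (ltW u0)); rewrite lerDr.
  have e0 := expR_gt0 (n%:R * dd).
  rewrite expRN ler_pdivrMr // [leRHS]mulrC -ler_pdivrMr ?divr_gt0 ?exprn_gt0 //.
  apply: le_trans h; rewrite le_eqVlt; apply/orP; left; apply/eqP.
  by move: (n%:R) n0 dl => m m0 dl; field; rewrite !gt_eqF.
have h : n%:R * y ^+ 2 <= expR (n%:R * y ^+ 2).
  by apply: le_trans (expR_ge1Dx _); rewrite lerDr.
by rewrite /q expRN -invfM (mulrC _ n%:R) lef_pV2 ?posrE ?expR_gt0 ?(mulr_gt0 n0 y20).
Unshelve. all: by end_near. Qed.

End agreement.

Section square_root.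
Context d (T : measurableType d) (R : realType) (P : probability T R).
Variable X : T -> R.
Hypothesis mX : measurable_fun [set: T] X.
Hypothesis iX : forall j : nat, P.-integrable [set: T] (EFin \o (fun w => X w ^+ j)).

Lemma measurable_sqrt_comp : measurable_fun [set: T] (fun w => Num.sqrt (X w)).
Proof.
apply: measurableT_comp => //; apply: continuous_measurable_fun.
exact: sqrt_continuous.
Qed.

Lemma integrable_sqrtX j :
  P.-integrable [set: T] (EFin \o (fun w => Num.sqrt (X w) ^+ j)).
Proof.
have i1 := finite_measure_integrable_cst P (1 : R) measurableT.
have := integrable_lin 1 i1 (iX (2 * j)).
apply: le_integrable => //.
  by apply/measurable_EFinP; apply: measurable_funX; exact: measurable_sqrt_comp.
move=> w _ /=; rewrite lee_fin mul1r exprM.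
have q0 : 0 <= (X w ^+ 2) ^+ j by rewrite exprn_ge0 // sqr_ge0.
rewrite ger0_norm ?exprn_ge0 // ger0_norm ?addr_ge0 //.
have [x0|x0] := ltP (X w) 0.
  by rewrite ltr0_sqrtr // expr0n; case: (j == 0%N); rewrite ?ler_wpDr // addr_ge0.
have [s1|s1] := leP (Num.sqrt (X w)) 1.
  by rewrite ler_wpDr // exprn_ile1.
rewrite ler_wpDl // -[X in _ <= (X ^+ 2) ^+ j](sqr_sqrtr x0).
apply: lerXn2r; rewrite ?nnegrE ?exprn_ge0 // -exprM.
by rewrite ler_eXnr // ltW.
Qed.

End square_root.

(** the alternating sign makes the missing negative part count positively *)
Lemma sign_pospart_ge0 (R : realType) (x : R) i :
  0 <= (-1) ^+ i * (x ^+ i - (Num.sqrt x ^+ 2) ^+ i).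
Proof.
have [x0|x0] := ltP x 0; last by rewrite sqr_sqrtr // subrr mulr0.
rewrite ltr0_sqrtr // mulrBr -exprMn mulN1r (expr0n _ 2) /= expr0n.
case: i => [|i] /=; first by rewrite !expr0 mulr1 subrr.
by rewrite mulr0 subr0 exprn_ge0 // oppr_ge0 ltW.
Qed.

Section determinacy.
Context d (T : measurableType d) d' (T' : measurableType d') (R : realType).
Context (P : probability T R) (P' : probability T' R).
Variables (Z : T -> R) (X : T' -> R) (K : R).
Hypothesis (mZ : measurable_fun [set: T] Z) (mX : measurable_fun [set: T'] X).
Hypothesis iZ : forall j : nat, P.-integrable [set: T] (EFin \o (fun w => Z w ^+ j)).
Hypothesis iX : forall j : nat, P'.-integrable [set: T'] (EFin \o (fun w => X w ^+ j)).
Hypothesis ZX : forall j, \int[P]_w (Z w ^+ j) = \int[P']_w (X w ^+ j).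
Hypothesis Z0 : forall w, 0 <= Z w.
Hypothesis K0 : 0 < K.
Hypothesis bZ : forall q, \int[P]_w (Z w ^+ q.*2) <= K ^+ q * (4 * q)`!%:R.

Let Y w := Num.sqrt (Z w).
Let Y' w := Num.sqrt (X w).

Let mY : measurable_fun [set: T] Y. Proof. exact: measurable_sqrt_comp. Qed.
Let mY' : measurable_fun [set: T'] Y'. Proof. exact: measurable_sqrt_comp. Qed.
Let Y0 w : 0 <= Y w. Proof. exact: sqrtr_ge0. Qed.
Let Y'0 w : 0 <= Y' w. Proof. exact: sqrtr_ge0. Qed.
Let iY j : P.-integrable [set: T] (EFin \o (fun w => Y w ^+ j)).
Proof. exact: integrable_sqrtX. Qed.
Let iY' j : P'.-integrable [set: T'] (EFin \o (fun w => Y' w ^+ j)).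
Proof. exact: integrable_sqrtX. Qed.

Let sqrY i w : (Y w ^+ 2) ^+ i = Z w ^+ i. Proof. by rewrite sqr_sqrtr. Qed.

Let bY q : \int[P]_w (Y w ^+ (4 * q)) <= K ^+ q * (4 * q)`!%:R.
Proof.
apply: le_trans (bZ q); rewrite le_eqVlt; apply/orP; left; apply/eqP.
apply: eq_Rintegral => w _; rewrite -sqrY -exprM; congr (_ ^+ _); lia.
Qed.

Let bY' q : \int[P']_w (Y' w ^+ (4 * q)) <= K ^+ q * (4 * q)`!%:R.
Proof.
apply: le_trans (bZ q); rewrite ZX; apply: le_Rintegral => // w _.
have := sign_pospart_ge0 (X w) q.*2; rewrite -exprM -[in (-1) ^+ _]mul2n exprM sqrrN.
rewrite !expr1n mul1r subr_ge0; apply: le_trans.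
by rewrite le_eqVlt; apply/orP; left; apply/eqP; congr (_ ^+ _); lia.
Qed.

Let cosdiff0_odd i : cosdiff P P' Y Y' i.*2.+1 0 = 0.
Proof.
rewrite /cosdiff /cosmom.
rewrite (@eq_Rintegral _ _ _ _ _ (fun=> 0)); last by move=> w _; rewrite mul0r cosd_odd_at0 mulr0.
rewrite [X in _ - X](@eq_Rintegral _ _ _ _ _ (fun=> 0)); last by move=> w _; rewrite mul0r cosd_odd_at0 mulr0.
by rewrite /Rintegral !integral0 subrr.
Qed.

Let iD i : P'.-integrable [set: T']
  (EFin \o (fun w => (-1) ^+ i * (X w ^+ i - (Y' w ^+ 2) ^+ i))).
Proof.
have i1 := integrableB measurableT (iX i) (iY' (2 * i)).
have := integrableZl measurableT ((-1) ^+ i) i1.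
apply: eq_integrable => // w _ /=; by rewrite -exprM.
Qed.

Let cosdiff0_even i : cosdiff P P' Y Y' i.*2 0 =
  \int[P']_w ((-1) ^+ i * (X w ^+ i - (Y' w ^+ 2) ^+ i)).
Proof.
have E1 d0 (T0 : measurableType d0) (Q : probability T0 R) (U : T0 -> R) :
    (forall j, Q.-integrable [set: T0] (EFin \o (fun w => U w ^+ j))) ->
    cosmom Q U i.*2 0 = (-1) ^+ i * \int[Q]_w ((U w ^+ 2) ^+ i).
  move=> iU; rewrite /cosmom -RintegralZl //; last first.
    by apply: eq_integrable (iU (2 * i)%N) => // w _ /=; rewrite exprM.
  by apply: eq_Rintegral => w _; rewrite mul0r cosd_even_at0 mulrC -exprM mul2n.
rewrite /cosdiff !E1 // -mulrBr (@eq_Rintegral _ _ _ _ _ (fun w => Z w ^+ i)); last first.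
  by move=> w _; rewrite sqrY.
have i2 : P'.-integrable [set: T'] (EFin \o (fun w => (Y' w ^+ 2) ^+ i)).
  by apply: eq_integrable (iY' (2 * i)) => // w _ /=; rewrite exprM.
rewrite ZX -RintegralB // -RintegralZl //.
by have := integrableB measurableT (iX i) i2.
Qed.

Let cosdiff0_ge0 j : 0 <= cosdiff P P' Y Y' j 0.
Proof.
rewrite -(odd_double_half j); case: (odd j); first by rewrite add1n cosdiff0_odd.
by rewrite add0n cosdiff0_even; apply: Rintegral_ge0 => w _; exact: sign_pospart_ge0.
Qed.

Let small_step : exists2 h0 : R, 0 < h0 & forall h, 0 < h -> h <= h0 -> 16 * K * h ^+ 4 <= 1 / 2.
Proof.
pose h0 : R := Num.min 1 (1 / (32 * K)).
have k0 : 0 < 32 * K by rewrite mulr_gt0.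
exists h0; first by rewrite lt_min ltr01 divr_gt0.
move=> h hp; rewrite le_min => /andP[h1 hK].
have h4 : h ^+ 4 <= h by rewrite -[leRHS]expr1 ler_wiXn2l // ltW.
have : 32 * K * h <= 1 by rewrite mulrC -ler_pdivlMr.
have : 16 * K * h ^+ 4 <= 16 * K * h by rewrite ler_wpM2l // mulr_ge0 // ltW.
lra.
Qed.

Lemma moments_nonneg : {ae P', forall w, 0 <= X w}.
Proof.
have [h hp hK] := small_step.
have := cosdiff2_le0 mY Y0 mY' Y'0 iY iY' K0 bY bY' hp (hK _ hp (lexx _)) cosdiff0_ge0.
rewrite -[2%N]/(1.*2) cosdiff0_even => I0.
have [_ H] := ae_eq_integral_abs P' measurableT (measurable_int _ (iD 1)).
have [+ _] := ae_eq_integral_abs P' measurableT (measurable_int _ (iD 1)).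
case.
  transitivity (\int[P']_w ((-1) ^+ 1 * (X w ^+ 1 - (Y' w ^+ 2) ^+ 1))%:E)%E.
    by apply: eq_integral => w _ /=; rewrite ger0_norm // sign_pospart_ge0.
  apply/eqP; rewrite eq_le; apply/andP; split; last first.
    by apply: integral_ge0 => w _; rewrite lee_fin sign_pospart_ge0.
  by rewrite -[leLHS]fineK ?lee_fin //; exact: (integrable_fin_num measurableT (iD 1)).
move=> N [mN PN sN]; exists N; split=> // w /= Xw; apply: sN => /= /(_ Logic.I) [].
rewrite expr1 mulN1r => /eqP; rewrite oppr_eq0 subr_eq0 !expr1 => /eqP e.
by apply: Xw; rewrite e sqr_ge0.
Qed.

Let cosdiff0 j : cosdiff P P' Y Y' j 0 = 0.
Proof.
rewrite -(odd_double_half j); case: (odd j); first by rewrite add1n cosdiff0_odd.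
rewrite add0n cosdiff0_even /Rintegral.
rewrite (ae_eq_integral (cst 0%E)) ?integral0 //; first exact: measurable_int (iD _).
have [N [mN PN sN]] := moments_nonneg; exists N; split=> // w /= Xw; apply: sN => /= X0.
by apply: Xw => _; rewrite /Y' sqr_sqrtr // subrr mulr0.
Qed.

Let cos_moments t : 0 <= t -> \int[P]_w cos (t * Y w) = \int[P']_w cos (t * Y' w).
Proof.
move=> t0; have [h0 hp hK] := small_step.
have [->|tn0] := eqVneq t 0.
  rewrite (@eq_Rintegral _ _ _ _ _ (fun=> 1)); last by move=> w _; rewrite mul0r cos0.
  rewrite [RHS](@eq_Rintegral _ _ _ _ _ (fun=> 1)); last by move=> w _; rewrite mul0r cos0.
  rewrite !Rintegral_cst //; congr (_ * fine _).
  by transitivity (1%E : \bar R); [exact: probability_setT|apply/esym; exact: probability_setT].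
have tp : 0 < t by rewrite lt_def tn0.
pose n := (Num.truncn (t / h0)).+1.
have n0 : 0 < n%:R :> R by rewrite ltr0n.
have h1 : t / n%:R <= h0.
  by rewrite ler_pdivrMr // mulrC -ler_pdivrMr // ltW // truncnS_gt.
have hK1 := hK _ (divr_gt0 tp n0) h1.
have E (d0 : measure_display) (T0 : measurableType d0) (Q : probability T0 R) (U : T0 -> R) :
    cosmom Q U 0 t = \int[Q]_w cos (t * U w).
  by apply: eq_Rintegral => w _; rewrite expr0 mul1r cosd0.
have tE : n%:R * (t / n%:R) = t by rewrite mulrCA divff ?mulr1 // gt_eqF.
have D1 := cosdiff_ge0 mY Y0 mY' Y'0 iY iY' K0 bY bY' (divr_gt0 tp n0) hK1 n 0 cosdiff0_ge0.
have swap j s : cosdiff P' P Y' Y j s = - cosdiff P P' Y Y' j s by rewrite /cosdiff opprB.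
have D0' j : 0 <= cosdiff P' P Y' Y j 0 by rewrite swap cosdiff0 oppr0.
have D2 := cosdiff_ge0 mY' Y'0 mY Y0 iY' iY K0 bY' bY (divr_gt0 tp n0) hK1 n 0 D0'.
rewrite tE in D1; rewrite tE swap oppr_ge0 in D2.
have D3 : cosdiff P P' Y Y' 0 t == 0 by rewrite eq_le D2 D1.
by move: D3; rewrite /cosdiff subr_eq0 !E => /eqP.
Qed.

Lemma moments_tail (a : R) : 0 <= a ->
  P [set w | a < Z w] = P' [set w | a < X w].
Proof.
move=> a0; have [_ _ e] := agree_tail mY mY' cos_moments a0.
have E (d0 : measure_display) (T0 : measurableType d0) (Q : probability T0 R) (U : T0 -> R) :
   measurable_fun [set: T0] U ->
   (\int[Q]_w ((a < Num.sqrt (U w) ^+ 2)%R)%:R)%R = fine (Q [set w | a < U w]).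
  move=> mU; have mS : measurable [set w | a < U w].
    by rewrite -[X in measurable X]setTI; exact: measurable_fun_ltr.
  rewrite -[X in Q X]setIT -(integral_indic Q measurableT mS); congr fine.
  apply: eq_integral => w _; rewrite indicE.
  have -> : (w \in [set w | a < U w]) = (a < U w).
    by apply/idP/idP => [/set_mem //|h]; exact: mem_set.
  have [u0|u0] := ltP (U w) 0; last by rewrite sqr_sqrtr.
  by rewrite ltr0_sqrtr // expr0n /= ltNge a0 /= ltNge (le_trans (ltW u0) a0).
have mS (d0 : measure_display) (T0 : measurableType d0) (U : T0 -> R) :
   measurable_fun [set: T0] U -> measurable [set w | a < U w].
  by move=> mU; rewrite -[X in measurable X]setTI; exact: measurable_fun_ltr.
rewrite -[LHS]fineK; last by rewrite fin_num_measure //; exact: mS.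
by rewrite -E // e E // fineK // fin_num_measure //; exact: mS.
Qed.

End determinacy.

(** half-lines generate the Borel sets and are stable under intersection *)
Lemma eq_distribution_ccdf d (T : measurableType d) d' (T' : measurableType d') (R : realType)
    (P : probability T R) (P' : probability T' R) (Z : {RV P >-> R}) (X : {RV P' >-> R}) :
  (forall a, ccdf Z a = ccdf X a) ->
  forall A : set R, measurable A -> distribution P' X A = distribution P Z A.
Proof.
move=> E A; rewrite -[measurable A]/((@ocitv R).-sigma.-measurable A).
rewrite RGenOInfty.measurableE => mA.
apply: (@g_sigma_algebra_measure_unique _ R _ (@RGenOInfty.G R) _
  (fun n : nat => `]- n%:R, +oo[%classic) _ _
  (distribution P' X) (distribution P Z) _ _ _ A mA).
- by move=> _ [x ->]; exact: measurable_itv.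
- by move=> n; exists (- n%:R).
- rewrite -subTset => x _; exists (Num.truncn (- x)).+1 => //=.
  by rewrite in_itv /= andbT ltrNl truncnS_gt.
- move=> _ _ [x ->] [y ->]; exists (Num.max x y).
  by apply/seteqP; split => z /=; rewrite !in_itv /= !andbT gt_max => /andP.
- by move=> _ [x ->]; exact/esym/E.
- by move=> n; rewrite (le_lt_trans (probability_le1 _ _)) ?ltry //; exact: measurable_itv.
Qed.

(** a nonnegative law whose moments grow at most like [K ^ q (4 q)!] at the even
    orders is determined by its moments among all real laws *)
Lemma determinacy d (T : measurableType d) d' (T' : measurableType d') (R : realType)
    (P : probability T R) (P' : probability T' R) (Z : {RV P >-> R}) (X : {RV P' >-> R})
    (m : nat -> R) (K : R) :
  has_moments Z m -> has_moments X m -> (forall w, 0 <= Z w) -> 0 < K ->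
  (forall q, m q.*2 <= K ^+ q * (4 * q)`!%:R) ->
  forall A : set R, measurable A -> distribution P' X A = distribution P Z A.
Proof.
move=> hZ hX Z0 K0 mK; apply: eq_distribution_ccdf => a.
have eZ r : \int[P]_w (Z w ^+ r) = m r.
  by case: (hZ r) => _; rewrite unlock /Rintegral => ->.
have eX r : \int[P']_w (X w ^+ r) = m r.
  by case: (hX r) => _; rewrite unlock /Rintegral => ->.
have iZ r : P.-integrable [set: T] (EFin \o (fun w => Z w ^+ r)) by case: (hZ r).
have iX r : P'.-integrable [set: T'] (EFin \o (fun w => X w ^+ r)) by case: (hX r).
have mZ : measurable_fun [set: T] Z by [].
have mX : measurable_fun [set: T'] X by [].
have ZX r : \int[P]_w (Z w ^+ r) = \int[P']_w (X w ^+ r) by rewrite eZ eX.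
have bZ q : \int[P]_w (Z w ^+ q.*2) <= K ^+ q * (4 * q)`!%:R by rewrite eZ.
have Xae := moments_nonneg mZ mX iZ iX ZX Z0 K0 bZ.
have pre (d0 : measure_display) (T0 : measurableType d0) (Q : probability T0 R) (U : {RV Q >-> R}) :
    ccdf U a = Q [set w | a < U w].
  rewrite /ccdf /distribution /pushforward; congr (Q _).
  by apply/seteqP; split => w /=; rewrite in_itv /= andbT.
rewrite !pre; have [a0|a0] := leP 0 a; first exact: (moments_tail mZ mX iZ iX ZX Z0 K0 bZ a0).
have -> : [set w | a < Z w] = setT.
  by rewrite -subTset => w _ /=; rewrite (lt_le_trans a0).
have mS : measurable [set w | a < X w].
  by rewrite -[X in measurable X]setTI; exact: measurable_fun_ltr.
transitivity (1%E : \bar R); first exact: probability_setT.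
have [N [mN PN sN]] := Xae.
rewrite -[X in P' X]setCK probability_setC; last exact: measurableC.
rewrite (_ : P' (~` _) = 0%E) ?sube0 //.
apply: (@subset_measure0 _ _ _ _ _ N) => //; first exact: measurableC.
by move=> w /= Xw; apply: sN => /= X0; apply: Xw; rewrite (lt_le_trans a0).
Qed.

Section empirical_laws.
Variable R : realType.
Implicit Type s : seq R.

Definition ecdf s (x : R) : R := (count (fun v => v <= x) s)%:R / (size s)%:R.
Definition etail s (x : R) : R := (count (fun v => x < v) s)%:R / (size s)%:R.
Definition emom s (r : nat) : R := (\sum_(v <- s) v ^+ r) / (size s)%:R.

Lemma ecdf_ge0 s x : 0 <= ecdf s x. Proof. by rewrite divr_ge0. Qed.

Lemma etail_ge0 s x : 0 <= etail s x. Proof. by rewrite divr_ge0. Qed.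

Lemma ecdfE s x : (0 < size s)%N -> ecdf s x = 1 - etail s x.
Proof.
move=> s0; have sn : (size s)%:R != 0 :> R by rewrite pnatr_eq0 -lt0n.
have -> : ecdf s x = ((size s)%:R - (count (fun v => x < v) s)%:R) / (size s)%:R.
  congr (_ / _); apply/eqP; rewrite eq_sym subr_eq -natrD eqr_nat.
  rewrite -(count_predC (fun v => v <= x) s); apply/eqP; congr (_ + _)%N.
  by apply: eq_count => v /=; rewrite ltNge.
by rewrite /etail; field.
Qed.

Lemma ecdf_le1 s x : ecdf s x <= 1.
Proof.
case: (posnP (size s)) => [/size0nil ->|s0].
  by rewrite /ecdf /= mul0r.
by rewrite ecdfE // lerBlDr lerDl etail_ge0.
Qed.

Lemma etail_le1 s x : (0 < size s)%N -> etail s x <= 1.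
Proof. by move=> s0; have := ecdf_ge0 s x; rewrite ecdfE // subr_ge0. Qed.

Lemma ecdf_nondecreasing s : {homo ecdf s : x y / x <= y}.
Proof.
move=> x y xy; rewrite ler_wpM2r ?invr_ge0 // ler_nat sub_count // => v /= vx.
exact: le_trans vx xy.
Qed.

Lemma ecdf_lt0 s x : all (>= 0) s -> x < 0 -> ecdf s x = 0.
Proof.
move=> /allP s0 x0; rewrite /ecdf (@eq_in_count _ _ pred0) ?count_pred0 ?mul0r //.
by move=> v /s0 /= v0; apply/negbTE; rewrite -ltNge (lt_le_trans x0).
Qed.

Lemma etail_markov s r y : all (>= 0) s -> 0 <= y -> etail s y * y ^+ r <= emom s r.
Proof.
move=> s0 y0; rewrite /etail /emom mulrAC ler_wpM2r ?invr_ge0 //.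
elim: s s0 => [|v s IH] /=; first by rewrite big_nil mul0r.
move=> /andP[v0 /IH {}IH]; rewrite big_cons natrD mulrDl lerD //.
case: ltP => yv; last by rewrite mul0r exprn_ge0.
by rewrite mul1r lerXn2r // ltW.
Qed.

Lemma etail_cauchy s y : (0 < size s)%N -> all (>= 0) s -> 0 <= y ->
  etail s y <= (1 + emom s 2) * (oneDsqr y)^-1.
Proof.
move=> n0 s0 y0; have h2 := etail_markov 2 s0 y0; have h1 := etail_le1 y n0.
rewrite ler_pdivlMr; last by rewrite /oneDsqr ltr_pwDl // sqr_ge0.
by rewrite /oneDsqr mulrDr mulr1 lerD.
Qed.

Lemma emomX s r : emom [seq v ^+ r | v <- s] 1 = emom s r.
Proof. by rewrite /emom size_map big_map; congr (_ / _); apply: eq_bigr => v _; rewrite expr1. Qed.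

(** the layer-cake formula *)
Lemma integral_etail s : all (>= 0) s ->
  (\int[lebesgue_measure]_(y in `[0%R, +oo[) (etail s y)%:E = (emom s 1)%:E)%E.
Proof.
move=> /allP s0; pose D : set R := `[0, +oo[%classic.
have mD : measurable D by exact: measurable_itv.
pose f (v y : R) : \bar R := (\1_(`]-oo, v[%classic : set R) y)%:E.
have mf v : measurable_fun D (f v).
  apply/measurable_EFinP; apply: measurable_indic; exact: measurable_itv.
have f0 v y : D y -> (0 <= f v y)%E by rewrite lee_fin.
have E y : (etail s y)%:E = (((size s)%:R^-1)%R%:E * \sum_(v <- s) f v y)%E.
  rewrite sumEFin -EFinM mulrC; congr (_ / _)%:E.
  rewrite -sum1_count natr_sum big_mkcond /=; apply: eq_bigr => v _.
  rewrite indicE.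
  have -> : (y \in `]-oo, v[%classic) = (y < v).
    by apply/idP/idP => [/set_mem|h]; [|apply: mem_set]; rewrite /= in_itv.
  by case: ifP.
under eq_integral => y _ do rewrite E.
rewrite ge0_integralZl //; last 2 first.
- by apply: emeasurable_sum.
- by move=> y Dy; apply: sume_ge0 => v _; exact: f0.
rewrite ge0_integral_sum // /emom EFinM muleC; congr (_ * _)%E.
rewrite -sumEFin !big_seq; apply: eq_bigr => v /s0 v0.
rewrite expr1 integral_indic //.
have -> : `]-oo, v[ `&` D = `[0, v[%classic.
  apply/seteqP; split => y; rewrite /D /= !in_itv /= ?andbT; first by move=> [-> ->].
  by move=> /andP[-> ->].
suff L : lebesgue_measure (`[0, v[%classic : set R) = v%:E by exact: L.
rewrite lebesgue_measure_itv /= lte_fin; case: ltP v0 => [|v1 v2]; rewrite ?EFinN ?sube0 //.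
by congr (_%:E); apply/eqP; rewrite eq_le v1 v2.
Qed.

End empirical_laws.

Lemma fmap_ultra (T U : Type) (f : T -> U) (F : set_system T) :
  UltraFilter F -> UltraFilter (f @ F).
Proof.
move=> UF; have PF : ProperFilter F := @ultra_proper _ _ UF; split; first exact: fmap_proper_filter.
move=> G PG FG; apply/seteqP; split => // A GA.
have [//|FA] := in_ultra_setVsetC (f @^-1` A) UF.
have GC : G (~` A) by exact: FG.
by have [x []] := filter_ex (filterI GA GC).
Qed.

(** Along an ultrafilter finer than the neighbourhoods of infinity every bounded
    sequence converges; diagonally choosing indices that are good for the first
    rationals turns this limit into the limit of a subsequence. *)
Lemma helly_selection (R : realType) (F : nat -> R -> R) :
  (forall n x, 0 <= F n x <= 1) ->
  exists f : nat -> nat, (forall j, (j <= f j)%N) /\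
  exists G : rat -> R, forall q, F (f j) (ratr q) @[j --> \oo] --> G q.
Proof.
move=> F01; have [U [UU sU]] := ultraFilterLemma (@eventually_filter).
have PU : ProperFilter U := @ultra_proper _ _ UU.
have H q : exists g : R, F n (ratr q) @[n --> U] --> g.
  have := @segment_compact R 0 1; rewrite compact_ultra => /(_ (F ^~ (ratr q) @ U)).
  case=> [||g [_ h]]; last by exists g.
    exact: fmap_ultra.
  by apply: (@filterE _ U) => n; rewrite /= in_itv /=; exact: F01.
have [G GP] := choice H.
have K j : exists n : nat, (j <= n)%N /\
    forall i : 'I_j.+1, if unpickle i is Some q then `|G q - F n (ratr q)| < j.+1%:R^-1 else true.
  have : \forall n \near U, (j <= n)%N /\
    forall i : 'I_j.+1, if unpickle i is Some q then `|G q - F n (ratr q)| < j.+1%:R^-1 else true.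
    apply: filterI; first by apply: sU; exists j.
    apply: filter_forall => i; case: unpickle => [q|]; last exact: filterE.
    have e0 : 0 < j.+1%:R^-1 :> R by rewrite invr_gt0.
    by move/cvgrPdist_lt : (GP q); apply; exact: e0.
  by case/filter_ex => n; exists n.
have [f fP] := choice K; exists f; split; first by move=> j; case: (fP j).
exists G => q; apply/cvgrPdist_lt => e e0.
have [N _ Ne] := near_infty_natSinv_lt (PosNum e0).
exists (maxn N (pickle q)) => // j /=; rewrite geq_max => /andP[Nj qj].
have qj1 : (pickle q < j.+1)%N by rewrite ltnS.
have [_ /(_ (Ordinal qj1))] := fP j.
by rewrite /= pickleK => h; apply: lt_trans h (Ne _ Nj).
Qed.

Section right_continuous_monotone.
Variables (R : realType) (F : R -> R).
Hypothesis ndF : {homo F : x y / x <= y}.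
Hypothesis rcF : right_continuous F.

Lemma countable_not_continuous : countable [set x | ~ {for x, continuous F}].
Proof.
apply: (@sub_countable _ _ _ (\bigcup_(n : nat)
  [set x | (x \in `](- n%:R), n%:R[) /\ discontinuity F x])).
  apply: subset_card_le => x /= xF.
  have xn : `|x| < (Num.truncn `|x|).+1%:R by exact: truncnS_gt.
  exists (Num.truncn `|x|).+1 => //=; split; first by rewrite in_itv /= -ltr_norml.
  have cl : cvg (F y @[y --> x^'-]).
    apply: nondecreasing_at_left_is_cvgr.
      by apply: nearW => z a b _ _; exact: ndF.
    apply: nearW => z; exists (F x) => _ [y + <-] /=.
    by rewrite ?in_itv /= => /andP[_ /ltW]; exact: ndF.
  have cr : F y @[y --> x^'+] --> F x by exact: rcF.
  split=> //; first by apply/cvg_ex; exists (F x).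
  apply: contra_notN xF => /eqP e; apply/left_right_continuousP; split=> //.
  by rewrite -(cvg_lim (@Rhausdorff R) cr) -e.
apply: bigcup_countable => // n _; apply: discontinuity_countable.
by move=> x y _ _; exact: ndF.
Qed.

End right_continuous_monotone.

Section limit_law.
Variables (R : realType) (F : nat -> R -> R) (G : rat -> R) (M : R).
Hypothesis F01 : forall n x, 0 <= F n x <= 1.
Hypothesis ndF : forall n, {homo F n : x y / x <= y}.
Hypothesis Fneg : forall n x, x < 0 -> F n x = 0.
Hypothesis tightF : forall n x, 0 < x -> 1 - M / x <= F n x.
Hypothesis M0 : 0 <= M.
Hypothesis FG : forall q, F n (ratr q) @[n --> \oo] --> G q.

(** the right-continuous version of the limit on the rationals *)
Definition limcdf (x : R) : R := inf [set G q | q in [set q | x < ratr q]].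

Let G_ge0 q : 0 <= G q.
Proof. by apply: (cvgr_to_ge (@FG q)); apply: nearW => n; case/andP: (F01 n (ratr q)). Qed.

Let G_le1 q : G q <= 1.
Proof. by apply: (cvgr_to_le (@FG q)); apply: nearW => n; case/andP: (F01 n (ratr q)). Qed.

Let G_tight q : 0 < ratr q :> R -> 1 - M / ratr q <= G q.
Proof.
move=> q0; set c := 1 - _; have h n : c <= F n (ratr q) by exact: tightF.
by apply: (cvgr_to_ge (@FG q)); exact: nearW.
Qed.

Let G_nd q q' : (ratr q : R) <= ratr q' -> G q <= G q'.
Proof. by move=> qq; apply: (ler_cvg_to (@FG q) (@FG q')); apply: nearW => n; exact: ndF. Qed.

Let limcdf_le x q : x < ratr q -> limcdf x <= G q.
Proof.
move=> xq; apply: inf_lbound; last by exists q.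
by exists 0 => _ [q' _ <-]; exact: G_ge0.
Qed.

Let le_limcdf x c : (forall q, x < ratr q -> c <= G q) -> c <= limcdf x.
Proof.
move=> H; apply: lb_le_inf; last by move=> _ [q xq <-]; exact: H.
have [q] : exists q : rat, ratr q \in `]x, x + 1[%R by apply: rat_in_itvoo; rewrite ltrDl.
by rewrite in_itv /= => /andP[xq _]; exists (G q), q.
Qed.

Lemma limcdf_nondecreasing : {homo limcdf : x y / x <= y}.
Proof.
by move=> x y xy; apply: le_limcdf => q yq; apply: limcdf_le; exact: le_lt_trans yq.
Qed.

Lemma limcdf_right_continuous : right_continuous limcdf.
Proof.
move=> x; apply/cvgrPdist_lt => e e0.
have [q [xq qe]] : exists q, x < ratr q /\ G q < limcdf x + e.
  apply: contrapT => H; suff : limcdf x + e <= limcdf x by rewrite gerDl leNgt e0.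
  apply: le_limcdf => q xq; rewrite leNgt; apply/negP => h; apply: H.
  by exists q.
near=> y.
have xy : x <= y by apply: ltW; near: y; exact: nbhs_right_gt.
have yq : y < ratr q by near: y; exact: nbhs_right_lt.
rewrite distrC ger0_norm ?subr_ge0 ?limcdf_nondecreasing // ltrBlDl.
exact: le_lt_trans (limcdf_le yq) qe.
Unshelve. all: by end_near. Qed.

Lemma limcdf_neg x : x < 0 -> limcdf x = 0.
Proof.
move=> x0; apply/eqP; rewrite eq_le; apply/andP; split; last by apply: le_limcdf.
have [q] := rat_in_itvoo x0; rewrite in_itv /= => /andP[xq q0].
have -> : 0 = G q; last exact: limcdf_le.
have L := @FG q; rewrite (_ : (fun n => F n (ratr q)) = fun=> 0) in L; last first.
  by apply/funext => n; exact: Fneg.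
exact: cvg_unique (cvg_cst (0 : R)) L.
Qed.

Lemma limcdf_Ny : limcdf x @[x --> -oo] --> (0 : R).
Proof.
apply: cvg_near_cst; near=> x; apply: limcdf_neg.
by near: x; apply: nbhs_ninfty_lt; exact: num_real.
Unshelve. all: by end_near. Qed.

Lemma limcdf_y : limcdf x @[x --> +oo] --> (1 : R).
Proof.
apply/cvgrPdist_lt => e e0; near=> x.
have x0 : 0 < x by near: x; apply: nbhs_pinfty_gt; exact: num_real.
have xe : M / e < x by near: x; apply: nbhs_pinfty_gt; exact: num_real.
have l1 : limcdf x <= 1.
  have [q] : exists q : rat, ratr q \in `]x, x + 1[%R by apply: rat_in_itvoo; rewrite ltrDl.
  rewrite in_itv /= => /andP[xq _]; exact: le_trans (limcdf_le xq) (G_le1 q).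
rewrite ger0_norm ?subr_ge0 // ltrBlDl -ltrBlDr.
apply: (@lt_le_trans _ _ (1 - M / x)).
  by rewrite ltrD2l ltrN2 ltr_pdivrMr // mulrC -ltr_pdivrMr.
apply: le_limcdf => q xq; have q0 := lt_trans x0 xq.
apply: le_trans (G_tight q0); rewrite lerD2l lerN2 ler_wpM2l //.
by rewrite lef_pV2 ?posrE // ltW.
Unshelve. all: by end_near. Qed.

HB.instance Definition _ :=
  isCumulative.Build R _ R limcdf limcdf_nondecreasing limcdf_right_continuous.
HB.instance Definition _ :=
  isCumulativeBounded.Build R 0 1 limcdf limcdf_Ny limcdf_y.

Lemma limcdf_cvg x : {for x, continuous limcdf} -> F n x @[n --> \oo] --> limcdf x.
Proof.
move=> cx; apply/cvgrPdist_le => e e0.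
have e2 : 0 < e / 2 by rewrite divr_gt0.
have /cvgrPdist_lt /(_ _ e2) [r /= r0 rP] := cx.
have near_x y : `|x - y| < r -> `|limcdf x - limcdf y| < e / 2 by exact: rP.
have r2 : `|x - (x - r / 2)| < r by rewrite opprB addrC subrK ger0_norm ?divr_ge0 ?ltW //; lra.
have r2' : `|x - (x + r / 2)| < r by rewrite opprD addrA subrr sub0r normrN ger0_norm ?divr_ge0 ?ltW //; lra.
have h1 := near_x _ r2; have h2 := near_x _ r2'.
have [q1] : exists q : rat, ratr q \in `](x - r / 2), x[%R.
  by apply: rat_in_itvoo; rewrite ltrBlDr ltrDl divr_gt0.
have [q2] : exists q : rat, ratr q \in `]x, (x + r / 2)[%R.
  by apply: rat_in_itvoo; rewrite ltrDl divr_gt0.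
rewrite !in_itv /= => /andP[xq2 q2x] /andP[xq1 q1x].
have g1 := limcdf_le xq1.
have g2 : G q2 <= limcdf (x + r / 2).
  by apply: le_limcdf => q xq; apply: G_nd; exact: ltW (lt_trans q2x xq).
have /cvgrPdist_lt /(_ _ e2) n1 := @FG q1; have /cvgrPdist_lt /(_ _ e2) n2 := @FG q2.
near=> n.
have m1 : `|G q1 - F n (ratr q1)| < e / 2 by near: n.
have m2 : `|G q2 - F n (ratr q2)| < e / 2 by near: n.
have f1 := ndF n (ltW q1x); have f2 := ndF n (ltW xq2).
move: h1 h2 m1 m2; rewrite !ltr_norml ler_norml => /andP[a1 a2] /andP[b1 b2] /andP[c1 c2] /andP[d1 d2].
apply/andP; split; lra.
Unshelve. all: by end_near. Qed.

Definition pospart (w : measurableTypeR R) : R := Num.max w 0.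

Lemma measurable_pospart : measurable_fun [set: measurableTypeR R] pospart.
Proof. by apply: measurable_maxr => //; exact: measurable_id. Qed.

HB.instance Definition _ := isMeasurableFun.Build _ _ _ _ pospart measurable_pospart.

Let P : probability (measurableTypeR R) R := lebesgue_stieltjes_measure limcdf.

Lemma cdf_pospart x : cdf (pospart : {RV P >-> R}) x = (limcdf x)%:E.
Proof.
have [x0|x0] := ltP x 0.
  rewrite limcdf_neg // /cdf /distribution /pushforward.
  rewrite (_ : _ @^-1` _ = set0) ?measure0 //.
  apply/seteqP; split => // w /=; rewrite in_itv /= /pospart => h.
  by move: (lt_le_trans (le_lt_trans h x0) (lexx 0)); rewrite ltNge le_max lexx orbT.
rewrite -cdf_lebesgue_stieltjes_id /cdf /distribution /pushforward; congr (P _).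
by apply/seteqP; split => w /=; rewrite !in_itv /= /pospart ge_max x0 andbT.
Qed.

Lemma limit_law_exists : exists (P : probability (measurableTypeR R) R) (Z : {RV P >-> R}),
  (forall w, 0 <= Z w) /\
  forall x, {for x, continuous (fun x => fine (cdf Z x))} ->
    F n x @[n --> \oo] --> fine (cdf Z x).
Proof.
exists P, (pospart : {RV P >-> R}); split.
  by move=> w; rewrite /= /pospart le_max lexx orbT.
have e : (fun x => fine (cdf (pospart : {RV P >-> R}) x)) = limcdf.
  by apply/funext => x; rewrite cdf_pospart.
move=> x; rewrite cdf_pospart /= e; exact: limcdf_cvg.
Qed.

End limit_law.

Section moments_of_limit.
Variables (R : realType) (S : nat -> seq R) (m : nat -> R).
Hypothesis S1 : forall n, (0 < size (S n))%N.
Hypothesis S0 : forall n, all (>= 0) (S n).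
Hypothesis mS : forall r, emom (S n) r @[n --> \oo] --> m r.

Let emom_bounded r : exists2 M, 0 <= M & forall n, emom (S n) r <= M.
Proof.
have /cvg_seq_bounded [M [Mr MP]] : cvgn (fun n => emom (S n) r) by apply/cvg_ex; exists (m r).
exists (`|M| + 1); first by rewrite addr_ge0.
move=> n; apply: le_trans (ler_norm _) _; apply: (MP (`|M| + 1)) => //.
by rewrite (le_lt_trans (ler_norm _)) // ltrDl.
Qed.

Context d (T : measurableType d) (P : probability T R) (Z : {RV P >-> R}).
Hypothesis Z0 : forall w, 0 <= Z w.
Hypothesis cvgZ : forall x, {for x, continuous (fun x => fine (cdf Z x))} ->
  ecdf (S n) x @[n --> \oo] --> fine (cdf Z x).

Lemma measurable_etail (s : seq R) : (0 < size s)%N -> measurable_fun [set: R] (etail s).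
Proof.
move=> s0; have -> : etail s = (fun y => 1 - ecdf s y).
  by apply/funext => y; rewrite ecdfE // subKr.
apply: measurable_funB => //; apply: nondecreasing_measurable => //.
exact: ecdf_nondecreasing.
Qed.

Lemma integrable_oneDsqrV (C : R) :
  (@lebesgue_measure R).-integrable `[0, +oo[ (fun y => (C * (oneDsqr y)^-1)%:E).
Proof.
have i1 : (@lebesgue_measure R).-integrable `[0, +oo[ (fun y => ((oneDsqr y)^-1)%:E).
  apply/integrableP; split.
    apply/measurable_EFinP; apply: measurable_funTS; apply: continuous_measurable_fun.
    exact: continuous_oneDsqrV.
  apply: (@le_lt_trans _ _ (pi / 2)%:E); last exact: ltry.
  rewrite -integral0y_oneDsqr le_eqVlt; apply/orP; left; apply/eqP.
  by apply: eq_integral => y _ /=; rewrite ger0_norm // invr_ge0 ltW // oneDsqr_gt0.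
by apply: (integrableZl _ C i1); exact: measurable_itv.
Qed.

Let powRV_id (r : nat) (y : R) : (0 < r)%N -> 0 <= y -> (y `^ r%:R^-1) ^+ r = y.
Proof.
move=> r0 y0; rewrite -powR_mulrn ?powR_ge0 // -powRrM mulVf ?powRr1 //.
by rewrite pnatr_eq0 -lt0n.
Qed.

(** the tails of the powers converge almost everywhere under a Cauchy density *)
Lemma moments_of_limit : has_moments Z m.
Proof.
have mZ : measurable_fun [set: T] Z by [].
move=> r; case: (posnP r) => [->|r0].
  have -> : (fun w => (Z w ^+ 0)%:E) = cst 1%E by apply/funext => w; rewrite expr0.
  split; first exact: finite_measure_integrable_cst.
  rewrite (_ : (fun w => Z w ^+ 0) = cst 1); last by apply/funext => w; rewrite expr0.
  rewrite expectation_cst; congr (_%:E).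
  apply: (cvg_unique _ _ (@mS 0%N)) => //.
  rewrite (_ : (fun n => _) = cst 1); first exact: cvg_cst.
  apply/funext => n; rewrite /emom (eq_bigr (fun=> 1)) => [|v _]; last by rewrite expr0.
  by rewrite big_const_seq count_predT iter_addr_0 divff // pnatr_eq0 -lt0n.
have mU : measurable_fun [set: T] (fun w => Z w ^+ r) by exact: measurable_funX.
pose U : {RV P >-> R} := HB.pack (fun w => Z w ^+ r) (isMeasurableFun.Build _ _ _ _ _ mU).
have U0 w : 0 <= U w by rewrite /= exprn_ge0.
pose D : set R := `[0, +oo[%classic.
have mD : measurable D by exact: measurable_itv.
pose Sr n := [seq v ^+ r | v <- S n].
have Sr1 n : (0 < size (Sr n))%N by rewrite size_map.
have Sr0 n : all (>= 0) (Sr n).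
  apply/allP => _ /mapP[v /(allP (S0 n)) v0 ->]; exact: exprn_ge0.
have tailE n y : 0 <= y -> etail (Sr n) y = 1 - ecdf (S n) (y `^ r%:R^-1).
  move=> y0; rewrite ecdfE // subKr /etail size_map count_map; congr (_%:R / _).
  apply: eq_in_count => v /(allP (S0 n)) v0 /=.
  by rewrite -[X in X < _](powRV_id r0 y0) ltr_pXn2r ?nnegrE // powR_ge0.
have ccdfU y : 0 <= y -> ccdf U y = (1 - fine (cdf Z (y `^ r%:R^-1)))%:E.
  move=> y0; rewrite ccdf_1_cdf EFinB fineK; last by rewrite fin_num_measure.
  congr (_ - _)%E; rewrite /cdf /distribution /pushforward; congr (P _).
  have E w : (Z w ^+ r <= y) = (Z w <= y `^ r%:R^-1).
    by rewrite -[X in _ <= X](powRV_id r0 y0) ler_pXn2r ?nnegrE // powR_ge0.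
  by apply/seteqP; split => w /=; rewrite !in_itv /= E.
have [C C0 CP] := emom_bounded (2 * r).
have aecvg : {ae @lebesgue_measure R, forall y, D y ->
    (etail (Sr n) y)%:E @[n --> \oo] --> ccdf U y}.
  pose B := [set x ^+ r | x in [set x | ~ {for x, continuous (fun x => fine (cdf Z x))}]].
  have cB : countable B.
    apply: (sub_countable (card_image_le _ _)); apply: countable_not_continuous.
      by move=> x y xy; rewrite fine_le ?fin_num_measure // cdf_nondecreasing.
    move=> x; apply: fine_cvg; rewrite fineK ?fin_num_measure //.
    exact: cdf_right_continuous.
  exists B; split.
  - by apply: countable_measurable => // t; exact: measurable_set1.
  - exact: countable_lebesgue_measure0.
  move=> y /= Ny; apply: contrapT => By; apply: Ny.
  rewrite /D /= in_itv /= andbT => y0; rewrite ccdfU //.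
  apply: cvg_EFin; first exact: nearW.
  rewrite (_ : (fine \o _) = fun n => 1 - ecdf (S n) (y `^ r%:R^-1)); last first.
    by apply/funext => n /=; rewrite tailE.
  apply: cvgB; first exact: cvg_cst.
  apply: cvgZ; apply: contrapT => h; apply: By; exists (y `^ r%:R^-1) => //.
  exact: powRV_id.
have dom y n : D y -> (`|(etail (Sr n) y)%:E| <= ((1 + C) * (oneDsqr y)^-1)%:E)%E.
  rewrite /D /= in_itv /= andbT => y0; rewrite lee_fin ger0_norm ?etail_ge0 //.
  apply: le_trans (etail_cauchy (Sr1 n) (Sr0 n) y0) _.
  rewrite ler_wpM2r ?invr_ge0 ?(ltW (oneDsqr_gt0 _)) // lerD2l.
  apply: le_trans (CP n); rewrite /emom size_map big_map le_eqVlt; apply/orP; left.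
  by apply/eqP; congr (_ / _); apply: eq_bigr => v _; rewrite -exprM mulnC.
have [] := @dominated_convergence _ _ _ (@lebesgue_measure R) D mD
  (fun n y => (etail (Sr n) y)%:E) (ccdf U) (fun y => ((1 + C) * (oneDsqr y)^-1)%:E).
- by move=> n; apply/measurable_EFinP; apply: measurable_funTS; exact: measurable_etail.
- by apply: measurable_funTS; exact: ccdf_measurable.
- exact: aecvg.
- exact: integrable_oneDsqrV.
- by apply: aeW => y n; exact: dom.
move=> _ _ L.
have EU : ('E_P[U] = (m r)%:E)%E.
  rewrite ge0_expectation_ccdf //; apply: (cvg_unique _ L) => //=.
  rewrite (_ : (fun n => _) = fun n => (emom (S n) r)%:E).
    by apply: cvg_EFin; [exact: nearW|exact: mS].
  by apply/funext => n; rewrite integral_etail // emomX.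
split=> //; apply/integrableP; split; first exact/measurable_EFinP.
apply: (@le_lt_trans _ _ (m r)%:E); last exact: ltry.
rewrite -EU expectation_def le_eqVlt; apply/orP; left; apply/eqP.
by apply: eq_integral => w _ /=; rewrite ger0_norm // exprn_ge0.
Qed.

End moments_of_limit.

Section method_of_moments.
Variables (R : realType) (m : nat -> R).

Lemma cvg_reindex (u : nat -> R) (l : R) (f : nat -> nat) : (forall j, (j <= f j)%N) ->
  u n @[n --> \oo] --> l -> u (f j) @[j --> \oo] --> l.
Proof.
move=> fj ul; apply: (cvg_comp f u) ul => A [N _ NA]; exists N => // j /= Nj.
exact/NA/(leq_trans Nj).
Qed.

Lemma moment_subsequence (S : nat -> seq R) : (forall n, (0 < size (S n))%N) ->
  (forall n, all (>= 0) (S n)) -> (forall r, emom (S n) r @[n --> \oo] --> m r) ->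
  exists f : nat -> nat, (forall j, (j <= f j)%N) /\
  exists (P : probability (measurableTypeR R) R) (Z : {RV P >-> R}),
  [/\ forall w, 0 <= Z w, has_moments Z m & forall x,
    {for x, continuous (fun x => fine (cdf Z x))} ->
    ecdf (S (f j)) x @[j --> \oo] --> fine (cdf Z x)].
Proof.
move=> S1 S0 mS.
have F01 n x : 0 <= ecdf (S n) x <= 1 by rewrite ecdf_ge0 ecdf_le1.
have [f [fj [G FG]]] := helly_selection F01; exists f; split=> //.
have /cvg_seq_bounded [M [Mr MP]] : cvgn (fun n => emom (S n) 1) by apply/cvg_ex; exists (m 1%N).
have Mn n : emom (S n) 1 <= `|M| + 1.
  apply: le_trans (ler_norm _) _; apply: (MP (`|M| + 1)) => //.
  by rewrite (le_lt_trans (ler_norm _)) // ltrDl.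
have tight n x : 0 < x -> 1 - (`|M| + 1) / x <= ecdf (S (f n)) x.
  move=> x0; rewrite ecdfE // lerD2l lerN2 ler_pdivlMr //.
  by apply: le_trans (Mn (f n)); rewrite -[X in _ * X]expr1 etail_markov // ltW.
have [P [Z [Z0 ZP]]] := limit_law_exists (fun n => F01 (f n))
  (fun n => @ecdf_nondecreasing R (S (f n)))
  (fun n x => @ecdf_lt0 R (S (f n)) x (S0 _)) tight (addr_ge0 (normr_ge0 M) ler01) FG.
exists P, Z; split=> //; apply: (@moments_of_limit R (fun n => S (f n))) => // r.
exact: cvg_reindex (mS r).
Qed.

Lemma moment_limit (S : nat -> seq R) d (T : measurableType d) (P : probability T R)
    (Z : {RV P >-> R}) (K : R) :
  (forall n, (0 < size (S n))%N) -> (forall n, all (>= 0) (S n)) ->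
  (forall r, emom (S n) r @[n --> \oo] --> m r) ->
  has_moments Z m -> (forall w, 0 <= Z w) -> 0 < K ->
  (forall q, m q.*2 <= K ^+ q * (4 * q)`!%:R) ->
  forall x, {for x, continuous (fun x => fine (cdf Z x))} ->
  ecdf (S n) x @[n --> \oo] --> fine (cdf Z x).
Proof.
move=> S1 S0 mS mZ Z0 K0 mK x cx; apply/cvgrPdist_lt => e e0; apply: contrapT => H.
have far N : exists n, (N <= n)%N /\ e <= `|fine (cdf Z x) - ecdf (S n) x|.
  apply: contrapT => h; apply: H; exists N => // n /= Nn.
  by rewrite ltNge; apply/negP => en; apply: h; exists n.
have [g gP] := choice far.
have gj j : (j <= g j)%N by case: (gP j).
have [f [fj [P' [Z' [Z'0 mZ' cZ']]]]] := @moment_subsequence (fun n => S (g n))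
  (fun n => S1 _) (fun n => S0 _) (fun r => cvg_reindex gj (@mS r)).
have E y : cdf Z' y = cdf Z y.
  by apply: (determinacy mZ mZ' Z0 K0 mK); exact: measurable_itv.
have Ef : (fun x => fine (cdf Z' x)) = (fun x => fine (cdf Z x)).
  by apply/funext => y; rewrite E.
have := cZ' x; rewrite Ef E => /(_ cx) /cvgrPdist_lt /(_ _ e0) [N _ /(_ N (leqnn N))] /=.
by rewrite ltNge; case: (gP (f N)) => _ ->.
Qed.

End method_of_moments.

Section total_probability.
Context d (T : measurableType d) (R : realType) (P : probability T R).
Variable X : {RV P >-> plane_tree}.

Lemma measurable_state (A : set plane_tree) : measurable [set w | A (X w)].
Proof. by rewrite -[X in measurable X]setTI; apply: (measurable_funP X). Qed.

Lemma measurable_eqstate t : measurable [set w | X w = t].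
Proof. exact: (measurable_state [set t]). Qed.

Lemma prob_states (A : set T) (L : seq plane_tree) : measurable A -> uniq L ->
  P (A `&` [set w | X w \in L]) = (\sum_(t <- L) P (A `&` [set w | X w = t]))%E.
Proof.
move=> mA; elim: L => [_|t L IH /= /andP[tL uL]].
  rewrite big_nil (_ : _ `&` _ = set0) ?measure0 //.
  by apply/seteqP; split => // w [].
rewrite big_cons -IH // -measureU.
- congr (P _); apply/seteqP; split => w /=.
    by move=> [Aw]; rewrite inE => /orP[/eqP ->|wL]; [left|right].
  by move=> [[Aw ->]|[Aw wL]]; split=> //; rewrite inE ?eqxx // wL orbT.
- apply: measurableI => //; exact: measurable_eqstate.
- apply: measurableI => //; exact: (measurable_state [set t | t \in L]).
- apply/seteqP; split => // w /= [[_ e] [_]]; rewrite e => h.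
  by rewrite h in tL.
Qed.

Lemma total_probability (A : set T) (L : seq plane_tree) : measurable A -> uniq L ->
  (\sum_(t <- L) P [set w | X w = t] = 1)%E ->
  P A = (\sum_(t <- L) P (A `&` [set w | X w = t]))%E.
Proof.
move=> mA uL L1; rewrite -prob_states //.
have mL : measurable [set w | X w \in L] by exact: (measurable_state [set t | t \in L]).
have L1' : P [set w | X w \in L] = 1%E.
  rewrite -L1 -[X in P X]setTI prob_states //.
  by apply: eq_bigr => t _; rewrite setTI.
rewrite [LHS](measureDI P mA mL) -[RHS]add0e; congr (_ + _)%E.
apply: (@subset_measure0 _ _ _ _ _ (~` [set w | X w \in L])).
- exact: measurableD.
- exact: measurableC.
- by move=> w [].
by rewrite [LHS]probability_setC // L1' subee.
Qed.

End total_probability.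

Section process_law.
Context d (T : measurableType d) (R : realType) (P : probability T R).
Variables (n : nat) (X : nat -> {RV P >-> plane_tree}).
Hypothesis X1 : P [set w | X 1%N w = [:: [::]]] = 1%E.
Hypothesis XS : forall (i : nat) (t t' : plane_tree), (0 < i < n)%N ->
  P [set w | X i w = t /\ X i.+1 w = t'] =
  (P [set w | X i w = t] * (attach_prob R t t')%:E)%E.

Definition states i := [seq decode i h | h <- hist i.-1].

Lemma size_hist_gt0 i : (0 < size (hist i))%N.
Proof.
have := wsum1_gt0 R i; rewrite /wsum /uhist big_map big_const_seq count_predT iter_addr_0.
by rewrite -[1 *+ _]/(_%:R) ltr0n.
Qed.

Lemma size_states_gt0 i : (0 < size (states i))%N.
Proof. by rewrite size_map size_hist_gt0. Qed.

Lemma size_grow_hist i h : h \in hist i -> size (grow i.+1 h) = (2 * i).+1.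
Proof.
move=> hh; rewrite -(size_map (@shape nat)) grow_shape size_grow.
rewrite (@nleaves_uhist i); last by rewrite map_f.
by rewrite mulnS.
Qed.

Lemma size_histS i : size (hist i.+1) = ((2 * i).+1 * size (hist i))%N.
Proof.
rewrite /= size_flatten /seq.shape -map_comp sumnE big_map.
rewrite (eq_big_seq (fun=> (2 * i).+1)) => [|h hh]; last exact: size_grow_hist.
by rewrite big_const_seq count_predT iter_addn_0.
Qed.

Lemma attach_prob_decode i h t' : h \in hist i ->
  attach_prob R (decode i.+1 h) t' =
  (count_mem t' [seq decode i.+2 h' | h' <- grow i.+1 h])%:R / (2 * i).+1%:R.
Proof.
move=> hh; have wl := hist_well_labelled hh; have pa := perm_attach wl.
rewrite /attach_prob -(size_grow_hist hh) -(size_map (decode i.+2)).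
rewrite -(perm_size pa) size_map; congr (_%:R / _).
by rewrite -(permP pa (pred1 t')) count_map; apply: eq_count.
Qed.

Lemma sum_undup (s : seq plane_tree) (f : plane_tree -> R) :
  \sum_(t <- undup s) (count_mem t s)%:R * f t = \sum_(t <- s) f t.
Proof.
rewrite -[RHS]big_undup_iterop_count; apply: eq_bigr => t _.
exact: mulr_natl.
Qed.

Let state_law i t := (count_mem t (states i))%:R / (size (states i))%:R : R.

Let sum_state_law i (f : plane_tree -> R) :
  \sum_(t <- undup (states i)) state_law i t * f t =
  (\sum_(t <- states i) f t) / (size (states i))%:R.
Proof.
rewrite -sum_undup mulr_suml; apply: eq_bigr => t _; rewrite /state_law; ring.
Qed.

Let sum_state_law1 i : (\sum_(t <- undup (states i)) (state_law i t)%:E = 1)%E.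
Proof.
rewrite sumEFin -(eq_bigr _ (fun t _ => mulr1 (state_law i t))) sum_state_law.
rewrite big_const_seq count_predT iter_addr_0 divff //.
by rewrite pnatr_eq0 -lt0n size_states_gt0.
Qed.

(** every history of the process has the same probability *)
Lemma process_law i t : (0 < i <= n)%N -> P [set w | X i w = t] = (state_law i t)%:E.
Proof.
elim: i t => // -[_ t _|i IH t' /andP[_ iN]].
  have e1 : state_law 1 t = (([:: [::]] : plane_tree) == t)%:R.
    by rewrite /state_law /= addn0 divr1.
  rewrite e1; case: eqP => [<- //|ne].
  apply: (@subset_measure0 _ _ _ _ _ (~` [set w | X 1%N w = [:: [::]]])).
  - exact: measurable_eqstate.
  - apply: measurableC; exact: measurable_eqstate.
  - by move=> w /= ->; exact/nesym.
  rewrite [LHS]probability_setC; last exact: measurable_eqstate.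
  by rewrite X1 subee.
have i1 : (0 < i.+1 <= n)%N by rewrite /= ltnW.
have L1 : (\sum_(t <- undup (states i.+1)) P [set w | X i.+1 w = t] = 1)%E.
  by rewrite -(sum_state_law1 i.+1); apply: eq_bigr => t _; rewrite IH.
rewrite (total_probability (measurable_eqstate _ t') (undup_uniq (states i.+1)) L1).
rewrite (eq_bigr (fun t => (state_law i.+1 t * attach_prob R t t')%:E)); last first.
  move=> t _; rewrite EFinM -IH // -XS //; congr (P _).
  by apply/seteqP; split => w /= [].
rewrite sumEFin sum_state_law; congr (_%:E).
rewrite big_map (eq_big_seq (fun h => (2 * i).+1%:R^-1 *
    (count_mem t' [seq decode i.+2 h' | h' <- grow i.+1 h])%:R)); last first.
  by move=> h hh; rewrite attach_prob_decode // mulrC.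
rewrite -mulr_sumr -natr_sum /state_law.
have -> : count_mem t' (states i.+2) =
    (\sum_(h <- hist i) count_mem t' [seq decode i.+2 h' | h' <- grow i.+1 h])%N.
  by rewrite /states /= map_flatten count_flatten -!map_comp sumnE big_map.
rewrite !size_map /= -/(hist i.+1) size_histS natrM invfM; ring.
Qed.

Lemma process_cdf (f : plane_tree -> R) x : (0 < n)%N ->
  P [set w | f (X n w) <= x] = (ecdf [seq f t | t <- states n] x)%:E.
Proof.
move=> n0; have nn : (0 < n <= n)%N by rewrite n0 leqnn.
have L1 : (\sum_(t <- undup (states n)) P [set w | X n w = t] = 1)%E.
  by rewrite -(sum_state_law1 n); apply: eq_bigr => t _; rewrite process_law.
have mA : measurable [set w | f (X n w) <= x].
  exact: (measurable_state _ [set t | f t <= x]).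
rewrite (total_probability mA (undup_uniq (states n)) L1).
rewrite (eq_bigr (fun t => (state_law n t * (f t <= x)%R%:R)%:E)); last first.
  move=> t _; case: (boolP (f t <= x)) => fx.
    rewrite mulr1 -process_law //; congr (P _).
    by apply/seteqP; split => w /= => [[]//|->].
  rewrite mulr0 (_ : _ `&` _ = set0) ?measure0 //.
  by apply/seteqP; split => // w /= [+ e]; rewrite e (negbTE fx).
rewrite sumEFin sum_state_law /ecdf size_map count_map; congr (_ / _)%:E.
by rewrite -sum1_count natr_sum [RHS]big_mkcond; apply: eq_bigr => t _ /=; case: ifP.
Qed.

End process_law.

Section normalized_values.
Variables (R : realType) (k : nat).

Definition scaled_zagrebs n : seq R :=
  [seq (zag k t)%:R / Num.sqrt n.+1%:R ^+ k | t <- uhist n].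

Lemma size_scaled_zagrebs n : (0 < size (scaled_zagrebs n))%N.
Proof. by rewrite !size_map; exact: (size_hist_gt0 R). Qed.

Lemma scaled_zagrebs_ge0 n : all (>= 0) (scaled_zagrebs n).
Proof. by apply/allP => _ /mapP[t _ ->]; rewrite divr_ge0 ?exprn_ge0 ?sqrtr_ge0. Qed.

Lemma emom_scaled_zagrebs n r : emom (scaled_zagrebs n) r =
  emean n (fun t => (zag k t)%:R ^+ r) / Num.sqrt n.+1%:R ^+ (k * r).
Proof.
rewrite /emom /emean /wsum big_map size_map big_const_seq count_predT iter_addr_0.
rewrite mulrAC; congr (_ / _); rewrite mulr_suml; apply: eq_bigr => t _.
by rewrite exprMn exprVn -exprM.
Qed.

Lemma normalized_zagreb_decode n h : (0 < k)%N -> h \in hist n ->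
  normalized_zagreb R k n.+1 (decode n.+1 h) = (zag k (shape h))%:R / Num.sqrt n.+1%:R ^+ k.
Proof.
move=> k0 hh; rewrite /normalized_zagreb tree_zagreb_decode ?zag_shape //; last exact: hist_well_labelled.
congr (_ / _); rewrite mulrC powRrM powR_mulrn ?powR_ge0 //.
by rewrite powR12_sqrt.
Qed.

End normalized_values.

Theorem theorem4p1 (R : realType) (k : nat) (hk : k = 3%N \/ k = 4%N) :
  exists (d : measure_display) (Omega : measurableType d)
         (P : probability Omega R) (Z : {RV P >-> R}),
    [/\ has_moments Z (fun r => zagreb_array R k r 0),
        forall (d' : measure_display) (Omega' : measurableType d')
               (P' : probability Omega' R) (Z' : {RV P' >-> R}),
          has_moments Z' (fun r => zagreb_array R k r 0) ->
          forall A : set R, measurable A ->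
            distribution P' Z' A = distribution P Z A
      & forall (dn : nat -> measure_display)
               (Omegan : forall n, measurableType (dn n))
               (Pn : forall n, probability (Omegan n) R)
               (X : forall n, {RV (Pn n) >-> plane_tree}),
          (forall n, (0 < n)%N -> random_plane_recursive_tree n (X n)) ->
          cvg_in_distribution
            (fun n => (normalized_zagreb R k n \o X n : {RV (Pn n) >-> R})) Z].
Proof.
have k3 : (2 < k)%N by case: hk => ->.
have k4 : (k <= 4)%N by case: hk => ->.
have k0 : (0 < k)%N by exact: ltn_trans k3.
pose m r := zagreb_array R k r 0; pose S := scaled_zagrebs R k.
have S1 n : (0 < size (S n))%N by exact: size_scaled_zagrebs.
have S0 n : all (>= 0) (S n) by exact: scaled_zagrebs_ge0.
have mS r : emom (S n) r @[n --> \oo] --> m r.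
  rewrite (_ : (fun n => _) = fun n =>
    emean n (fun t => (zag k t)%:R ^+ r) / Num.sqrt n.+1%:R ^+ (k * r)).
    exact: emean_cvg.
  by apply/funext => n; rewrite emom_scaled_zagrebs.
have K0 : 0 < 16 * 256 :> R by rewrite mulr_gt0.
have mK q : m q.*2 <= (16 * 256) ^+ q * (4 * q)`!%:R by exact: zagreb_array_bound.
have [f [_ [P [Z [Z0 mZ _]]]]] := moment_subsequence S1 S0 mS.
exists _, _, P, Z; split=> //.
  by move=> d' T' P' Z' mZ'; exact: (determinacy mZ mZ' Z0 K0 mK).
move=> dn Tn Pn X hX x cx.
have cx' : {for x, continuous (fun x => fine (cdf Z x))}.
  by apply: fine_cvg; rewrite fineK ?fin_num_measure //; exact: cx.
have H := moment_limit S1 S0 mS mZ Z0 K0 mK cx'.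
rewrite -(cvg_shiftS (fun n => cdf (normalized_zagreb R k n \o X n : {RV (Pn n) >-> R}) x)).
have -> : cdf Z x = (fine (cdf Z x))%:E by rewrite fineK ?fin_num_measure.
rewrite (_ : (fun n => _) = fun n => (ecdf (S n) x)%:E); last first.
  apply/funext => n; have [T [T1 TS XE]] := hX n.+1 isT.
  have := process_cdf T1 TS (normalized_zagreb R k n.+1) x isT.
  rewrite -XE => e; transitivity (Pn n.+1 [set w | normalized_zagreb R k n.+1 (X n.+1 w) <= x]).
    rewrite /cdf /distribution /pushforward; congr (Pn n.+1 _).
  rewrite e; congr (ecdf _ _)%:E; rewrite /states /S /scaled_zagrebs /uhist -!map_comp.
  by apply/eq_in_map => h hh /=; exact: normalized_zagreb_decode.
by apply: cvg_EFin; [exact: nearW|exact: H].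
Qed.
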